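(* Let $d\ge2$, let $U\subset\mathbb{R}^d$ be a bounded open set, and let $q\in(2,\infty)$ if $d=2$, $q:=d$ if $d\ge3$. Let $\mathbf H\in L^q(U,\mathbb{R}^d)$ with $\|\mathbf H\|\le h$ in $U$, where $h\in L^q(U)$. Let $A=(a_{ij})_{1\le i,j\le d}$ be a (possibly non-symmetric) matrix of measurable functions on $\mathbb{R}^d$ such that for some constants $M>0,\lambda>0$, $\max_{i,j}|a_{ij}(x)|\le M$ and $\langle A(x)\xi,\xi\rangle\ge\lambda\|\xi\|^2$ for a.e. $x\in\mathbb{R}^d$ and all $\xi\in\mathbb{R}^d$. Let $\theta\in[0,\infty)$ be a constant and $c\in L^s(U)$ with $c\ge0$ a.e. in $U$, where $s\in(1,\infty)$ if $d=2$ and $s:=\frac d2$ if $d\ge3$. Let $T\in(0,\infty)$ and $g\in L^2(U)$. If $\mathbf u$ and $\mathbf v$ are weak solutions (in the sense of the context) to $$u_t-\operatorname{div}(A\nabla u)+\langle\mathbf H,\nabla u\rangle+(c+\theta)u=0\ \text{in }U\times(0,T),\quad u=0\ \text{on }\partial U\times[0,T],\quad u=g\ \text{on }U\times\{t=0\},$$ then $\mathbf u=\mathbf v$ in $L^2(0,T;H^{1,2}_0(U))$.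
   Context: $H^{1,2}_0(U)$ is the closure of $C_0^\infty(U)$ in the Sobolev space $H^{1,2}(U)$, normed by $\|u\|_{H^{1,2}_0(U)}:=\|\nabla u\|_{L^2(U)}$; $H^{-1,2}(U)$ is its dual, with duality pairing $\langle\cdot,\cdot\rangle_{H^{-1,2}(U)}$, and $L^2(U)$ is embedded in $H^{-1,2}(U)$ through the $L^2(U)$ inner product. $L^2(0,T;X)$ is the Bochner space. The statement $\mathbf u'\in L^2(0,T;H^{-1,2}(U))$ means that there is $\mathbf u'\in L^2(0,T;H^{-1,2}(U))$ with $\int_0^T\mathbf u'(t)\eta(t)dt=-\int_0^T\mathbf u(t)\eta'(t)dt$ in $H^{-1,2}(U)$ for all $\eta\in C_0^\infty((0,T))$. Weak solution: $\mathbf u$ is a weak solution to the initial-boundary value problem $$u_t-\operatorname{div}(A\nabla u)+\langle\mathbf H,\nabla u\rangle+(c+\theta)u=0\ \text{in }U\times(0,T),\quad u=0\ \text{on }\partial U\times[0,T],\quad u=g\ \text{on }U\times\{t=0\}$$ if: (1) $\mathbf u\in L^2(0,T;H^{1,2}_0(U))$ and $\mathbf u'\in L^2(0,T;H^{-1,2}(U))$; (2) for all $v\in H^{1,2}_0(U)$ and a.e. $t\in(0,T)$, $$\langle\mathbf u'(t),v\rangle_{H^{-1,2}(U)}+\int_U\langle A\nabla\mathbf u(t),\nabla v\rangle+\langle\mathbf H,\nabla\mathbf u(t)\rangle v+(c+\theta)\mathbf u(t)v\,dx=0;$$ (3) $\lim_{t\to0+}\mathbf u(t)=g$ in $L^2(U)$.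 (By (1), $\mathbf u$ has a version in $C([0,T];L^2(U))$, with which it is identified.) *)

(* Defs.v *)
From HB Require Import structures.
From mathcomp Require Import all_boot all_order all_algebra.
From mathcomp Require Import all_classical all_reals all_analysis.
From mathcomp Require Import measurable_realfun.

Set Implicit Arguments.
Unset Strict Implicit.
Unset Printing Implicit Defensive.

Import Order.TTheory GRing.Theory Num.Theory.
Import numFieldNormedType.Exports.

Local Open Scope classical_set_scope.
Local Open Scope ring_scope.

Definition measure_rV_display : measure_display.
Proof. exact. Qed.

(* As for tuples in the library, 'rV[R]_d carries the product of the Borel
   sigma-algebras of its coordinates, i.e. the Borel sigma-algebra. *)
Section measurable_rV.
Context (R : realType) (d : nat).

Definition rV_coord (i : 'I_d) (x : 'rV[R]_d) : R := x ord0 i.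

Let rV_set0 : g_sigma_preimage rV_coord set0.
Proof. exact: sigma_algebra0. Qed.

Let rV_setC A : g_sigma_preimage rV_coord A -> g_sigma_preimage rV_coord (~` A).
Proof. exact: sigma_algebraC. Qed.

Let rV_bigcup (F : (set 'rV[R]_d)^nat) :
  (forall i, g_sigma_preimage rV_coord (F i)) ->
  g_sigma_preimage rV_coord (\bigcup_i (F i)).
Proof. exact: sigma_algebra_bigcup. Qed.

HB.instance Definition _ := @isMeasurable.Build measure_rV_display
  'rV[R]_d (g_sigma_preimage rV_coord) rV_set0 rV_setC rV_bigcup.

End measurable_rV.

Lemma measurable_rV_coord (R : realType) d (i : 'I_d) :
  measurable_fun [set: 'rV[R]_d] (@rV_coord R d i).
Proof.
move=> _ Y mY; rewrite setTI; apply: sub_sigma_algebra => /=.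
rewrite -bigcup_seq/=; exists i => /=; first by rewrite mem_index_enum.
by exists Y => //; rewrite setTI.
Qed.

Lemma measurable_fun_rVP (R : realType) d d1 (T1 : measurableType d1)
    (f : T1 -> 'rV[R]_d) :
  (forall i, measurable_fun [set: T1] (fun x => f x ord0 i)) ->
  measurable_fun [set: T1] f.
Proof.
move=> mf; have prefS : g_sigma_preimage (fun i => @rV_coord R d i \o f)
    `<=` measurable.
  apply: smallest_sub; first exact: sigma_algebra_measurable.
  case: d f mf => [|d] f mf; first by rewrite big_ord0.
  rewrite -bigcup_mkord_ord; apply: bigcup_sub => i Ii.
  by move=> A [B mB <-]; exact: mf.
move=> _ A mA; apply: prefS; rewrite g_sigma_preimage_comp.
by exists A.
Qed.

Definition rV_cons (R : realType) d (p : R * 'rV[R]_d) : 'rV[R]_d.+1 :=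
  \row_i oapp (p.2 ord0) p.1 (unlift ord0 i).

Definition rV_uncons (R : realType) d (x : 'rV[R]_d.+1) : R * 'rV[R]_d :=
  (x ord0 ord0, \row_i x ord0 (lift ord0 i)).

Lemma measurable_rV_cons (R : realType) d :
  measurable_fun [set: R * 'rV[R]_d] (@rV_cons R d).
Proof.
apply: measurable_fun_rVP => i.
case: (unliftP ord0 i) => [j|] ->.
  rewrite (_ : (fun _ => _) = @rV_coord R d j \o snd); last first.
    by apply/funext => p /=; rewrite mxE liftK.
  exact: measurableT_comp (measurable_rV_coord j) measurable_snd.
rewrite (_ : (fun _ => _) = fst) //.
by apply/funext => p /=; rewrite mxE unlift_none.
Qed.

Lemma measurable_rV_uncons (R : realType) d :
  measurable_fun [set: 'rV[R]_d.+1] (@rV_uncons R d).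
Proof.
apply/measurable_fun_pairP; split; first exact: measurable_rV_coord.
apply: measurable_fun_rVP => i.
rewrite (_ : (fun _ => _) = @rV_coord R d.+1 (lift ord0 i)).
  exact: measurable_rV_coord.
by apply/funext => x /=; rewrite mxE.
Qed.

Lemma rV_consK (R : realType) d : cancel (@rV_cons R d) (@rV_uncons R d).
Proof.
move=> [a v]; rewrite /rV_uncons /rV_cons mxE unlift_none/=; congr pair.
by apply/rowP => i; rewrite !mxE liftK.
Qed.

Section rV_cons_measure.
Context (R : realType) (d : nat).
Variables (m1 : {sigma_finite_measure set (measurableTypeR R) -> \bar R})
  (m2 : {sigma_finite_measure set 'rV[R]_d -> \bar R}).

Definition rV_cons_measure : set 'rV[R]_d.+1 -> \bar R :=
  pushforward (m1 \x m2)%E (@rV_cons R d).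

Let rV_cons_pushforward : {measure set 'rV[R]_d.+1 -> \bar R} :=
  measure_function_pushforward__canonical__measure_function_Measure
    (m1 \x m2)%E (@measurable_rV_cons R d).

HB.instance Definition _ := isMeasure.Build _ _ _ rV_cons_measure
  (measure0 rV_cons_pushforward) (measure_ge0 rV_cons_pushforward)
  (@measure_semi_sigma_additive _ _ _ rV_cons_pushforward).

Let rV_cons_measure_sigma_finite : sigma_finite setT rV_cons_measure.
Proof.
have /sigma_finiteP[F [TF ndF Foo]] := sigma_finiteT m1.
have /sigma_finiteP[G [TG ndG Goo]] := sigma_finiteT m2.
exists (fun n => @rV_uncons R d @^-1` (F n `*` G n)).
  apply/seteqP; split => // x _.
  have : setT (rV_uncons x).1 by [].
  have : setT (rV_uncons x).2 by [].
  rewrite TF TG => -[k _ Gk] [n _ Fn]; exists (maxn n k) => //; split.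
    by move: Fn; exact/subsetPset/ndF/leq_maxl.
  by move: Gk; exact/subsetPset/ndG/leq_maxr.
move=> n; have [mF Fn] := Foo n; have [mG Gn] := Goo n; split.
  rewrite -[X in measurable X]setTI.
  by apply: measurable_rV_uncons => //; exact: measurableX.
rewrite /rV_cons_measure /pushforward -comp_preimage.
rewrite (_ : _ @^-1` _ = F n `*` G n); last first.
  by rewrite (_ : _ \o _ = id)//; apply/funext => p; exact: rV_consK.
by rewrite product_measure1E// lte_mul_pinfty// ge0_fin_numE.
Qed.

HB.instance Definition _ := Measure_isSigmaFinite.Build _ _ _ rV_cons_measure
  rV_cons_measure_sigma_finite.

End rV_cons_measure.

Fixpoint lebesgue_rV (R : realType) (d : nat) :
    {sigma_finite_measure set 'rV[R]_d -> \bar R} :=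
  match d with
  | 0 => \d_(0 : 'rV[R]_0)
  | d'.+1 => rV_cons_measure (@lebesgue_measure R) (lebesgue_rV R d')
  end.

Lemma lebesgue_rV_box (R : realType) d (A : 'I_d -> set R) :
  (forall i, measurable (A i)) ->
  lebesgue_rV R d [set x | forall i, A i (x ord0 i)] =
  (\prod_(i < d) lebesgue_measure (A i))%E.
Proof.
elim: d A => [|d IH] A mA.
  by rewrite big_ord0 /= diracE mem_set// => -[].
rewrite big_ord_recl /= /rV_cons_measure /pushforward.
have mB : measurable [set x : 'rV[R]_d | forall i, A (lift ord0 i) (x ord0 i)].
  rewrite (_ : mkset _ =
    \bigcap_(i in [set: 'I_d]) (@rV_coord R d i @^-1` A (lift ord0 i))).
    apply: fin_bigcap_measurable => // i _; rewrite -[X in measurable X]setTI.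
    exact: measurable_rV_coord.
  by apply/seteqP; split => [x Ax i _|x Ax i]; [exact: Ax|exact: (Ax i)].
rewrite -(IH (fun i => A (lift ord0 i)))// -product_measure1E//; last exact: mA.
congr product_measure1; apply/seteqP; split => -[a v] /=.
- move=> Av; split => [|i] /=.
    by have := Av ord0; rewrite mxE unlift_none.
  by have := Av (lift ord0 i); rewrite mxE liftK.
- move=> [Aa Av] i; rewrite mxE /=.
  by case: (unliftP ord0 i) => [j|] -> //=.
Qed.

(* With respect to the completion of the Borel sigma-algebra. *)
Definition Lebesgue_measurable (R : realType) d (f : 'rV[R]_d -> R) : Prop :=
  measurable_fun
    [set: g_sigma_algebraType (completed_algebra_gen (lebesgue_rV R d))] f.

Definition dot (R : realType) d (x y : 'rV[R]_d) : R :=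
  \sum_(i < d) x ord0 i * y ord0 i.

Definition eucl_norm (R : realType) d (x : 'rV[R]_d) : R := Num.sqrt (dot x x).

Section test_functions.
Context (R : realType) (d : nat).
Implicit Types (U : set 'rV[R]_d) (f : 'rV[R]_d -> R).

Definition pderiv (i : 'I_d) f : 'rV[R]_d -> R :=
  fun x => 'D_(delta_mx ord0 i) f x.

Definition smooth f : Prop := forall s : seq 'I_d,
  continuous (foldr pderiv f s) /\
  forall i x, derivable (foldr pderiv f s) x (delta_mx ord0 i).

Definition test_fun U f : Prop :=
  [/\ smooth f, compact (closure [set x | f x != 0]) &
      closure [set x | f x != 0] `<=` U].

End test_functions.

Definition test_fun1 (R : realType) (D : set R) (eta : R -> R) : Prop :=
  [/\ forall n t, derivable (derive1n n eta) t 1,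
      compact (closure [set t | eta t != 0]) &
      closure [set t | eta t != 0] `<=` D].

(* A normed space presented by representatives: a subspace [sp_mem] of an
   ambient vector space, two members being identified when the seminorm
   [sp_norm] of their difference vanishes.  Values of [sp_norm] outside
   [sp_mem] carry no meaning. *)
Record space (R : realType) := Space {
  sp_sort :> lmodType R;
  sp_mem : set sp_sort;
  sp_norm : sp_sort -> \bar R }.

Section dual.
Context (R : realType) (X : space R).

Definition bounded_functional (l : X -> R) : Prop :=
  (forall (a : R) (u v : X), sp_mem u -> sp_mem v ->
     l (a *: u + v) = a * l u + l v) /\
  exists C : R, forall v : X, sp_mem v -> (`|l v|%:E <= C%:E * sp_norm v)%E.

Definition dual_norm (l : X -> R) : \bar R :=
  ereal_sup [set `|l v|%:E | v in [set v | sp_mem v /\ (sp_norm v <= 1)%E]].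

Definition dual : space R :=
  @Space R (X -> R : lmodType R) bounded_functional dual_norm.

End dual.

Section bochner.
Context (R : realType) (X : space R).
Implicit Types (D : set R) (f : R -> X).

Record simple_fun := SimpleFun {
  sf_size : nat;
  sf_piece : 'I_sf_size -> set (measurableTypeR R);
  sf_value : 'I_sf_size -> X;
  sf_piece_measurable : forall i, measurable (sf_piece i);
  sf_value_mem : forall i, sp_mem (sf_value i) }.

Arguments sf_piece s i : clear implicits.
Arguments sf_value s i : clear implicits.

Definition sf_eval (s : simple_fun) (t : R) : X :=
  \sum_i \1_(sf_piece s i) t *: sf_value s i.

Definition sf_integral D (s : simple_fun) : X :=
  \sum_i fine (lebesgue_measure (D `&` sf_piece s i)) *: sf_value s i.

Definition strongly_measurable D f : Prop :=
  exists s : nat -> simple_fun,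
    \forall t \ae @lebesgue_measure R, D t ->
      sp_mem (f t) /\ sp_norm (f t - sf_eval (s n) t) @[n --> \oo] --> 0%E.

Definition is_bochner_integral D f (I : X) : Prop :=
  [/\ strongly_measurable D f, sp_mem I &
      exists s : nat -> simple_fun,
        (\int[lebesgue_measure]_(t in D) sp_norm (f t - sf_eval (s n) t))%E
          @[n --> \oo] --> 0%E /\
        sp_norm (I - sf_integral D (s n)) @[n --> \oo] --> 0%E].

Definition bochner_L2 D f : Prop :=
  strongly_measurable D f /\
  (\int[lebesgue_measure]_(t in D) (sp_norm (f t) ^+ 2) < +oo)%E.

End bochner.

Section sobolev.
Context (R : realType) (d : nat) (U : set 'rV[R]_d).
Local Notation mu := (lebesgue_rV R d).
Implicit Types (u v : 'rV[R]_d -> R) (G : 'rV[R]_d -> 'rV[R]_d).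

(* Functions on U are represented by functions on R^d whose values outside U
   are ignored: [f \_ U] is the extension of f from U by zero. *)
Definition Lp (p : R) u : Prop := u \_ U \in Lfun mu p%:E.

Definition L2_norm u : \bar R := 'N[mu]_2%:E [EFin \o (u \_ U)]%E.

Definition L2 : space R := @Space R ('rV[R]_d -> R : lmodType R) (Lp 2) L2_norm.

Definition is_weak_grad u G : Prop :=
  forall i : 'I_d, Lp 2 (fun x => G x ord0 i) /\
    forall phi, test_fun U phi ->
      \int[mu]_(x in U) (u x * pderiv i phi x) =
      - \int[mu]_(x in U) (G x ord0 i * phi x).

Definition H12_mem u : Prop := Lp 2 u /\ exists G, is_weak_grad u G.

(* For u in H^{1,2}(U) the gradient is unique up to a null subset of U; for
   other u the value carries no meaning. *)
Definition weak_grad u : 'rV[R]_d -> 'rV[R]_d :=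
  xget (cst 0) [set G | is_weak_grad u G].

Definition grad_norm u : \bar R := L2_norm (fun x => eucl_norm (weak_grad u x)).

Definition H12_norm u : \bar R :=
  ((L2_norm u ^+ 2 + grad_norm u ^+ 2) `^ 2^-1)%E.

Definition H120_mem u : Prop :=
  H12_mem u /\
  forall e : R, 0 < e -> exists2 phi, test_fun U phi &
    (H12_norm (u - phi)%R < e%:E)%E.

Definition H120 : space R :=
  @Space R ('rV[R]_d -> R : lmodType R) H120_mem grad_norm.

Definition Hm12 : space R := dual H120.

(* The embedding of L^2(U) into H^{-1,2}(U) through the L^2(U) inner product. *)
Definition L2_to_Hm12 u : Hm12 :=
  (fun v : 'rV[R]_d -> R => \int[mu]_(x in U) (u x * v x)).

End sobolev.

Section weak_solution.
Context (R : realType) (d : nat) (U : set 'rV[R]_d) (T : R).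
Local Notation mu := (lebesgue_rV R d).
Local Notation TI := (`]0, T[%classic : set R).
Local Notation cTI := (`[0, T]%classic : set R).
Local Notation leb := (@lebesgue_measure R).

Definition is_time_derivative (u : R -> H120 U) (u' : R -> Hm12 U) : Prop :=
  forall eta : R -> R, test_fun1 TI eta ->
    exists2 I : Hm12 U,
      is_bochner_integral TI (fun t => eta t *: u' t) I &
      is_bochner_integral TI
        (fun t => derive1 eta t *: (L2_to_Hm12 (u t) : Hm12 U)) (- I).

(* Two elements of C([0,T]; L^2(U)) that agree a.e. in (0,T) are equal, so the
   version w of u is unique. *)
Definition is_continuous_version (u : R -> H120 U) (w : R -> L2 U) : Prop :=
  [/\ forall t, cTI t -> sp_mem (w t),
      forall t, cTI t ->
        sp_norm (w s - w t) @[s --> within cTI (nbhs t)] --> 0%E &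
      \forall t \ae leb, TI t -> ae_eq mu U (u t) (w t)].

Definition weak_solution (A : 'rV[R]_d -> 'M[R]_d) (H : 'rV[R]_d -> 'rV[R]_d)
    (c : 'rV[R]_d -> R) (theta : R) (g : L2 U) (u : R -> H120 U) : Prop :=
  [/\ bochner_L2 TI u,
      exists u' : R -> Hm12 U,
        [/\ bochner_L2 TI u', is_time_derivative u u' &
          forall v : H120 U, sp_mem v ->
            \forall t \ae leb, TI t ->
              u' t v + \int[mu]_(x in U)
                (dot (weak_grad U (u t) x *m (A x)^T) (weak_grad U v x)
                 + dot (H x) (weak_grad U (u t) x) * v x
                 + (c x + theta) * u t x * v x) = 0] &
      exists w : R -> L2 U,
        is_continuous_version u w /\
        sp_norm (w t - g) @[t --> 0^'+] --> 0%E].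

(* Elements of L^2(0,T;H^{1,2}_0(U)) are classes modulo equality for a.e. t, and
   elements of H^{1,2}_0(U) are classes modulo equality a.e. in U. *)
Definition bochner_H120_eq (u v : R -> H120 U) : Prop :=
  \forall t \ae leb, TI t -> ae_eq mu U (u t) (v t).

End weak_solution.

(* Main.v *)
(* By linearity, the difference w of two solutions satisfies, for every v in
   H^{1,2}_0(U) and almost every t,
     (w(t), v) = - a(S(t), v)   with   S(t) = int_0^t w,
   where a is the elliptic form: testing the time derivative with smooth bumps
   on (alpha, beta) that increase to the indicator function turns it into an
   increment of the continuous version, and alpha -> 0 brings in the common
   initial value.  Since S' = w and a does not depend on time,
     d/dt |S|^2 = 2 (w, S) = - 2 a(S, S) <= 2 K |S|^2
   by Garding's inequality, so S = 0 and w = 0.  This avoids the energy identity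
   for w itself; S is replaced by the finite combinations given by simple
   functions approximating w, and the differential inequality by a discrete
   Gronwall inequality.

   The boundedness of a and Garding's inequality rest on
     int V phi^2 <= C |grad phi|^2   for V in L^s(U), s > 1, 2 s >= d,
   obtained from the Gagliardo inequality applied to a power of |phi|; truncating
   V gives an arbitrarily small constant at the price of a multiple of |phi|^2. *)

Require Import Defs.
From HB Require Import structures.
From mathcomp Require Import all_boot all_order all_algebra.
From mathcomp Require Import all_classical all_reals all_analysis.
From mathcomp Require Import measurable_realfun ring lra.

Set Implicit Arguments.
Unset Strict Implicit.
Unset Printing Implicit Defensive.

Import Order.TTheory GRing.Theory Num.Theory.
Import numFieldNormedType.Exports.

Local Open Scope classical_set_scope.
Local Open Scope ring_scope.

(** * Almost everywhere comparison and Borel versions *)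

(** The primitive S cannot be treated directly, for two reasons. For each test function the equation
    holds off a null set of times that depends on it, so it cannot simply be tested with the moving
    element S(t). And S(t), as an integral with values in H^{1,2}_0, would call for completeness of
    a space that is given only by representatives and a seminorm. On a time grid each step has one
    fixed test function S(c'), and for a simple function the integral is a finite combination,
    through which linear functionals pass by algebra alone. The approximation enters only through
    the integral E of a majorant of its error: the grid is fixed first, then E tends to 0, and the
    remaining error is small by the choice of the grid. The first obstacle returns at the end, where
    (w(t), v) = 0 holds for each v off its own null set; the countably many values of the
    approximating simple functions then serve as a dense set. *)

Section lower_integral.
Context d (T : measurableType d) (R : realType).
Variable mu : {measure set T -> \bar R}.
Implicit Types (f g : T -> \bar R) (D : set T).
Import HBNNSimple.
Local Open Scope ereal_scope.

(* The library integral of a nonnegative function is a supremum over the simple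
   functions below it, hence these two lemmas hold without measurability. *)
Lemma ae_le_integral_lower D f g : (forall x, D x -> 0 <= f x) ->
  (forall x, D x -> 0 <= g x) -> (\forall x \ae mu, D x -> f x <= g x) ->
  \int[mu]_(x in D) f x <= \int[mu]_(x in D) g x.
Proof.
move=> f0 g0 [N [mN N0 fgN]].
rewrite 2?ge0_integralE//; apply: ge_ereal_sup => _ [k /= kf <-].
(* Cutting [k] to zero on the null set [N] puts it below [g] everywhere and keeps its integral. *)
apply: ereal_sup_ubound; exists (proj_nnsfun k (measurableC mN)) => /=.
  move=> x; rewrite mindicE.
  have g0x : 0 <= (g \_ D) x by rewrite patchE; case: ifPn => // /set_mem/g0.
  have [/set_mem xN|_] := boolP (x \in ~` N); last by rewrite mulr0.
  rewrite mulr1 (le_trans (kf x))//; rewrite !patchE; case: ifPn => // /set_mem Dx.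
  by apply: contrapT => fg; apply: xN; apply: fgN => /=; move/(_ Dx).
rewrite -!integralT_nnsfun; apply: ge0_ae_eq_integral => //.
- by apply/measurable_EFinP; exact: measurable_funP.
- by apply/measurable_EFinP; exact: measurable_funP.
- by move=> x _; rewrite lee_fin; exact: fun_ge0.
- by move=> x _; rewrite lee_fin; exact: fun_ge0.
exists N; split => // x /= /not_implyP[_]; apply: contra_notP => xN.
by rewrite mindicE (_ : _ \in _) ?mulr1//; exact/mem_set.
Qed.

Lemma ae_eq_integral_lower D f g : (\forall x \ae mu, D x -> f x = g x) ->
  \int[mu]_(x in D) f x = \int[mu]_(x in D) g x.
Proof.
move=> fg; rewrite integralE [RHS]integralE.
have H (h1 h2 : T -> \bar R) : (forall x, 0 <= h1 x) -> (forall x, 0 <= h2 x) ->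
    (\forall x \ae mu, D x -> h1 x = h2 x) ->
    \int[mu]_(x in D) h1 x = \int[mu]_(x in D) h2 x.
  move=> h10 h20 h12; apply/eqP; rewrite eq_le; apply/andP; split;
    apply: ae_le_integral_lower => //; apply: filterS h12 => x /[apply] -> //.
have /ae_eq_funeposneg[fgp fgn] : ae_eq mu D f g by [].
by congr (_ - _); apply: H.
Qed.

Lemma ae_eq_Rintegral D (f g : T -> R) :
  (\forall x \ae mu, D x -> f x = g x) ->
  (\int[mu]_(x in D) f x = \int[mu]_(x in D) g x)%R.
Proof.
move=> fg; congr fine; apply: ae_eq_integral_lower.
by apply: filterS fg => x /[apply] ->.
Qed.

End lower_integral.

Section completion.
Context d (T : measurableType d) (R : realType).
Variable mu : {measure set T -> \bar R}.

(** The sets that agree a.e. with a measurable set form a sigma-algebra, and it contains the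
    generators, which are unions of a measurable and a negligible set. *)
Lemma completed_measurable_ae (A : set T) :
  (completed_algebra_gen mu).-sigma.-measurable A ->
  exists2 B : set T, measurable B & \forall x \ae mu, A x <-> B x.
Proof.
apply: (@smallest_sub _ _ _
  [set A | exists2 B : set T, measurable B & \forall x \ae mu, A x <-> B x]).
  split => /=.
  - by exists set0 => //; apply: aeW.
  - move=> E [B mB EB]; exists (~` B); first exact: measurableC.
    by apply: filterS EB => x /= EBx; split => [[_ nx] /EBx//|nx]; split => // /EBx.
  - move=> E BE; have /choice[B /all_and2[mB EB]] : forall n, exists B : set T,
        measurable B /\ \forall x \ae mu, E n x <-> B x.
      by move=> n; have [B] := BE n; exists B.
    exists (\bigcup_n B n); first exact: bigcup_measurable.
    have /= := ae_foralln EB; apply: filterS => x EBx.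
    by split => -[n _ nx]; exists n => //; exact/EBx.
move=> _ [B mB] [N [M [mM M0 NM]]] <-; exists B => //.
exists M; split => // x /= H; apply: contrapT => Mx; apply: H.
by split; [move=> [//|/NM]|left].
Qed.

(** Off one null set, common to all rationals, every superlevel set of [f] at a rational height is
    measurable; setting [f] to 0 there gives [g]. This replaces the Lebesgue measurable coefficients
    by Borel ones. *)
Lemma completed_measurable_fun_ae (f : T -> R) :
  measurable_fun [set: g_sigma_algebraType (completed_algebra_gen mu)] f ->
  exists2 g : T -> R, measurable_fun [set: T] g & \forall x \ae mu, f x = g x.
Proof.
move=> mf.
have /choice[B /all_and2[mB fB]] : forall q : rat, exists B : set T,
    measurable B /\ \forall x \ae mu, ratr q < f x <-> B x.
  move=> q; have := mf measurableT `]ratr q, +oo[%classic (measurable_itv _).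
  rewrite setTI => /completed_measurable_ae[B mB fB]; exists B; split => //.
  by apply: filterS fB => x; rewrite /preimage/= in_itv/= andbT.
have [N [mN N0 NfB]] : \forall x \ae mu, forall q : rat, ratr q < f x <-> B q x.
  pose P n x := if unpickle n is Some q then ratr q < f x <-> B q x else True.
  have : \forall x \ae mu, forall n, P n x.
    apply: ae_foralln => n; rewrite /P; case: unpickle => [q|]; first exact: fB.
    exact: aeW.
  by apply: filterS => x Px q; have := Px (pickle q); rewrite /P pickleK.
have {}NfB x : ~ N x -> forall q, ratr q < f x <-> B q x.
  by move=> Nx; apply: contrapT => H; apply: Nx; exact: NfB.
pose g x := if x \in N then 0 else f x.
exists g; last first.
  exists N; split => // x /=; apply: contra_notP => Nx.
  by rewrite /g memNset.
apply: (measurability (@RGenOInfty.G R)); first exact: RGenOInfty.measurableE.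
move=> _ [_ [y ->] <-]; rewrite setTI.
(* On [N] the value is 0, so [N] belongs to the superlevel set exactly when [y < 0]. *)
rewrite (_ : _ @^-1` _ = (if y < 0 then N else set0) `|`
  \bigcup_(q in [set q : rat | y < ratr q]) (B q `\` N)).
  apply: measurableU; first by case: ifP.
  rewrite bigcup_mkcond; apply: bigcupT_measurable_rat => q.
  by case: ifP => // _; exact: measurableD.
apply/seteqP; split => [x|x].
  rewrite /preimage/= in_itv/= andbT /g; case: ifPn => [/set_mem Nx y0|].
    by left; rewrite y0.
  rewrite notin_setE => Nx yf; right.
  have /rat_in_itvoo[q] := yf; rewrite in_itv/= => /andP[yq qf].
  by exists q => //; split => //; exact/NfB.
rewrite /preimage/= in_itv/= andbT /g => -[|[q /= yq [Bq Nx]]].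
  by case: ifPn => // y0 Nx; rewrite mem_set.
by rewrite memNset// (lt_trans yq)//; exact/NfB.
Qed.

End completion.

(** * Boxes and the Borel sets of R^d *)

Section rV_boxes.
Context (R : realType) (d : nat).
Implicit Types (a b : 'I_d -> R) (O : set 'rV[R]_d).

Definition open_box a b : set 'rV[R]_d :=
  [set x | forall i, `]a i, b i[%classic (x ord0 i)].

Definition closed_box a b : set 'rV[R]_d :=
  [set x | forall i, `[a i, b i]%classic (x ord0 i)].

Lemma open_boxI a b a' b' : open_box a b `&` open_box a' b' =
  open_box (fun i => Num.max (a i) (a' i)) (fun i => Num.min (b i) (b' i)).
Proof.
apply/seteqP; split => [x [xab xab'] i|x xab].
  have := xab i; have := xab' i; rewrite /= !in_itv/= gt_max lt_min.
  by move=> /andP[? ?] /andP[? ?]; apply/and3P; split => //; apply/andP.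
by split=> i; have := xab i; rewrite /= !in_itv/= gt_max lt_min;
  move=> /andP[/andP[? ?] /andP[? ?]]; apply/andP.
Qed.

Lemma sub_open_closed_box a b : open_box a b `<=` closed_box a b.
Proof. by move=> x xab i; exact/subset_itv_oo_cc/xab. Qed.

Definition rat_lo (p : 'rV[rat]_d * nat) i : R := ratr (p.1 ord0 i) - p.2.+1%:R^-1.
Definition rat_hi (p : 'rV[rat]_d * nat) i : R := ratr (p.1 ord0 i) + p.2.+1%:R^-1.

(** The inclusion is asked of the closed boxes, so that a bump supported in such a box is a test
    function on [O]. *)
Lemma open_bigcup_rat_box O : open O ->
  O = \bigcup_(p in [set p | closed_box (rat_lo p) (rat_hi p) `<=` O])
        open_box (rat_lo p) (rat_hi p).
Proof.
move=> oO; apply/seteqP; split => [x Ox|x [p /= pO xp]]; last first.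
  exact/pO/sub_open_closed_box.
have /nbhs_ballP[e /= e0 xeO] : nbhs x O by exact: open_nbhs_nbhs.
have [n ne] : exists n : nat, n.+1%:R^-1 < e / 2.
  have /ltr_add_invr[k] : 0 < e / 2 by rewrite divr_gt0.
  by rewrite add0r => ?; exists k.
have /choice[q xq] : forall i, exists q : rat, `|x ord0 i - ratr q| < n.+1%:R^-1.
  move=> i; have [|q] := @rat_in_itvoo R (x ord0 i - n.+1%:R^-1) (x ord0 i + n.+1%:R^-1).
    by rewrite ltrD2l gtrN// invr_gt0.
  by rewrite in_itv/= -ltr_distl distrC; exists q.
exists (\row_i q i, n) => [y /= yp|i /=]; last first.
  by rewrite in_itv/= /rat_lo /rat_hi/= mxE -ltr_distl; exact: xq.
apply: xeO; split => // i0 i; rewrite ord1 /ball/=.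
rewrite (le_lt_trans (ler_distD (ratr (q i)) _ _))// (splitr e).
apply: ltrD; first exact: (lt_trans (xq i) ne).
have := yp i; rewrite /= in_itv/= /rat_lo /rat_hi/= mxE -ler_distl distrC.
by move/le_lt_trans; exact.
Qed.

Lemma measurable_open_box a b : measurable (open_box a b).
Proof.
rewrite (_ : open_box a b =
    \bigcap_(i in [set: 'I_d]) (@rV_coord R d i @^-1` `]a i, b i[%classic)).
  apply: fin_bigcap_measurable => // i _; rewrite -[X in measurable X]setTI.
  exact: measurable_rV_coord.
by apply/seteqP; split => [x xab i _|x xab i]; [exact: xab|exact: (xab i)].
Qed.

Lemma open_measurable_rV O : open O -> measurable O.
Proof.
move=> oO; rewrite (open_bigcup_rat_box oO) bigcup_mkcond.
apply: countable_bigcupT_measurable => // p.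
by case: ifP => // _; exact: measurable_open_box.
Qed.

Definition open_boxes : set (set 'rV[R]_d) := [set open_box p.1 p.2 | p in setT].

(** Open boxes are stable under intersection, so this lets an identity known on boxes spread to all
    Borel sets by a Dynkin argument. *)
Lemma measurable_rV_open_boxes : @measurable _ 'rV[R]_d `<=` <<s open_boxes >>.
Proof.
pose f (x : g_sigma_algebraType open_boxes) : 'rV[R]_d := x.
have mf : measurable_fun setT f.
  apply: measurable_fun_rVP => i; apply: (measurability (@RGenOInfty.G R)).
    exact: RGenOInfty.measurableE.
  move=> _ [_ [y ->] <-]; rewrite setTI.
  have /open_bigcup_rat_box -> : open ((fun x : 'rV[R]_d => x ord0 i) @^-1` `]y, +oo[%classic).
    by apply: (open_comp (fun x _ => @coord_continuous _ _ _ ord0 i x)); exact: rray_open.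
  rewrite bigcup_mkcond; apply: countable_bigcupT_measurable => // p.
  by case: ifP => // _; apply: sub_sigma_algebra; exists (rat_lo p, rat_hi p).
by move=> A mA; have := mf measurableT A mA; rewrite setTI.
Qed.

Lemma continuous_measurable_rV (f : 'rV[R]_d -> R) :
  continuous f -> measurable_fun [set: 'rV[R]_d] f.
Proof.
move=> /continuousP cf; apply: (measurability (@RGenOpens.G R)).
  exact: RGenOpens.measurableE.
by move=> _ [_ [y [z ->]] <-]; rewrite setTI; apply: open_measurable_rV; exact/cf/interval_open.
Qed.
End rV_boxes.

(** * Tonelli along lines and the Gagliardo inequality *)

Lemma hoelder_ge0 d (T : measurableType d) (R : realType)
    (mu : {measure set T -> \bar R}) (f g : T -> R) (p q : R) :
  measurable_fun [set: T] f -> measurable_fun [set: T] g ->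
  (forall x, 0 <= f x) -> (forall x, 0 <= g x) ->
  0 < p -> 0 < q -> p^-1 + q^-1 = 1 ->
  (\int[mu]_x (f x * g x)%:E <=
   (\int[mu]_x (f x `^ p)%:E) `^ p^-1 * (\int[mu]_x (g x `^ q)%:E) `^ q^-1)%E.
Proof.
move=> mf mg f0 g0 p0 q0 pq.
have := @hoelder _ _ _ mu f g p q mf mg p0 q0 pq.
rewrite Lnorm1; under eq_integral do rewrite /= ger0_norm ?mulr_ge0//.
move/le_trans; apply; rewrite unlock.
have E (h : T -> R) r : (forall x, 0 <= h x) ->
    (fun x => (`|(EFin \o h) x| `^ r)%E) = (fun x => (h x `^ r)%:E :> \bar R).
  by move=> h0; apply/funext => x /=; rewrite ger0_norm// poweR_EFin.
by rewrite /= (E f p f0) (E g q g0).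
Qed.

Lemma le_poweR (R : realType) (x y : \bar R) (r : R) :
  0 <= r -> (0 <= x)%E -> (x <= y)%E -> (x `^ r <= y `^ r)%E.
Proof.
move=> r0 x0 xy; apply: gt0_ler_poweR => //.
  by rewrite in_itv/= leey x0.
by rewrite in_itv/= leey (le_trans x0 xy).
Qed.

Section rV_tonelli.
Context (R : realType).
Local Open Scope ereal_scope.

Definition rV_set d (i : 'I_d) (x : 'rV[R]_d) (t : R) : 'rV[R]_d :=
  (\row_j if j == i then t else x ord0 j)%R.

Lemma rV_set_cons0 d (a t : R) (v : 'rV[R]_d) :
  rV_set ord0 (rV_cons (a, v)) t = rV_cons (t, v).
Proof.
apply/rowP => j; rewrite !mxE; case: unliftP => [k ->|->] //=.
Qed.

Lemma rV_set_consS d (a t : R) (v : 'rV[R]_d) i :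
  rV_set (lift ord0 i) (rV_cons (a, v)) t = rV_cons (a, rV_set i v t).
Proof.
apply/rowP => j; rewrite !mxE; case: unliftP => [k ->|->] //=.
by rewrite (inj_eq lift_inj) mxE.
Qed.

Lemma measurable_rV_consr d (a : R) :
  measurable_fun [set: 'rV[R]_d] (fun v => rV_cons (a, v)).
Proof.
apply: measurableT_comp (@measurable_rV_cons R d) _.
exact: measurable_pair1.
Qed.

Section tonelli.
Context (d : nat) (f : 'rV[R]_d.+1 -> \bar R).
Hypothesis mf : measurable_fun [set: 'rV[R]_d.+1] f.
Hypothesis f0 : forall x, 0 <= f x.

Let mfc : measurable_fun [set: R * 'rV[R]_d] (f \o @rV_cons R d).
Proof. exact: measurableT_comp mf (@measurable_rV_cons R d). Qed.

Lemma rV_integralE : \int[lebesgue_rV R d.+1]_x f x =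
  \int[lebesgue_measure \x lebesgue_rV R d]_p (f (rV_cons p)).
Proof.
exact: (@ge0_integral_pushforward _ _ (measurableTypeR R * 'rV[R]_d)%type
  'rV[R]_d.+1 R _ (@measurable_rV_cons R d)
  (@lebesgue_measure R \x lebesgue_rV R d) setT f measurableT mf (fun x _ => f0 x)).
Qed.

Lemma rV_tonelli1 : \int[lebesgue_rV R d.+1]_x f x =
  \int[lebesgue_measure]_a \int[lebesgue_rV R d]_v f (rV_cons (a, v)).
Proof. by rewrite rV_integralE fubini_tonelli1. Qed.

Lemma rV_tonelli2 : \int[lebesgue_rV R d.+1]_x f x =
  \int[lebesgue_rV R d]_v \int[lebesgue_measure]_a f (rV_cons (a, v)).
Proof. by rewrite rV_integralE fubini_tonelli2. Qed.

Lemma measurable_rV_tonelli1 : measurable_fun [set: R]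
  (fun a => \int[lebesgue_rV R d]_v f (rV_cons (a, v))).
Proof. 
exact: (@measurable_fun_fubini_tonelli_F _ _ (measurableTypeR R) 'rV[R]_d R
  (lebesgue_rV R d) _ mfc (fun p => f0 _)). Qed.

Lemma measurable_rV_tonelli2 : measurable_fun [set: 'rV[R]_d]
  (fun v => \int[lebesgue_measure]_a f (rV_cons (a, v))).
Proof. 
exact: (@measurable_fun_fubini_tonelli_G _ _ (measurableTypeR R) 'rV[R]_d R
  (@lebesgue_measure R) _ mfc (fun p => f0 _)). Qed.

End tonelli.

(** Tonelli in the first coordinate: either the lines run in that direction and are integrated
    first, or the coordinate is frozen and the lower dimension applies. *)
Lemma le_integral_lines d (i : 'I_d) (f g : 'rV[R]_d -> \bar R) :
  measurable_fun [set: 'rV[R]_d] f -> measurable_fun [set: 'rV[R]_d] g ->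
  (forall x, 0 <= f x) -> (forall x, 0 <= g x) ->
  (forall x, \int[lebesgue_measure]_t f (rV_set i x t) <=
             \int[lebesgue_measure]_t g (rV_set i x t)) ->
  \int[lebesgue_rV R d]_x f x <= \int[lebesgue_rV R d]_x g x.
Proof.
elim: d i f g => [[]//|d IH] i f g mf mg f0 g0 fg.
case: (unliftP ord0 i) => [j|] ij; rewrite ij in fg.
  rewrite !rV_tonelli1//; apply: ge0_le_integral => //.
  - by move=> a _; exact: integral_ge0.
  - exact: measurable_rV_tonelli1.
  - exact: measurable_rV_tonelli1.
  move=> a _; apply: (IH j) => //.
  - exact: measurableT_comp mf (@measurable_rV_consr d a).
  - exact: measurableT_comp mg (@measurable_rV_consr d a).
  - move=> v; have := fg (rV_cons (a, v)).
    by under eq_integral do rewrite rV_set_consS;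
       under [X in _ <= X -> _]eq_integral do rewrite rV_set_consS.
rewrite !rV_tonelli2//; apply: ge0_le_integral => //.
- by move=> a _; exact: integral_ge0.
- exact: measurable_rV_tonelli2.
- exact: measurable_rV_tonelli2.
move=> v _; have := fg (rV_cons (0%R, v)).
by under eq_integral do rewrite rV_set_cons0;
   under [X in _ <= X -> _]eq_integral do rewrite rV_set_cons0.
Qed.

Lemma eq_integral_lines d (i : 'I_d) (f g : 'rV[R]_d -> \bar R) :
  measurable_fun [set: 'rV[R]_d] f -> measurable_fun [set: 'rV[R]_d] g ->
  (forall x, 0 <= f x) -> (forall x, 0 <= g x) ->
  (forall x, \int[lebesgue_measure]_t f (rV_set i x t) =
             \int[lebesgue_measure]_t g (rV_set i x t)) ->
  \int[lebesgue_rV R d]_x f x = \int[lebesgue_rV R d]_x g x.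
Proof.
move=> mf mg f0 g0 fg; apply/eqP; rewrite eq_le.
by apply/andP; split; apply: (le_integral_lines (i := i)) => // x; rewrite fg.
Qed.

Lemma integral_rV1 (f : 'rV[R]_1 -> \bar R) (x : 'rV[R]_1) :
  measurable_fun [set: 'rV[R]_1] f -> (forall x, 0 <= f x) ->
  \int[lebesgue_rV R 1]_x f x = \int[lebesgue_measure]_t f (rV_set ord0 x t).
Proof.
move=> mf f0; rewrite rV_tonelli1//; apply: eq_integral => t _ /=.
rewrite integral_dirac//; last exact: measurableT_comp mf (@measurable_rV_consr _ t).
rewrite (_ : \d__ _ = 1) ?mul1e; last by rewrite /dirac/= indicE mem_set.
congr f.
by apply/rowP => j; rewrite !mxE; case: unliftP => [[]|->].
Qed.

End rV_tonelli.

Section gagliardo.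
Context (R : realType).
Local Open Scope ereal_scope.

Let measurable_slice d (f : 'rV[R]_d.+1 -> R) (a : R) :
  measurable_fun [set: 'rV[R]_d.+1] f ->
  measurable_fun [set: 'rV[R]_d] (fun v => f (rV_cons (a, v))).
Proof. by move=> mf; exact: measurableT_comp mf (@measurable_rV_consr R d a). Qed.

(** With d = [n.+2], the exponent splits as d/(d-1) = 1/(d-1) + 1: the slice bound carries the first
    power as a constant, and integrating its other factor over [a] produces the second. *)
Lemma gagliardo_slices n (F g : 'rV[R]_n.+2 -> R) :
  measurable_fun [set: 'rV[R]_n.+2] F -> measurable_fun [set: 'rV[R]_n.+2] g ->
  (forall x, 0 <= F x)%R -> (forall x, 0 <= g x)%R ->
  (forall a, \int[lebesgue_rV R n.+1]_v (F (rV_cons (a, v)) `^ (n.+2%:R / n.+1%:R))%:E <=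
    (\int[lebesgue_rV R n.+2]_x (g x)%:E) `^ (n.+1%:R)^-1 *
    \int[lebesgue_rV R n.+1]_v (g (rV_cons (a, v)))%:E) ->
  \int[lebesgue_rV R n.+2]_x (F x `^ (n.+2%:R / n.+1%:R))%:E <=
  (\int[lebesgue_rV R n.+2]_x (g x)%:E) `^ (n.+2%:R / n.+1%:R).
Proof.
move=> mF mg F0 g0; set I := \int[_]_x (g x)%:E => Fg.
have mFp : measurable_fun setT (fun x => (F x `^ (n.+2%:R / n.+1%:R))%:E).
  by apply/measurable_EFinP; exact: measurableT_comp (measurable_powR _) mF.
have mg' := (measurable_EFinP _ _).2 mg.
have I0 : 0 <= I by apply: integral_ge0 => x _; rewrite lee_fin.
rewrite rV_tonelli1//; last by move=> x; rewrite lee_fin powR_ge0.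
apply: (@le_trans _ _ (\int[lebesgue_measure]_a (I `^ (n.+1%:R)^-1 *
    \int[lebesgue_rV R n.+1]_v (g (rV_cons (a, v)))%:E))).
  apply: ge0_le_integral => //.
  - by move=> a _; apply: integral_ge0 => v _; rewrite lee_fin powR_ge0.
  - by apply: (measurable_rV_tonelli1 mFp) => x; rewrite lee_fin powR_ge0.
  - apply: emeasurable_funM => //.
    by apply: (measurable_rV_tonelli1 (f := EFin \o g)) => // x; rewrite lee_fin.
rewrite ge0_integralZl//; last 3 first.
- by apply: (measurable_rV_tonelli1 (f := EFin \o g)) => // x; rewrite lee_fin.
- by move=> a _; apply: integral_ge0 => v _; rewrite lee_fin.
- exact: poweR_ge0.
rewrite -(rV_tonelli1 (f := EFin \o g))//.
have -> : (n.+2%:R / n.+1%:R = n.+1%:R^-1 + 1 :> R)%R.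
  by rewrite -[n.+2]addn1 natrD mulrDl divff ?pnatr_eq0// mul1r addrC.
rewrite poweRD; last first.
  by apply: add_neq0_poweRD_def; rewrite gt_eqF// addr_gt0// invr_gt0.
by rewrite poweRe1.
Qed.

(* If F is bounded at each point by the integral of g over every line through
   that point in a coordinate direction, then [F^(d/(d-1))] is integrable with
   the natural bound. In the induction on [d], on a slice [F] is interpolated
   between [L^1], where integrating in the first variable gives a uniform bound,
   and the exponent of the lower dimension. *)
Lemma gagliardo n (F g : 'rV[R]_n.+2 -> R) :
  measurable_fun [set: 'rV[R]_n.+2] F -> measurable_fun [set: 'rV[R]_n.+2] g ->
  (forall x, 0 <= F x)%R -> (forall x, 0 <= g x)%R ->
  (forall i x, (F x)%:E <= \int[lebesgue_measure]_t (g (rV_set i x t))%:E) ->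
  \int[lebesgue_rV R n.+2]_x (F x `^ (n.+2%:R / n.+1%:R))%:E <=
  (\int[lebesgue_rV R n.+2]_x (g x)%:E) `^ (n.+2%:R / n.+1%:R).
Proof.
elim: n F g => [|n IH] F g mF mg F0 g0 Fg; apply: gagliardo_slices => // a;
  set I := \int[_]_x (g x)%:E; set G := \int[_]_v (g _)%:E;
  have mF' := (measurable_EFinP _ _).2 mF;
  have mg' := (measurable_EFinP _ _).2 mg;
  have mFa := measurable_slice a mF; have mga := measurable_slice a mg;
  have mFa' := (measurable_EFinP _ _).2 mFa; have mga' := (measurable_EFinP _ _).2 mga;
  have G0 : 0 <= G by apply: integral_ge0 => x _; rewrite lee_fin.
all: have FI : \int[lebesgue_rV R _]_v (F (rV_cons (a, v)))%:E <= I by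
  rewrite /I (rV_tonelli2 (f := EFin \o g))//;
  apply: ge0_le_integral => //; [by move=> v _; rewrite lee_fin|
  by apply: (measurable_rV_tonelli2 (f := EFin \o g)) => // x; rewrite lee_fin|
  by move=> v _; apply: (le_trans (Fg ord0 _));
     under eq_integral do rewrite rV_set_cons0].
  (* In the plane F^2 = F * F: one factor is at most [G], the integral of [g] over the slice, and
     the other integrates to at most [I]. *)
  rewrite invr1 poweRe1//; last by apply: integral_ge0 => x _; rewrite lee_fin.
  rewrite muleC; apply: le_trans (lee_wpmul2l G0 FI).
  rewrite -ge0_integralZl//; last by move=> v _; rewrite lee_fin.
  apply: ge0_le_integral => //.
  - by move=> v _; rewrite lee_fin powR_ge0.
  - by apply/measurable_EFinP; exact: measurableT_comp (measurable_powR _) mFa.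
  - exact: emeasurable_funM.
  move=> v _; rewrite mulr1 powR_mulrn// expr2 EFinM.
  apply: lee_wpmul2r; first by rewrite lee_fin.
  have := Fg (lift ord0 ord0) (rV_cons (a, v)).
  under eq_integral do rewrite rV_set_consS.
  by rewrite -(integral_rV1 (f := fun v => (g (rV_cons (a, v)))%:E)) => // x; rewrite lee_fin.
have k0 : (0 < n.+2%:R :> R)%R by [].
have k1 : (0 < n.+2%:R / n.+1%:R :> R)%R by rewrite divr_gt0.
pose q : R := (n.+2%:R / n.+1%:R)%R.
have kq : ((n.+2%:R)^-1 + q^-1 = 1 :> R)%R.
  by rewrite /q invf_div -[X in (X + _)%R]mul1r -mulrDl nat1r divff// pnatr_eq0.
(* F^(d/(d-1)) is split as F^(1/(d-1)) * F with d - 1 = [n.+2]. The power [n.+2] of the first factor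
   is F, bounded through [FI]; the power [q] of the second is the induction hypothesis on the
   slice. *)
have := @hoelder_ge0 _ _ R (lebesgue_rV R n.+2)
  (fun v => F (rV_cons (a, v)) `^ (n.+2%:R)^-1)%R (fun v => F (rV_cons (a, v))) n.+2%:R q.
have mFk : measurable_fun [set: 'rV[R]_n.+2] (fun v => F (rV_cons (a, v)) `^ (n.+2%:R)^-1)%R.
  exact: measurableT_comp (measurable_powR _) mFa.
move=> /(_ mFk mFa (fun=> powR_ge0 _ _) (fun=> F0 _) k0 k1 kq).
have -> : (fun x => (F (rV_cons (a, x)) `^ n.+2%:R^-1 * F (rV_cons (a, x)))%:E) =
    (fun v => (F (rV_cons (a, v)) `^ (n.+3%:R / n.+2%:R))%:E).
  apply/funext => v; congr EFin.
  rewrite -[X in (_ * X)%R]powRr1// -powRD; last first.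
    by apply/implyP => /eqP H; have : (0 < n.+2%:R^-1 + 1 :> R)%R;
      [rewrite addr_gt0// invr_gt0|rewrite H ltxx].
  by rewrite -[n.+3]addn1 natrD mulrDl divff ?pnatr_eq0// mul1r addrC.
move/le_trans; apply; apply: lee_pmul; rewrite ?poweR_ge0//.
  apply: le_poweR; first by rewrite invr_ge0.
    by apply: integral_ge0 => v _; rewrite lee_fin powR_ge0.
  under eq_integral do rewrite -powRrM mulVf ?pnatr_eq0// powRr1//.
  exact: FI.
apply: (@le_trans _ _ ((G `^ q) `^ q^-1)); last first.
  by rewrite -poweRrM mulfV ?poweRe1// gt_eqF.
apply: le_poweR; first by rewrite invr_ge0 ltW.
  by apply: integral_ge0 => v _; rewrite lee_fin powR_ge0.
apply: IH => // i v; have := Fg (lift ord0 i) (rV_cons (a, v)).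
by under eq_integral do rewrite rV_set_consS.
Qed.

End gagliardo.

(** * Test functions *)

Section flat_function.
Context (R : realType).
Implicit Types (k t : R) (P : {poly R}).

(* The flat function [exp (- k / t)] times a polynomial in [1 / t]; this family
   is closed under differentiation. *)
Definition flat k P t : R := if 0 < t then P.[t^-1] * expR (- (k * t^-1)) else 0.

Definition flat_deriv k P : {poly R} := 'X ^+ 2 * (k *: P - P^`()).

Lemma horner_le_expR k P : 0 < k ->
  exists2 C : R, 0 <= C & forall y, 0 <= y -> `|P.[y]| <= C * expR (k * y).
Proof.
elim/poly_ind: P k => [|P c IH] k k0.
  by exists 0 => // y _; rewrite horner0 normr0 mul0r.
have k20 : 0 < k / 2 by rewrite divr_gt0.
have [C C0 HC] := IH _ k20.
exists (C * (2 / k) + `|c|) => [|y y0].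
  by rewrite addr_ge0// mulr_ge0// divr_ge0// ltW.
rewrite hornerMXaddC (le_trans (ler_normD _ _))// mulrDl lerD//; last first.
  by rewrite ler_peMr// -[leLHS]expR0 ler_expR mulr_ge0// ltW.
rewrite normrM (ger0_norm y0).
have yle : y <= 2 / k * expR (k / 2 * y).
  have {1}-> : y = 2 / k * (k / 2 * y) by field; rewrite gt_eqF.
  rewrite ler_wpM2l ?divr_ge0 ?(ltW k0)//.
  by rewrite (le_trans _ (expR_ge1Dx _))// lerDr.
have -> : k * y = k / 2 * y + k / 2 * y by rewrite -mulrDl -splitr.
rewrite expRD mulrACA; apply: ler_pM => //; first exact: HC.
Qed.

(** Quadratic decay makes the difference quotient at 0 tend to 0. It comes from the exponential
    bound for the polynomial ['X ^+ 2 * P] at 1/t. *)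
Lemma flat_le k P : 0 < k ->
  exists2 C : R, 0 <= C & forall t, `|flat k P t| <= C * t ^+ 2.
Proof.
move=> k0; have [C C0 HC] := horner_le_expR ('X ^+ 2 * P) k0.
exists C => // t; rewrite /flat; case: ifPn => [t0|_]; last first.
  by rewrite normr0 mulr_ge0// sqr_ge0.
have ti0 : 0 <= t^-1 by rewrite invr_ge0 ltW.
have := HC _ ti0; rewrite hornerM hornerXn normrM ger0_norm ?exprn_ge0//.
rewrite expRN normrM [`|_^-1|]gtr0_norm ?invr_gt0 ?expR_gt0//.
rewrite -ler_pdivrMr ?expR_gt0// -mulrA exprVn mulrC.
by rewrite ler_pdivrMr ?exprn_gt0.
Qed.

Lemma is_derive_flat k P t : 0 < k ->
  is_derive t (1 : R) (flat k P) (flat k (flat_deriv k P) t).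
Proof.
move=> k0; have [t0|t0|<-{t}] := ltgtP 0 t.
- have t1 : t != 0 by rewrite gt_eqF.
  apply: (@near_eq_is_derive R R R (fun s : R => P.[s^-1] * expR (- (k * s^-1)))).
    near=> s; rewrite /flat ifT//; near: s.
    exact: (lt_nbhsr t0).
  have dV : is_derive t (1 : R) (fun s : R => s^-1) (- t ^- 2).
    by apply: is_derive_eq; first exact: (is_deriveV t1 (is_derive_id _ _));
      rewrite /GRing.scale/= mulr1.
  have dP : is_derive t (1 : R) (horner P \o (fun s : R => s^-1))
    (P^`().[t^-1] * - t ^- 2) by apply: is_derive1_comp.
  have dk : is_derive t (1 : R) (fun s : R => - (k * s^-1)) (k * t ^- 2).
    have : is_derive t (1 : R) (- (k *: (fun s : R => s^-1))) (- (k *: (- t ^- 2))).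
      exact: is_deriveN.
    by rewrite /GRing.scale/= mulrN opprK.
  have dE : is_derive t (1 : R) (expR \o (fun s : R => - (k * s^-1)))
    (expR (- (k * t^-1)) * (k * t ^- 2)) by apply: is_derive1_comp.
  have dPE := is_deriveM dP dE.
  apply: (is_derive_eq dPE).
  rewrite /GRing.scale/= /flat t0 /flat_deriv hornerM hornerXn hornerD hornerN hornerZ.
  by rewrite exprVn; ring.
- rewrite /flat ltNge (ltW t0)/=.
  apply: (@near_eq_is_derive R R R (cst 0)) => //.
  by near=> s; rewrite /flat ltNge ltW//; near: s; exact: lt_nbhsl.
- have [C C0 HC] := flat_le P k0.
  have f00 Q : flat k Q 0 = 0 by rewrite /flat ltxx.
  apply/is_derive1_caratheodory; exists (fun z => flat k P z / z); split.
  + move=> z; rewrite !f00 !subr0; have [->|z0] := eqVneq z 0.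
      by rewrite f00 mulr0.
    by rewrite divfK.
  + have C1 : 0 < C + 1 by rewrite ltr_wpDl.
    suff : flat k P z / z @[z --> (0 : R)] --> (0 : R).
      by rewrite /prop_for /continuous_at f00 mul0r.
    apply/cvgr0Pnorm_le => e e0.
    near=> z; have [->|z0] := eqVneq z 0; first by rewrite f00 mul0r normr0 ltW.
    rewrite normrM normfV ler_pdivrMr ?normr_gt0//.
    rewrite (le_trans (HC z))// -[z ^+ 2]ger0_norm ?sqr_ge0// normrX expr2 mulrA.
    rewrite ler_wpM2r// (@le_trans _ _ ((C + 1) * `|z|))// ?ler_wpM2r ?lerDl//.
    rewrite mulrC -ler_pdivlMr//.
    by near: z; apply: (@nbhs0_le R R); exact: divr_gt0.
  + by rewrite !f00 mul0r.
Unshelve. all: by end_near. Qed.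

End flat_function.

Section bump_functions.
Context (R : realType).
Implicit Types (k a b t : R) (P Q : {poly R}).

Definition smooth1 (f : R -> R) : Prop := forall n t, derivable (derive1n n f) t 1.

Lemma smooth1_continuous f n : smooth1 f -> continuous (derive1n n f).
Proof.
by move=> sf t; apply/differentiable_continuous/derivable1_diffP; exact: sf.
Qed.

Lemma smooth1_is_derive f n t : smooth1 f ->
  is_derive t (1 : R) (derive1n n f) (derive1n n.+1 f t).
Proof. by move=> sf; rewrite derive1nS derive1E; apply: derivableP; exact: sf. Qed.

Lemma is_derive_flat_left k P a t : 0 < k ->
  is_derive t (1 : R) (fun s => flat k P (s - a)) (flat k (flat_deriv k P) (t - a)).
Proof.
move=> k0; rewrite -[X in is_derive _ _ _ X]mulr1.
apply: (@is_derive1_comp R (flat k P) (fun s => s - a)); first exact: is_derive_flat.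
have H : is_derive t (1 : R) (id - cst a) (1 - 0) by apply: is_deriveB.
by rewrite subr0 in H.
Qed.

Lemma is_derive_flat_right k P b t : 0 < k ->
  is_derive t (1 : R) (fun s => flat k P (b - s)) (- flat k (flat_deriv k P) (b - t)).
Proof.
move=> k0; rewrite -[X in is_derive _ _ _ X]mulrN1.
apply: (@is_derive1_comp R (flat k P) (fun s => b - s)); first exact: is_derive_flat.
have H : is_derive t (1 : R) (cst b - id) (0 - 1) by apply: is_deriveB.
by rewrite sub0r in H.
Qed.

(** The product rule leads out of single products; finite sums of products, recorded by their
    polynomials, are closed under differentiation, which gives all derivatives at once. *)
Definition bumps k a b (L : seq ({poly R} * {poly R})) t : R :=
  \sum_(p <- L) flat k p.1 (t - a) * flat k p.2 (b - t).

Definition bumps_deriv k (L : seq ({poly R} * {poly R})) :=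
  flatten [seq [:: (flat_deriv k p.1, p.2); (- p.1, flat_deriv k p.2)] | p <- L].

Lemma is_derive_bumps k a b L t : 0 < k ->
  is_derive t (1 : R) (bumps k a b L) (bumps k a b (bumps_deriv k L) t).
Proof.
move=> k0; elim: L => [|[P Q] L IH].
  rewrite /bumps /= big_nil.
  rewrite (_ : (fun _ => _) = cst 0); last by apply/funext => s; rewrite big_nil.
  exact: is_derive_cst.
rewrite (_ : bumps k a b _ = (fun s => flat k P (s - a)) * (fun s => flat k Q (b - s))
  + bumps k a b L); last by apply/funext => s; rewrite /bumps big_cons.
rewrite /bumps /= !big_cons /= -/(bumps k a b (bumps_deriv k L) t) addrA.
have dP := is_derive_flat_left P a t k0.
have dQ := is_derive_flat_right Q b t k0.
apply: (is_derive_eq (is_deriveD (is_deriveM dP dQ) IH)).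
rewrite /GRing.scale/=; congr (_ + _).
have -> : flat k (- P) (t - a) = - flat k P (t - a).
  by rewrite /flat hornerN; case: ifP => _; rewrite ?oppr0// mulNr.
by ring.
Qed.

Lemma smooth1_bumps k a b L : 0 < k -> smooth1 (bumps k a b L).
Proof.
move=> k0 n; have -> : derive1n n (bumps k a b L) = bumps k a b (iter n (bumps_deriv k) L).
  elim: n => [//|n IH]; rewrite derive1nS IH; apply/funext => t.
  by rewrite derive1E; have [_ ->] := is_derive_bumps a b (iter n (bumps_deriv k) L) t k0.
by move=> t; have [] := is_derive_bumps a b (iter n (bumps_deriv k) L) t k0.
Qed.

(** The support is fixed and [k] governs the steepness: as [k] tends to 0 the bump tends to the
    indicator of ]a, b[ while staying in [0, 1]. *)
Definition bump k a b t : R := flat k 1 (t - a) * flat k 1 (b - t).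

Lemma bumpE k a b : bump k a b = bumps k a b [:: (1, 1)].
Proof. by apply/funext => t; rewrite /bumps big_seq1. Qed.

Lemma smooth1_bump k a b : 0 < k -> smooth1 (bump k a b).
Proof. by rewrite bumpE; exact: smooth1_bumps. Qed.

Lemma flat1E k t : 0 < t -> flat k 1 t = expR (- (k * t^-1)).
Proof. by move=> t0; rewrite /flat t0 hornerC mul1r. Qed.

Lemma flat1_ge0 k t : 0 <= flat k 1 t.
Proof. by rewrite /flat; case: ifP => // _; rewrite hornerC mul1r expR_ge0. Qed.

Lemma flat1_le1 k t : 0 < k -> flat k 1 t <= 1.
Proof.
move=> k0; rewrite /flat; case: ifP => // t0; rewrite hornerC mul1r expR_le1.
by rewrite oppr_le0 mulr_ge0 ?invr_ge0 ?ltW.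
Qed.

Lemma bump_ge0 k a b t : 0 <= bump k a b t.
Proof. by rewrite mulr_ge0 ?flat1_ge0. Qed.

Lemma bump_le1 k a b t : 0 < k -> bump k a b t <= 1.
Proof. by move=> k0; rewrite mulr_ile1 ?flat1_ge0 ?flat1_le1. Qed.

Lemma bump_out k a b t : ~ (a < t < b) -> bump k a b t = 0.
Proof.
rewrite /bump /flat !subr_gt0; have [at_|] := boolP (a < t); last by rewrite mul0r.
by have [tb|] := boolP (t < b); last by rewrite mulr0.
Qed.

Lemma flat1_cvg t : 0 < t -> flat (n.+1%:R^-1) 1 t @[n --> \oo] --> (1 : R).
Proof.
move=> t0; rewrite [X in X @ _ --> _](_ : _ =
    expR \o (fun n : nat => - (n.+1%:R^-1 * t^-1))); last first.
  by apply/funext => n /=; rewrite flat1E.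
rewrite -[X in _ --> X]expR0; apply: continuous_cvg; first exact: continuous_expR.
rewrite -[X in _ --> X]oppr0; apply: cvgN; rewrite -[X in _ --> X](mul0r t^-1).
by apply: cvgM; [exact: (@cvg_harmonic R)|exact: cvg_cst].
Qed.

Lemma bump_cvg a b t :
  bump n.+1%:R^-1 a b t @[n --> \oo] --> (\1_`]a, b[ t : R).
Proof.
have [abt|abt] := boolP (t \in `]a, b[); last first.
  rewrite (_ : (fun n => _) = cst 0); last first.
    by apply/funext => n; rewrite bump_out//; apply/negP; move: abt; rewrite in_itv.
  by rewrite indicE memNset//=; [exact: cvg_cst|exact/negP].
rewrite indicE mem_set//= -[X in _ --> X]mulr1.
by apply: cvgM; apply: flat1_cvg; rewrite subr_gt0 (itvP abt).
Qed.

Lemma flat_deriv1 k t : 0 < t ->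
  flat k (flat_deriv k 1) t = k * t ^- 2 * flat k 1 t.
Proof.
move=> t0; rewrite flat1E// /flat t0 /flat_deriv derivC subr0 hornerM hornerXn hornerZ.
by rewrite hornerC mulr1 exprVn [_ * k]mulrC.
Qed.

(** In this form the sign is visible: it changes only at the midpoint of ]a, b[. *)
Lemma derive1_bump k a b t : 0 < k -> a < t < b ->
  derive1 (bump k a b) t = k * ((t - a) ^- 2 - (b - t) ^- 2) * bump k a b t.
Proof.
move=> k0 /andP[at_ tb]; rewrite derive1E.
have dP := is_derive_flat_left 1 a t k0.
have dQ := is_derive_flat_right 1 b t k0.
have [_ ->] := is_deriveM dP dQ.
by rewrite /GRing.scale/= !flat_deriv1 ?subr_gt0// /bump; ring.
Qed.

Lemma test_fun1_bump k a b (D : set R) : 0 < k -> `[a, b]%classic `<=` D ->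
  test_fun1 D (bump k a b).
Proof.
move=> k0 abD; have sub : closure [set t | bump k a b t != 0] `<=` `[a, b]%classic.
  rewrite (_ : `[a, b]%classic = closure `[a, b]%classic); last first.
    by rewrite -(closure_id _).1//; exact: interval_closed.
  apply: closure_subset => t /=; apply: contra_neqP => abt; apply: bump_out.
  by apply: contra_not abt => /andP[at_ tb]; rewrite in_itv/= !ltW.
split; first exact: smooth1_bump.
- by apply: subclosed_compact sub; [exact: closed_closure|exact: segment_compact].
- exact: subset_trans sub abD.
Qed.

End bump_functions.

Section directional_derivative.
Context (R : realType) (d : nat).
Implicit Types (f : 'rV[R]_d -> R) (i j : 'I_d) (x : 'rV[R]_d).

Lemma rV_set_id i x : rV_set i x (x ord0 i) = x.
Proof. by apply/rowP => j; rewrite mxE; case: eqP => // ->. Qed.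

Lemma rV_setE i x t : rV_set i x t ord0 i = t.
Proof. by rewrite mxE eqxx. Qed.

Lemma rV_set_shift i x t h :
  rV_set i x (h + t) = h *: delta_mx ord0 i + rV_set i x t.
Proof.
apply/rowP => j; rewrite !mxE eqxx/=; case: eqP => _; first by rewrite mulr1.
by rewrite mulr0 add0r.
Qed.

Let quotientE f i x t :
  (fun h : R => h^-1 *: ((f \o shift (rV_set i x t)) (h *: delta_mx ord0 i) - f (rV_set i x t))) =
  (fun h : R => h^-1 *: (((f \o rV_set i x) \o shift t) (h *: 1) - (f \o rV_set i x) t)).
Proof. by apply/funext => h /=; rewrite [h%:A]mulr1 rV_set_shift. Qed.

Lemma is_derive_lineP f i x t (l : R) :
  is_derive (rV_set i x t) (delta_mx ord0 i) f l <->
  is_derive t (1 : R) (f \o rV_set i x) l.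
Proof.
by split=> -[D1 D2]; split; move: D1 D2; rewrite /derivable /derive quotientE.
Qed.

Lemma is_derive_pderiv f i x t : derivable f (rV_set i x t) (delta_mx ord0 i) ->
  is_derive t (1 : R) (f \o rV_set i x) (pderiv i f (rV_set i x t)).
Proof. by move=> df; apply/is_derive_lineP/derivableP. Qed.

Lemma rV_set_continuous i x : continuous (rV_set i x).
Proof.
move=> t; apply/cvg_ballP => e e0; near=> s; split => // k j; rewrite !mxE.
case: eqP => _; last exact: ballxx.
near: s; exact: (@nbhsx_ballx R R).
Unshelve. all: by end_near. Qed.

Definition tensor (f : 'I_d -> R -> R) x : R := \prod_i f i (x ord0 i).

Lemma tensor_continuous (f : 'I_d -> R -> R) :
  (forall i, continuous (f i)) -> continuous (tensor f).
Proof.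
move=> cf; apply: continuous_big => [|i _]; first exact: mul_continuous.
by move=> x; apply: continuous_comp; [exact: coord_continuous|exact: cf].
Qed.

Lemma tensor_set (f : 'I_d -> R -> R) i x t :
  tensor f (rV_set i x t) = (\prod_(j | j != i) f j (x ord0 j)) * f i t.
Proof.
rewrite /tensor (bigD1 i)//= rV_setE mulrC; congr (_ * _).
by apply: eq_bigr => j /negPf ji; rewrite mxE ji.
Qed.

Lemma is_derive_tensor (f : 'I_d -> R -> R) i x :
  derivable (f i) (x ord0 i) 1 ->
  is_derive x (delta_mx ord0 i) (tensor f)
    (tensor (fun j => if j == i then derive1 (f i) else f j) x).
Proof.
move=> df; rewrite -[in is_derive x](rV_set_id i x); apply/is_derive_lineP.
rewrite -[X in tensor _ X](rV_set_id i x) tensor_set eqxx.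
rewrite (_ : tensor f \o _ = (\prod_(j | j != i) f j (x ord0 j)) *: f i); last first.
  by apply/funext => t /=; rewrite tensor_set.
have -> : \prod_(j | j != i) (if j == i then derive1 (f i) else f j) (x ord0 j) =
    \prod_(j | j != i) f j (x ord0 j) by apply: eq_bigr => j /negPf ->.
by apply: is_deriveZ; rewrite derive1E; exact: derivableP.
Qed.

(** Iterated partial derivatives of a tensor are tensors: factor i is differentiated as often as i
    occurs in the list. *)
Lemma smooth_tensor (f : 'I_d -> R -> R) :
  (forall i, smooth1 (f i)) -> smooth (tensor f).
Proof.
move=> sf s.
have -> : foldr (@pderiv R d) (tensor f) s =
    tensor (fun i => derive1n (count_mem i s) (f i)).
  elim: s => //= i s ->; apply/funext => x.
  have [_ D] := @is_derive_tensor (fun i => derive1n (count_mem i s) (f i)) i x (sf i _ _).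
  rewrite /pderiv D; congr (tensor _ x); apply/funext => j.
  by rewrite [in RHS]eq_sym; case: eqP => [->|].
split=> [|i x]; first by apply: tensor_continuous => i; exact: smooth1_continuous.
by have [] := @is_derive_tensor (fun i => derive1n (count_mem i s) (f i)) i x (sf i _ _).
Qed.

Definition box_bump (k : R) (a b : 'I_d -> R) : 'rV[R]_d -> R :=
  tensor (fun i => bump k (a i) (b i)).

Lemma test_fun_box_bump k (a b : 'I_d -> R) (U : set 'rV[R]_d) : 0 < k ->
  closed_box a b `<=` U ->
  test_fun U (box_bump k a b).
Proof.
move=> k0; set B := closed_box a b => BU.
have cB : compact B.
  by apply: (@rV_compact R d (fun i => `[a i, b i]%classic)) => i; exact: segment_compact.
have sub : closure [set x | box_bump k a b x != 0] `<=` B.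
  rewrite (_ : B = closure B); last first.
    rewrite -(closure_id _).1//.
    exact: (compact_closed (@norm_hausdorff _ 'rV[R]_d) cB).
  apply: closure_subset => x /=; apply: contra_neqP => /existsNP[i xi].
  rewrite /box_bump /tensor (bigD1 i)//= bump_out ?mul0r//.
  by apply: contra_not xi => /andP[ax xb]; rewrite /= in_itv/= !ltW.
split; first by apply: smooth_tensor => i; exact: smooth1_bump.
- by apply: subclosed_compact sub; [exact: closed_closure|].
- exact: subset_trans sub BU.
Qed.

Lemma box_bump_ge0 k a b x : 0 <= box_bump k a b x.
Proof. by apply: prodr_ge0 => i _; exact: bump_ge0. Qed.

Lemma box_bump_le1 k a b x : 0 < k -> box_bump k a b x <= 1.
Proof.
by move=> k0; apply: prodr_ile1 => i _; rewrite bump_ge0 bump_le1.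
Qed.

Lemma box_bump_cvg a b x :
  box_bump n.+1%:R^-1 a b x @[n --> \oo] --> (\1_(open_box a b) x : R).
Proof.
suff -> : (\1_(open_box a b) x : R) = \prod_i (\1_(`]a i, b i[%classic) (x ord0 i)).
  by apply: cvg_big => [|i _]; [exact: mul_continuous|exact: bump_cvg].
have [xab|xab] := boolP (x \in open_box a b).
  rewrite indicE xab big1// => i _; rewrite indicE mem_set//.
  by move: xab => /set_mem; exact.
rewrite indicE (negbTE xab).
have /existsNP[i xi] : ~ (forall i, `]a i, b i[%classic (x ord0 i)).
  by move: xab; rewrite notin_setE.
by rewrite (bigD1 i)//= indicE memNset// mul0r.
Qed.

End directional_derivative.

Lemma integrable_bounded d (T : measurableType d) (R : realType)
    (mu : {measure set T -> \bar R}) (D : set T) (f : T -> R) (C : R) :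
  measurable D -> (mu D < +oo)%E -> measurable_fun D f ->
  (forall x, D x -> `|f x| <= C) -> mu.-integrable D (EFin \o f).
Proof.
move=> mD Dfin mf fC; apply: measurable_bounded_integrable => //.
exists C; split; first exact: num_real.
by move=> M CM x Dx; apply: (le_trans (fC _ Dx)); exact: ltW.
Qed.

Lemma dominated_convergence_Rintegral d (T : measurableType d) (R : realType)
    (mu : {measure set T -> \bar R}) (D : set T) (f_ : nat -> T -> R) (f g : T -> R) :
  measurable D -> (forall n, measurable_fun D (f_ n)) -> measurable_fun D f ->
  (\forall x \ae mu, D x -> f_ n x @[n --> \oo] --> f x) ->
  mu.-integrable D (EFin \o g) ->
  (\forall x \ae mu, forall n, D x -> `|f_ n x| <= g x) ->
  mu.-integrable D (EFin \o f) /\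
  \int[mu]_(x in D) f_ n x @[n --> \oo] --> \int[mu]_(x in D) f x.
Proof.
move=> mD mf_ mf f_f ig f_g.
have [|||||intf _ cvf] := @dominated_convergence _ _ _ mu D mD
    (fun n => EFin \o f_ n) (EFin \o f) (EFin \o g).
- by move=> n; exact/measurable_EFinP.
- exact/measurable_EFinP.
- by apply: filterS f_f => x /[apply] fx; apply: cvg_EFin => //; exact: nearW.
- exact: ig.
- by apply: filterS f_g => x fx n Dx; rewrite /= lee_fin; exact: fx.
split => //; apply: fine_cvg; rewrite fineK; first exact: cvf.
exact: integrable_fin_num.
Qed.

Section ftc_compact.
Context (R : realType).
Local Notation leb := (@lebesgue_measure R).
Variables (p p' : R -> R) (M : R).
Hypothesis dp : forall t, is_derive t (1 : R) p (p' t).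
Hypothesis cp' : continuous p'.

Lemma ftc_segment a b : a <= b ->
  leb.-integrable `[a, b] (EFin \o p') /\
  (\int[leb]_(t in `[a, b]) (p' t)%:E = (p b - p a)%:E)%E.
Proof.
move=> ab; split.
  by apply: continuous_compact_integrable; [exact: segment_compact|exact: continuous_subspaceT].
have [->|/eqP ab'] := pselect (a = b).
  by rewrite set_itv1 integral_set1 subrr.
have altb : a < b by rewrite lt_neqAle ab'.
have cp : continuous p.
  move=> t; apply/differentiable_continuous/derivable1_diffP.
  by have [] := dp t.
rewrite (@continuous_FTC2 _ p' p)//.
- exact: continuous_subspaceT.
- split => [x _||]; first by have [] := dp x.
  + exact/cvg_at_right_filter/cp.
  + exact/cvg_at_left_filter/cp.
- by move=> x _; rewrite derive1E; have [_ ->] := dp x.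
Qed.

Hypothesis p0 : forall t, M <= `|t| -> p t = 0.

(** Integrate from [- M], where [p] vanishes, up to [t]. *)
Lemma ftc_compact_norm t : (`|p t|%:E <= \int[leb]_s `|p' s|%:E)%E.
Proof.
have [tM|tM] := leP M `|t|.
  by rewrite p0// normr0; apply: integral_ge0 => s _; rewrite lee_fin.
have Mt : - M <= t by have := ltW tM; rewrite ler_norml => /andP[].
have M0 : 0 <= M by rewrite (le_trans _ (ltW tM)).
have [ip intp] := ftc_segment Mt.
rewrite [p (- M)]p0 ?normrN ?ler_norm// subr0 in intp.
rewrite -abse_EFin -intp; apply: le_trans (le_abse_integral _ _ _) _ => //.
  exact: measurable_int ip.
apply: ge0_subset_integral => //.
by apply/measurable_EFinP/measurableT_comp => //; exact: continuous_measurable_fun.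
Qed.

(** This says that [p'] has integral 0, written with nonnegative functions so that it can be
    integrated over parallel lines by Tonelli. *)
Lemma ftc_compact_pos_neg :
  (\int[leb]_s (EFin \o p')^\+ s = \int[leb]_s (EFin \o p')^\- s)%E.
Proof.
have p'0 t : M < `|t| -> p' t = 0.
  move=> Mt; have [_ <-] := dp t.
  rewrite [RHS](_ : 0 = 'D_(1 : R) (cst (0 : R)) t); last by rewrite derive_cst.
  apply: (@near_eq_derive R R R); near=> s; rewrite p0// ltW//; near: s.
  have : (`|s| @[s --> t] --> `|t|) by exact: cvg_norm.
  by move/cvgr_gt; exact.
pose N : R := `|M|; have N0 : - N <= N by rewrite -subr_ge0 opprK addr_ge0 ?normr_ge0.
have [ip] := ftc_segment N0.
rewrite !p0 ?normrN ?normr_id ?ler_norm// subrr.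
pose D : set R := `[- N, N]%classic.
have restr : (EFin \o p') \_ D = EFin \o p'.
  apply/funext => s; rewrite patchE; case: ifPn => // Ns /=.
  rewrite p'0// (le_lt_trans (ler_norm _))// ltNge.
  by apply: contra Ns; rewrite ler_norml => Ns; rewrite mem_set//= in_itv.
have -> : (\int[leb]_s (EFin \o p')^\+ s = \int[leb]_(s in D) (EFin \o p')^\+ s)%E.
  by rewrite [RHS]integral_mkcond -funepos_restrict restr.
have -> : (\int[leb]_s (EFin \o p')^\- s = \int[leb]_(s in D) (EFin \o p')^\- s)%E.
  by rewrite [RHS]integral_mkcond -funeneg_restrict restr.
have mD : measurable (D : set (measurableTypeR R)) by exact: measurable_itv.
have pfin := integrable_pos_fin_num mD ip.
have nfin := integrable_neg_fin_num mD ip.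
rewrite integralE => /eqP; rewrite sube_eq ?add0e ?fin_num_adde_defl//.
by move/eqP.
Unshelve. all: by end_near. Qed.

End ftc_compact.

(** * Square integrable functions *)

Lemma quadratic_discr (R : realFieldType) (a b c : R) : 0 <= a ->
  (forall t, 0 <= a * t ^+ 2 + b * t *+ 2 + c) -> b ^+ 2 <= a * c.
Proof.
rewrite le_eqVlt => /predU1P[<-|a0] H; last first.
  have := H (- b / a); have an : a != 0 by rewrite gt_eqF.
  have -> : a * (- b / a) ^+ 2 + b * (- b / a) *+ 2 + c = c - b ^+ 2 / a.
    by rewrite mulr2n; field.
  by rewrite subr_ge0 ler_pdivrMr// mulrC.
rewrite mul0r; have [->|b0] := eqVneq b 0; first by rewrite expr0n.
have := H (- (c + 1) / (b * 2)); rewrite mul0r add0r.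
have -> : b * (- (c + 1) / (b * 2)) *+ 2 + c = - 1 by rewrite mulr2n; field.
by rewrite oppr_ge0 ler10.
Qed.

Section psd_form.
Context (R : realType) (V : lmodType R) (S : set V) (b : V -> V -> R).
Hypothesis S_lincomb : forall (a : R) u v, S u -> S v -> S (a *: u + v).
Hypothesis b_lincomb : forall (a : R) u v w, S u -> S v -> S w ->
  b (a *: u + v) w = a * b u w + b v w.
Hypothesis bC : forall u v, S u -> S v -> b u v = b v u.
Hypothesis b_ge0 : forall u, S u -> 0 <= b u u.

Lemma form_sqr (a : R) u v : S u -> S v ->
  b (a *: u + v) (a *: u + v) = a ^+ 2 * b u u + a * b u v *+ 2 + b v v.
Proof.
move=> Su Sv; have Suv := S_lincomb a Su Sv.
rewrite b_lincomb// (bC Su Suv) (bC Sv Suv) !b_lincomb// (bC Sv Su) mulr2n.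
by ring.
Qed.

(** The discriminant argument uses semidefiniteness only; the forms below do vanish on functions
    that are zero a.e. *)
Lemma form_cauchy_schwarz u v : S u -> S v ->
  `|b u v| <= Num.sqrt (b u u) * Num.sqrt (b v v).
Proof.
move=> Su Sv; rewrite -sqrtrM ?b_ge0// -sqrtr_sqr ler_wsqrtr//.
apply: quadratic_discr => [|t]; first exact: b_ge0.
have := b_ge0 (S_lincomb t Su Sv).
by rewrite form_sqr// [t ^+ 2 * _]mulrC [t * _]mulrC.
Qed.

Lemma form_triangle (a : R) u v : S u -> S v ->
  Num.sqrt (b (a *: u + v) (a *: u + v)) <=
  `|a| * Num.sqrt (b u u) + Num.sqrt (b v v).
Proof.
move=> Su Sv; rewrite -[leRHS]ger0_norm ?addr_ge0 ?mulr_ge0 ?sqrtr_ge0//.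
rewrite -sqrtr_sqr ler_wsqrtr// form_sqr// sqrrD exprMn !sqr_sqrtr ?b_ge0//.
rewrite real_normK ?num_real// lerD2r lerD2l lerMn2r/=.
apply: le_trans (ler_norm _) _; rewrite normrM -mulrA ler_wpM2l//.
exact: form_cauchy_schwarz.
Qed.

End psd_form.

Lemma ge0_integrable_lty d (T : measurableType d) (R : realType)
    (mu : {measure set T -> \bar R}) (D : set T) (f : T -> R) :
  measurable_fun D f -> (forall x, D x -> 0 <= f x) ->
  mu.-integrable D (EFin \o f) <-> (\int[mu]_(x in D) (f x)%:E < +oo)%E.
Proof.
move=> mf f0.
have E : (\int[mu]_(x in D) `|(EFin \o f) x| = \int[mu]_(x in D) (f x)%:E)%E.
  by apply: eq_integral => x /set_mem Dx; rewrite /= ger0_norm// f0.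
split=> [/integrableP[_]|fi]; first by rewrite E.
by apply/integrableP; rewrite E; split => //; exact/measurable_EFinP.
Qed.

Section Lp_domain.
Context (R : realType) (d : nat) (U : set 'rV[R]_d).
Hypothesis mU : measurable U.
Local Notation mu := (lebesgue_rV R d).
Implicit Types (u v : 'rV[R]_d -> R).

Let Lp_integrandE (p : R) u : 0 < p ->
  (\int[mu]_x (`|(EFin \o (u \_ U)) x| `^ p) =
   \int[mu]_(x in U) (`|u x| `^ p)%:E)%E.
Proof.
move=> p0; rewrite [RHS]integral_mkcond; apply: eq_integral => x _.
rewrite /= !patchE; case: ifP => // _.
by rewrite /point/= normr0 powR0// gt_eqF.
Qed.

Lemma LpP (p : R) u : 0 < p -> Lp U p u <->
  measurable_fun U u /\ (\int[mu]_(x in U) (`|u x| `^ p)%:E < +oo)%E.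
Proof.
move=> p0; rewrite /Lp; split=> [/andP[]|[mu_ ui]].
  rewrite !inE/= /finite_norm unlock Lp_integrandE// => mf fi; split.
    by apply/(measurable_restrictT _ mU); exact: mf.
  by apply: lty_poweRy fi; rewrite gt_eqF// invr_gt0.
apply/andP; split; rewrite inE/=; first exact/(measurable_restrictT _ mU).
by rewrite /finite_norm unlock Lp_integrandE// poweR_lty.
Qed.

Lemma L2_normE u : (L2_norm U u = (\int[mu]_(x in U) (u x ^+ 2)%:E) `^ 2^-1)%E.
Proof.
rewrite /L2_norm unlock Lp_integrandE//; congr (_ `^ _)%E.
by apply: eq_integral => x _; rewrite powR_mulrn// real_normK// num_real.
Qed.

Lemma Lp2P u : Lp U 2 u <->
  measurable_fun U u /\ mu.-integrable U (fun x => (u x ^+ 2)%:E).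
Proof.
rewrite LpP//; under eq_integral do rewrite powR_mulrn// real_normK ?num_real//.
have P mf := @ge0_integrable_lty _ _ _ mu U (fun x => u x ^+ 2)
  (measurable_funX 2 mf) (fun x _ => sqr_ge0 _).
by split=> -[mf fi]; split => //; apply/(P mf).
Qed.

Lemma Lp2_measurable u : Lp U 2 u -> measurable_fun U u.
Proof. by move=> /Lp2P[]. Qed.

Lemma integrable_Lp2M u v : Lp U 2 u -> Lp U 2 v ->
  mu.-integrable U (fun x => (u x * v x)%:E).
Proof.
move=> /Lp2P[mu_ iu] /Lp2P[mv iv].
apply: (le_integrable mU _ _ (integrableD mU iu iv)).
  by apply/measurable_EFinP; exact: measurable_funM.
move=> x Ux; rewrite /= lee_fin normrM.
rewrite [leRHS]ger0_norm ?addr_ge0 ?sqr_ge0//.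
have := sqr_ge0 (`|u x| - `|v x|).
rewrite sqrrB !real_normK ?num_real// => H.
have : 0 <= `|u x| * `|v x| by exact: mulr_ge0.
by move: H; set p := `|u x| * _; rewrite mulr2n; lra.
Qed.

Lemma Lp2_lincomb (a : R) u v : Lp U 2 u -> Lp U 2 v -> Lp U 2 (a *: u + v).
Proof.
move=> Lu Lv; have [mu_ iu] := (Lp2P _).1 Lu; have [mv iv] := (Lp2P _).1 Lv.
have iuv := integrable_Lp2M Lu Lv.
apply/Lp2P; split.
  by apply: measurable_funD => //; exact: measurable_funM.
rewrite (_ : (fun x => _) = (fun x => (a ^+ 2)%:E * (u x ^+ 2)%:E +
   ((2 * a)%:E * (u x * v x)%:E + (v x ^+ 2)%:E))%E).
  by apply: integrableD => //; [|apply: integrableD => //]; exact: integrableZl.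
by apply/funext => x; rewrite -!EFinM -!EFinD; congr EFin => /=;
  rewrite !fctE /GRing.scale/=; ring.
Qed.

Definition dotU u v : R := \int[mu]_(x in U) (u x * v x).

Lemma dotU_ae_eq u v u' v' : (\forall x \ae mu, U x -> u x = u' x) ->
  (\forall x \ae mu, U x -> v x = v' x) -> dotU u v = dotU u' v'.
Proof.
by move=> uu vv; apply: ae_eq_Rintegral; apply: filterS2 uu vv => x + + Ux
  => /(_ Ux) -> /(_ Ux) ->.
Qed.

Lemma dotUC u v : dotU u v = dotU v u.
Proof. by apply: eq_Rintegral => x _; rewrite mulrC. Qed.

Lemma dotU_lincomb (a : R) u v w : Lp U 2 u -> Lp U 2 v -> Lp U 2 w ->
  dotU (a *: u + v) w = a * dotU u w + dotU v w.
Proof.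
move=> Lu Lv Lw; have iuw := integrable_Lp2M Lu Lw; have ivw := integrable_Lp2M Lv Lw.
rewrite /dotU -RintegralZl//= -RintegralD//=; last exact: (integrableZl mU a iuw).
by apply: eq_Rintegral => x _; rewrite !fctE mulrDl -mulrA.
Qed.

Lemma dotU_ge0 u : 0 <= dotU u u.
Proof. by apply: Rintegral_ge0 => x _; rewrite -expr2 sqr_ge0. Qed.

Lemma dotU_EFin u : Lp U 2 u ->
  ((dotU u u)%:E = \int[mu]_(x in U) (u x ^+ 2)%:E)%E.
Proof.
move=> /Lp2P[_ iu]; rewrite /dotU /Rintegral fineK.
  by apply: eq_integral => x _; rewrite expr2.
by under eq_fun do rewrite -expr2; exact: integrable_fin_num.
Qed.

Lemma L2_norm_dotU u : Lp U 2 u -> L2_norm U u = (Num.sqrt (dotU u u))%:E.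
Proof.
by move=> Lu; rewrite L2_normE -dotU_EFin// poweR_EFin powR12_sqrt// dotU_ge0.
Qed.

Lemma dotU_eq0 u : Lp U 2 u -> dotU u u = 0 -> \forall x \ae mu, U x -> u x = 0.
Proof.
move=> Lu u0; have [mu_ iu] := (Lp2P _).1 Lu.
have := dotU_EFin Lu; rewrite u0 => /esym.
rewrite (eq_integral (fun x => `|(u x ^+ 2)%:E|%E)); last first.
  by move=> x _; rewrite gee0_abs// lee_fin sqr_ge0.
move/(ae_eq_integral_abs mu mU (measurable_int _ iu)).1.
apply: filterS => x /[apply] -[/eqP]; rewrite sqrf_eq0 => /eqP; exact.
Qed.

Lemma Lp2_norm u : Lp U 2 u -> Lp U 2 (fun x => `|u x|).
Proof.
move=> /Lp2P[mu_ iu]; apply/Lp2P; split; first exact: measurableT_comp.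
by under eq_fun do rewrite real_normK ?num_real//.
Qed.

Lemma dotU_norm u : dotU (fun x => `|u x|) (fun x => `|u x|) = dotU u u.
Proof.
by apply: eq_Rintegral => x _; rewrite -normrM ger0_norm// -expr2 sqr_ge0.
Qed.

Lemma dotU_cauchy_schwarz u v : Lp U 2 u -> Lp U 2 v ->
  `|dotU u v| <= Num.sqrt (dotU u u) * Num.sqrt (dotU v v).
Proof.
apply: (@form_cauchy_schwarz _ _ (Lp U 2) dotU).
- exact: Lp2_lincomb.
- exact: dotU_lincomb.
- by move=> *; exact: dotUC.
- by move=> *; exact: dotU_ge0.
Qed.

End Lp_domain.

Section bounded_sets.
Context (R : realType) (d : nat).
Local Notation mu := (lebesgue_rV R d).

Lemma rV_coord_le_norm (x : 'rV[R]_d) i : `|x ord0 i| <= `|x|.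
Proof.
rewrite [leRHS]mx_normrE.
exact: (@le_bigmax _ _ _ 0 (fun ij : 'I_1 * 'I_d => `|x ij.1 ij.2|) (ord0, i)).
Qed.

Lemma measurable_closed_box (a b : 'I_d -> R) : measurable (closed_box a b).
Proof.
rewrite (_ : closed_box a b =
    \bigcap_(i in [set: 'I_d]) (@rV_coord R d i @^-1` `[a i, b i]%classic)).
  apply: fin_bigcap_measurable => // i _; rewrite -[X in measurable X]setTI.
  exact: measurable_rV_coord.
by apply/seteqP; split => [x xab i _|x xab i]; [exact: xab|exact: (xab i)].
Qed.

Lemma bounded_set_measure_lty (S : set 'rV[R]_d) :
  bounded_set S -> measurable S -> (mu S < +oo)%E.
Proof.
move=> [M [Mreal HM]] mS.
have SM x : S x -> `|x| <= M + 1 by apply: HM; rewrite ltrDl.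
apply: (@le_lt_trans _ _ (mu (closed_box (fun=> - (M + 1)) (fun=> M + 1)))).
  apply: le_measure; rewrite ?inE//.
    exact: measurable_closed_box.
  move=> x Sx i /=; rewrite in_itv/= -ler_norml.
  exact: le_trans (rV_coord_le_norm x i) (SM _ Sx).
rewrite (@lebesgue_rV_box R d (fun=> `[- (M + 1), M + 1]%classic)) => [|i]; last exact: measurable_itv.
pose I : set R := `[- (M + 1), M + 1]%classic.
suff : (\prod_(i < d) lebesgue_measure I)%E \is a fin_num.
  by rewrite fin_num_abs; apply: le_lt_trans; exact: lee_abs.
elim/big_ind : _ => // [x y xf yf|i _]; first exact: fin_numM.
by rewrite /I lebesgue_measure_itv /=; case: ifP.
Qed.

Lemma continuous_csupp_bounded (f : 'rV[R]_d -> R) K : continuous f -> compact K ->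
  (forall x, ~ K x -> f x = 0) -> exists C, forall x, `|f x| <= C.
Proof.
move=> cf cK f0.
have /compact_bounded[M [Mreal HM]] : compact (f @` K).
  by apply: continuous_compact => //; exact: continuous_subspaceT.
exists (`|M| + 1) => x; have [Kx|/f0 ->] := pselect (K x); last first.
  by rewrite normr0 addr_ge0.
apply: HM; last by exists x.
by rewrite (le_lt_trans (ler_norm _))// ltrDl.
Qed.

End bounded_sets.

Section test_calculus.
Context (R : realType) (d : nat).
Local Notation mu := (lebesgue_rV R d).
Implicit Types (f phi : 'rV[R]_d -> R) (U : set 'rV[R]_d).

Definition grad f x : 'rV[R]_d := \row_i pderiv i f x.

Lemma pderiv_out f i x : ~ closure [set x | f x != 0] x -> pderiv i f x = 0.
Proof.
move=> fx; have : \forall y \near x, f y = 0.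
  have : nbhs x (~` closure [set x | f x != 0]).
    by apply: open_nbhs_nbhs; split => //; exact/closed_openC/closed_closure.
  apply: filterS => y /= fy; apply: contrapT => /eqP y0.
  by apply: fy; exact: subset_closure.
move=> f0; rewrite /pderiv (@near_eq_derive R _ _ f (cst 0) x _ f0).
by rewrite derive_cst.
Qed.

(** Along each line in direction [i] the function has compact support, so the positive and negative
    parts of its derivative have equal integrals; this survives integration over the lines. *)
Lemma integral_pderiv f i K : continuous f -> (forall x, derivable f x (delta_mx ord0 i)) ->
  continuous (pderiv i f) -> compact K -> (forall x, ~ K x -> f x = 0) ->
  mu.-integrable setT (EFin \o pderiv i f) /\ \int[mu]_x pderiv i f x = 0.
Proof.
move=> cf df cf' cK f0.
have clK : closed K by exact: (compact_closed (@norm_hausdorff _ 'rV[R]_d)).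
have f'0 x : ~ K x -> pderiv i f x = 0.
  move=> Kx; apply: pderiv_out => cfx; apply: Kx.
  rewrite (closure_id K).1//; apply: closure_subset cfx => y /= /eqP fy.
  by apply: contrapT => /f0.
have mf' := continuous_measurable_rV cf'.
have mK : measurable K by rewrite -[K]setCK; apply: measurableC; apply: open_measurable_rV; exact: closed_openC.
have Kfin : (mu K < +oo)%E by apply: bounded_set_measure_lty => //; exact: compact_bounded.
have [C HC] := continuous_csupp_bounded cf' cK f'0.
have intK : mu.-integrable K (EFin \o pderiv i f).
  apply: (integrable_bounded mK Kfin (C := C)) => //; exact: measurable_funTS.
have int : mu.-integrable setT (EFin \o pderiv i f).
  have := (integrable_mkcond _ mK).1 intK; congr (is_true (_.-integrable _ _)).
  by apply/funext => x; rewrite patchE; case: ifPn => // /negP; rewrite inE => /f'0/= ->.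
split => //.
have E : (\int[mu]_x (EFin \o pderiv i f)^\+ x = \int[mu]_x (EFin \o pderiv i f)^\- x)%E.
  have mF : measurable_fun setT (EFin \o pderiv i f) by exact/measurable_EFinP.
  apply: (eq_integral_lines (i := i)) => //.
  - exact: measurable_funepos.
  - exact: measurable_funeneg.
  move=> x.
  have /compact_bounded[M [Mreal HM]] := cK.
  have -> : (fun t => (EFin \o pderiv i f)^\+%E (rV_set i x t)) =
      (EFin \o (pderiv i f \o rV_set i x))^\+%E.
    by apply/funext => t; rewrite !funeposE.
  have -> : (fun t => (EFin \o pderiv i f)^\-%E (rV_set i x t)) =
      (EFin \o (pderiv i f \o rV_set i x))^\-%E.
    by apply/funext => t; rewrite !funenegE.
  apply: (@ftc_compact_pos_neg R (f \o rV_set i x) (pderiv i f \o rV_set i x) (M + 1)).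
  - by move=> t; exact: is_derive_pderiv.
  - by move=> t; apply: continuous_comp; [exact: rV_set_continuous|exact: cf'].
  - move=> t Mt; apply: f0 => Kt.
    (* [HM] holds only for bounds strictly above [M]; the half stays below [M + 1]. *)
    have := HM (M + 1/2) _ _ Kt; rewrite ltrDl divr_gt0// => /(_ isT).
    have := rV_coord_le_norm (rV_set i x t) i; rewrite rV_setE => tn tM.
    have := le_trans Mt (le_trans tn tM); lra.
rewrite /Rintegral integralE E subee//.
exact: (integrable_neg_fin_num measurableT int).
Qed.

End test_calculus.

(** * Uniqueness of weak gradients *)

Section weak_gradient.
Context (R : realType) (d : nat) (U : set 'rV[R]_d).
Hypothesis oU : open U.
Hypothesis bU : bounded_set U.
Local Notation mu := (lebesgue_rV R d).
Implicit Types (f phi : 'rV[R]_d -> R) (u v : 'rV[R]_d -> R) (G : 'rV[R]_d -> 'rV[R]_d).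

Let mU : measurable U := open_measurable_rV oU.
Let Ufin : (mu U < +oo)%E := bounded_set_measure_lty bU mU.

Lemma Lp2_bounded f C : measurable_fun U f -> (forall x, U x -> `|f x| <= C) -> Lp U 2 f.
Proof.
move=> mf fC; apply/(Lp2P mU); split => //.
apply: (@integrable_bounded _ _ _ mu U (fun x => f x ^+ 2) (C ^+ 2)) => //.
  exact: measurable_funX.
move=> x Ux; rewrite normrX lerXn2r ?nnegrE//; last exact: fC.
by rewrite (le_trans _ (fC _ Ux)).
Qed.

Lemma test_fun_continuous phi : test_fun U phi -> continuous phi.
Proof. by move=> [/(_ [::])[]]. Qed.

Lemma test_fun_pderiv_continuous phi i : test_fun U phi -> continuous (pderiv i phi).
Proof. by move=> [sm _ _]; have [c _] := sm [:: i]; exact: c. Qed.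

Lemma test_fun_derivable phi i x : test_fun U phi -> derivable phi x (delta_mx ord0 i).
Proof. by move=> [/(_ [::])[_ /(_ i x)]]. Qed.

Lemma test_fun_support phi : test_fun U phi -> exists K, [/\ compact K, K `<=` U,
  forall x, ~ K x -> phi x = 0 & forall i x, ~ K x -> pderiv i phi x = 0].
Proof.
move=> [_ cK KU]; exists (closure [set x | phi x != 0]); split => // [x Kx|i x Kx].
  by apply: contrapT => /eqP p0; apply: Kx; exact: subset_closure.
exact: pderiv_out.
Qed.

Lemma test_fun_bounded phi : test_fun U phi -> exists C, forall x, `|phi x| <= C.
Proof.
move=> tp; have [K [cK KU p0 _]] := test_fun_support tp.
exact: (continuous_csupp_bounded (test_fun_continuous tp) cK p0).
Qed.

Lemma test_fun_pderiv_bounded phi i : test_fun U phi ->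
  exists C, forall x, `|pderiv i phi x| <= C.
Proof.
move=> tp; have [K [cK KU _ p0]] := test_fun_support tp.
exact: (continuous_csupp_bounded (@test_fun_pderiv_continuous phi i tp) cK (p0 i)).
Qed.

Lemma test_fun_Lp2 phi : test_fun U phi -> Lp U 2 phi.
Proof.
move=> tp; have [C HC] := test_fun_bounded tp.
apply: (@Lp2_bounded _ C) => //; apply: measurable_funTS.
exact: (continuous_measurable_rV (test_fun_continuous tp)).
Qed.

Lemma test_fun_pderiv_Lp2 phi i : test_fun U phi -> Lp U 2 (pderiv i phi).
Proof.
move=> tp; have [C HC] := @test_fun_pderiv_bounded _ i tp.
apply: (@Lp2_bounded _ C) => //; apply: measurable_funTS.
exact: (continuous_measurable_rV (@test_fun_pderiv_continuous _ i tp)).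
Qed.

(** The derivative of [phi * psi] integrates to 0, and the product rule splits it into the two
    sides. *)
Lemma test_fun_weak_grad phi : test_fun U phi -> is_weak_grad U phi (grad phi).
Proof.
move=> tp i.
have Lg : Lp U 2 (fun x => grad phi x ord0 i).
  rewrite (_ : (fun x => _) = pderiv i phi); first exact: test_fun_pderiv_Lp2.
  by apply/funext => x; rewrite mxE.
split => // psi tq.
have [K [cK KU p0 p1]] := test_fun_support tp.
have Lp1 := @test_fun_pderiv_Lp2 _ i tp; have Lq1 := @test_fun_pderiv_Lp2 _ i tq.
have L0 := test_fun_Lp2 tp; have Lq := test_fun_Lp2 tq.
apply/eqP; rewrite -subr_eq0 opprK.
have -> : \int[mu]_(x in U) (grad phi x ord0 i * psi x) =
    \int[mu]_(x in U) (pderiv i phi x * psi x).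
  by apply: eq_Rintegral => x _; rewrite mxE.
rewrite -RintegralD//; [|exact: (integrable_Lp2M mU L0 Lq1)|exact: (integrable_Lp2M mU Lp1 Lq)].
have [_ <-] : mu.-integrable setT (EFin \o pderiv i (phi * psi)) /\
    \int[mu]_x (pderiv i (phi * psi) x) = 0.
  have dE : pderiv i (phi * psi) = (fun x => phi x * pderiv i psi x + psi x * pderiv i phi x).
    apply/funext => x; rewrite /pderiv deriveM//; exact: test_fun_derivable.
  apply: (integral_pderiv (K := K)) => //.
  - move=> x; apply: continuousM; exact: test_fun_continuous.
  - by move=> x; apply: derivableM; exact: test_fun_derivable.
  - have -> : pderiv i (phi * psi) = phi * pderiv i psi + psi * pderiv i phi.
      by rewrite dE.
    move=> x; apply: continuousD; apply: continuousM.
    + exact: test_fun_continuous.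
    + exact: test_fun_pderiv_continuous.
    + exact: test_fun_continuous.
    + exact: test_fun_pderiv_continuous.
  - by move=> x Kx; rewrite !fctE p0// mul0r.
rewrite Rintegral_mkcond; apply/eqP; apply: eq_Rintegral => x _; rewrite patchE.
have -> : pderiv i (phi * psi) x = phi x * pderiv i psi x + psi x * pderiv i phi x.
  by rewrite /pderiv deriveM//; exact: test_fun_derivable.
case: ifPn => [_|]; first by rewrite [pderiv i phi x * _]mulrC.
by rewrite notin_setE => Ux; rewrite p0 ?p1 ?mul0r ?mulr0 ?addr0// => /KU.
Qed.

(** Bumps increasing to the indicator of a box give integral zero over every box with closure in
    [U]; a Dynkin argument extends this to the Borel subsets of such a box, where [f] therefore
    vanishes a.e. Countably many boxes cover [U]. *)
Lemma fundamental_lemma f : Lp U 2 f ->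
  (forall phi, test_fun U phi -> \int[mu]_(x in U) (f x * phi x) = 0) ->
  \forall x \ae mu, U x -> f x = 0.
Proof.
move=> Lf f0; have mf := Lp2_measurable mU Lf.
have if1 : mu.-integrable U (EFin \o f).
  have := integrable_Lp2M mU Lf (@Lp2_bounded (cst 1) 1 _ _).
  under eq_fun do rewrite /cst mulr1; apply; first exact: measurable_cst.
  by move=> x _; rewrite normr1.
have box0 a b : closed_box a b `<=` U -> \int[mu]_(x in U) (f x * \1_(open_box a b) x) = 0.
  move=> abU; pose g n x := f x * box_bump n.+1%:R^-1 a b x.
  have tn n : test_fun U (@box_bump R d n.+1%:R^-1 a b) by apply: test_fun_box_bump.
  have mg n : measurable_fun U (g n).
    apply: measurable_funM => //; apply: measurable_funTS.
    exact: (continuous_measurable_rV (test_fun_continuous (tn n))).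
  have [||||_] := @dominated_convergence_Rintegral _ _ R mu U g
      (fun x => f x * \1_(open_box a b) x) (fun x => `|f x|) mU mg.
  - apply: measurable_funM => //; apply: measurable_indic; exact: measurable_open_box.
  - apply: aeW => x _; apply: cvgM; [exact: cvg_cst|exact: box_bump_cvg].
  - exact: integrable_norm.
  - apply: aeW => x n _; rewrite /g normrM [`|box_bump _ _ _ _|]ger0_norm ?box_bump_ge0//.
    by rewrite ler_piMr// box_bump_le1.
  move=> H; rewrite -(cvg_lim _ H)//; apply: lim_near_cst => //.
  by apply: nearW => n; rewrite f0.
have ifE E : measurable E -> mu.-integrable U (EFin \o (fun x => f x * \1_E x)).
  move=> mE; apply: (le_integrable mU _ _ (integrable_norm if1)).
    by apply/measurable_EFinP/measurable_funM => //; exact: measurable_indic.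
  move=> x _; rewrite /= lee_fin normrM normr_id indicE.
  by case: (_ \in _); rewrite ?normr1 ?normr0 ?mulr1 ?mulr0.
pose Q p := open_box (@rat_lo R d p) (@rat_hi R d p).
have Q0 p : closed_box (@rat_lo R d p) (@rat_hi R d p) `<=` U ->
    \forall x \ae mu, Q p x -> f x = 0.
  move=> pU; have mQ : measurable (Q p) by exact: measurable_open_box.
  have QU : Q p `<=` U by apply: subset_trans pU; exact: sub_open_closed_box.
  have iQ : mu.-integrable (Q p) (EFin \o f) by apply: integrableS if1.
  (* Intersecting with [Q p] puts the whole space into the class, since its trace is a box with
     closure in [U]. *)
  have H : @measurable _ 'rV[R]_d `<=`
      [set E | measurable E /\ \int[mu]_(x in U) (f x * \1_(Q p `&` E) x) = 0].
    apply: subset_trans (@measurable_rV_open_boxes R d) _.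
    apply: lambda_system_subset => //.
    - move=> _ _ [[a b] _ <-] [[a' b'] _ <-].
      rewrite open_boxI; set a2 := (fun i => _); set b2 := (fun i => _).
      by exists (a2, b2).
    - split => //.
      + by split => //; rewrite setIT; exact: box0.
      + move=> A B BA [mA A0] [mB B0]; split; first exact: measurableD.
        transitivity (\int[mu]_(x in U) (f x * \1_(Q p `&` A) x - f x * \1_(Q p `&` B) x)).
          apply: eq_Rintegral => x _; rewrite -mulrBr; congr (_ * _).
          rewrite !indicE (in_setI x (Q p) (A `\` B)) in_setD !(in_setI x (Q p)).
          case: (boolP (x \in B)) => /= [/set_mem/BA/mem_set ->|_].
            by case: (x \in Q p); rewrite /= ?subrr.
          by rewrite andbT andbF subr0.
        rewrite RintegralB ?A0 ?B0 ?subrr//; apply: ifE; exact: measurableI.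
      + move=> F ndF F0; split; first by apply: bigcup_measurable => n _; have [] := F0 n.
        have mQF n : measurable (Q p `&` F n) by apply: measurableI => //; have [] := F0 n.
        have mQF' : measurable (Q p `&` \bigcup_n F n).
          by rewrite setI_bigcupr; exact: bigcup_measurable.
        have [|||||_] := @dominated_convergence_Rintegral _ _ R mu U
          (fun n x => f x * \1_(Q p `&` F n) x)
          (fun x => f x * \1_(Q p `&` \bigcup_n F n) x) (fun x => `|f x|) mU.
        * by move=> n; apply: measurable_funM => //; exact: measurable_indic.
        * by apply: measurable_funM => //; exact: measurable_indic.
        * apply: aeW => x _; apply: cvgM; first exact: cvg_cst.
          apply: cvg_near_cst.
          have [[N _ FNx]|nF] := pselect ((\bigcup_n F n) x).
            near=> n; have Nn : (N <= n)%N by near: n; exists N.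
            have FnN : F n x by have /subsetPset/(_ x FNx) := ndF _ _ Nn.
            have bx : (\bigcup_n F n) x by exists N.
            by rewrite !indicE !in_setI (mem_set FnN) (mem_set bx).
          apply: nearW => n; have nFn : ~ F n x by move=> Fx; apply: nF; exists n.
          by rewrite !indicE !in_setI (memNset nFn) (memNset nF).
        * exact: integrable_norm.
        * apply: aeW => x n _; rewrite normrM indicE.
          by case: (_ \in _); rewrite ?normr1 ?normr0 ?mulr1 ?mulr0.
        move=> cv; rewrite -(cvg_lim _ cv)//; apply: lim_near_cst => //.
        by apply: nearW => n; have [] := F0 n.
    - by move=> _ [[a b] _ <-]; split; [exact: measurable_open_box|rewrite open_boxI;
        apply: box0 => x xab; apply: pU => i; have := xab i; rewrite /= !in_itv/= ge_max le_min;
        move=> /andP[/andP[? ?] /andP[? ?]]; apply/andP].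
  suff : ae_eq mu (Q p) (EFin \o f) (cst 0%E) by apply: filterS => x /[apply] -[].
  apply: (integral_ae_eq mQ iQ) => // E EQ mE.
  rewrite integral0; have [_] := H E mE.
  rewrite (setIidr EQ) => I0.
  have : \int[mu]_(x in U `&` E) f x = 0.
    rewrite Rintegral_mkcondr -I0; apply: eq_Rintegral => x _.
    by rewrite patchE indicE; case: ifP => _; rewrite ?mulr1 ?mulr0.
  rewrite (setIidr (subset_trans EQ QU)) /Rintegral => /eqP.
  rewrite -eqe fineK => [/eqP//|].
  by apply: integrable_fin_num => //; apply: integrableS iQ.
have : \forall x \ae mu, forall n, if unpickle n is Some p then
    closed_box (@rat_lo R d p) (@rat_hi R d p) `<=` U -> Q p x -> f x = 0 else True.
  apply: ae_foralln => n; case: unpickle => [p|]; last exact: aeW.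
  have [/Q0|pU] := pselect (closed_box (@rat_lo R d p) (@rat_hi R d p) `<=` U); last exact: aeW.
  by apply: filterS => x + _.
apply: filterS => x Hx; rewrite {1}(open_bigcup_rat_box oU) => -[p /= pU Qx].
by have := Hx (pickle p); rewrite pickleK; exact.
Unshelve. all: by end_near. Qed.

(** Hence the choice made in [weak_grad] is harmless: rules for gradients hold for it a.e. in
    [U]. *)
Lemma weak_grad_unique u G1 G2 : is_weak_grad U u G1 -> is_weak_grad U u G2 ->
  \forall x \ae mu, U x -> G1 x = G2 x.
Proof.
move=> wG1 wG2.
have H i : \forall x \ae mu, U x -> G1 x ord0 i = G2 x ord0 i.
  have [L1 E1] := wG1 i; have [L2 E2] := wG2 i.
  have : \forall x \ae mu, U x ->
      ((-1) *: (fun x => G1 x ord0 i) + (fun x => G2 x ord0 i)) x = 0.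
    apply: fundamental_lemma; first exact: Lp2_lincomb.
    move=> phi tp; have Lphi := test_fun_Lp2 tp.
    rewrite -/(dotU U _ phi) dotU_lincomb// /dotU mulN1r.
    by have := E1 _ tp; rewrite (E2 _ tp) => /oppr_inj ->; rewrite addNr.
  by apply: filterS => x /[apply]; rewrite !fctE scaleN1r => /eqP; rewrite addrC subr_eq0 => /eqP.
have : \forall x \ae mu, forall n, forall i : 'I_d, i = n :> nat -> U x -> G1 x ord0 i = G2 x ord0 i.
  apply: ae_foralln => n; have [nd|nd] := ltnP n d.
    apply: filterS (H (Ordinal nd)) => x Hx i iE.
    by rewrite (_ : i = Ordinal nd)//; exact: val_inj.
  by apply: aeW => x i iE; have := ltn_ord i; rewrite iE ltnNge nd.
by apply: filterS => x Hx Ux; apply/rowP => i; exact: Hx.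
Qed.

End weak_gradient.

(** * Form bounds from the Sobolev inequality *)

Section power_norm.
Context (R : realType).
Implicit Types (y a : R).

(** For a > 1 this is the derivative of |y|^a, including the value 0 at the origin. *)
Definition signed_power a y : R := a * `|y| `^ (a - 1) * Num.sg y.

Lemma normr_signed_power a y : 1 < a -> `|signed_power a y| = a * `|y| `^ (a - 1).
Proof.
move=> a1; have a0 : 0 <= a by rewrite (le_trans _ (ltW a1)).
rewrite /signed_power !normrM (ger0_norm a0) (ger0_norm (powR_ge0 _ _)) normr_sg.
have [->|_] := eqVneq y 0; last by rewrite mulr1.
by rewrite mulr0 normr0 powR0 ?mulr0// subr_eq0 gt_eqF.
Qed.

Lemma is_derive_gt0_powR a y : 0 < y ->
  is_derive y (1 : R) (fun z => `|z| `^ a) (a * y `^ (a - 1)).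
Proof.
move=> y0; apply: (@near_eq_is_derive R R R (fun z => z `^ a)).
  near=> z; rewrite gtr0_norm//; near: z; exact: (lt_nbhsr y0).
exact: is_derive1_powR.
Unshelve. all: by end_near. Qed.

Lemma normr_powR_le a e y : 0 < a -> 0 < e -> `|y| <= e `^ a^-1 -> `|y| `^ a <= e.
Proof.
move=> a0 e0 ye; have -> : e = (e `^ a^-1) `^ a.
  by rewrite -powRrM mulVf ?lt0r_neq0// powRr1// ltW.
by apply: ge0_ler_powR; rewrite ?nnegrE ?powR_ge0// ltW.
Qed.

Lemma is_derive_normr_powR a y : 1 < a ->
  is_derive y (1 : R) (fun z => `|z| `^ a) (signed_power a y).
Proof.
move=> a1; have a0 : 0 < a by rewrite (lt_trans _ a1).
rewrite /signed_power; have [y0|y0|<-{y}] := ltgtP 0 y.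
- by rewrite gtr0_sg// mulr1 gtr0_norm//; exact: is_derive_gt0_powR.
- rewrite ltr0_sg// mulrN1 ltr0_norm// -mulrN1.
  have ny0 : 0 < - y by rewrite oppr_gt0.
  have H := @is_derive1_comp R (fun z => `|z| `^ a) -%R y _ _
    (@is_derive_gt0_powR a _ ny0) (is_deriveNid _ _).
  rewrite (_ : (fun z => _) = (fun z => `|z| `^ a) \o -%R)//.
  by apply/funext => z /=; rewrite normrN.
(* At the origin the slope has absolute value |z|^(a-1), which tends to 0 because a > 1. *)
- apply/is_derive1_caratheodory; exists (fun z => `|z| `^ a / z); split.
  + move=> z; rewrite subr0 normr0 (powR0 (lt0r_neq0 a0)) subr0.
    have [->|z0] := eqVneq z 0; first by rewrite normr0 powR0 ?mulr0// gt_eqF.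
    by rewrite divfK.
  + suff : `|z| `^ a / z @[z --> (0 : R)] --> (0 : R).
      by rewrite /prop_for /continuous_at invr0 mulr0.
    apply/cvgr0Pnorm_le => e e0; near=> z.
    have [->|z0] := eqVneq z 0; first by rewrite invr0 mulr0 normr0 ltW.
    rewrite normrM normfV ger0_norm ?powR_ge0// -{2}[`|z|]powRr1//.
    rewrite -powRB; last by apply/implyP; rewrite normr_eq0.
    apply: normr_powR_le => //; first by rewrite subr_gt0.
    by near: z; apply: (@nbhs0_le R R); exact: powR_gt0.
  + by rewrite invr0 !mulr0 sgr0 mulr0.
Unshelve. all: by end_near. Qed.

Lemma continuous_normr_powR a : 0 < a -> continuous (fun z : R => `|z| `^ a).
Proof.
move=> a0 y; have [y0|y0|<-{y}] := ltgtP 0 y.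
- apply/differentiable_continuous/derivable1_diffP.
  by have [] := is_derive_gt0_powR a y0.
- have H : continuous_at y ((fun z : R => `|z| `^ a) \o -%R).
    apply: continuous_comp; first exact: oppr_continuous.
    apply/differentiable_continuous/derivable1_diffP.
    have ny0 : 0 < - y by rewrite oppr_gt0.
    by have [] := is_derive_gt0_powR a ny0.
  rewrite (_ : (fun z => `|z| `^ a) = (fun z : R => `|z| `^ a) \o -%R)//.
  by apply/funext => z /=; rewrite normrN.
- suff : `|z| `^ a @[z --> (0 : R)] --> (0 : R).
    by rewrite /continuous_at normr0 powR0 // gt_eqF.
  apply/cvgr0Pnorm_le => e e0; near=> z.
  rewrite ger0_norm ?powR_ge0//; apply: normr_powR_le => //.
  by near: z; apply: (@nbhs0_le R R); exact: powR_gt0.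
Unshelve. all: by end_near. Qed.

Lemma continuous_signed_power a : 1 < a -> continuous (signed_power a).
Proof.
move=> a1; have a10 : 0 < a - 1 by rewrite subr_gt0.
have cP := continuous_normr_powR a10.
have cPa y : (a * `|z| `^ (a - 1)) @[z --> y] --> (a * `|y| `^ (a - 1)).
  by apply: cvgM; [exact: cvg_cst|exact: cP].
move=> y; have [y0|y0|<-{y}] := ltgtP 0 y.
- rewrite /continuous_at {2}/signed_power gtr0_sg// mulr1; apply: cvg_trans (cPa y).
  apply: near_eq_cvg; near=> z; rewrite /signed_power gtr0_sg ?mulr1//.
  near: z; exact: (lt_nbhsr y0).
- rewrite /continuous_at {2}/signed_power ltr0_sg// mulrN1; apply: cvg_trans (cvgN (cPa y)).
  apply: near_eq_cvg; near=> z; rewrite /signed_power ltr0_sg ?mulrN1//.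
  near: z; exact: (lt_nbhsl y0).
- rewrite /continuous_at {2}/signed_power sgr0 mulr0; apply/cvgr0Pnorm_le => e e0.
  have := cPa 0; rewrite normr0 powR0 ?gt_eqF// mulr0 => /cvgr0Pnorm_le/(_ _ e0).
  apply: filterS => z; rewrite normr_signed_power// ger0_norm// mulr_ge0 ?powR_ge0//.
  by rewrite (le_trans _ (ltW a1)).
Unshelve. all: by end_near. Qed.

End power_norm.

Section euclidean.
Context (R : realType) (d : nat).
Implicit Types (x y : 'rV[R]_d).

Lemma dot_ge0 x : 0 <= dot x x.
Proof. by apply: sumr_ge0 => i _; rewrite -expr2 sqr_ge0. Qed.

Lemma eucl_norm_sqr x : eucl_norm x ^+ 2 = dot x x.
Proof. by rewrite /eucl_norm sqr_sqrtr// dot_ge0. Qed.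

Lemma coord_le_eucl_norm x i : `|x ord0 i| <= eucl_norm x.
Proof.
rewrite -sqrtr_sqr ler_wsqrtr// /dot (bigD1 i)//= -expr2 lerDl.
by apply: sumr_ge0 => j _; rewrite -expr2 sqr_ge0.
Qed.

Lemma dotC x y : dot x y = dot y x.
Proof. by apply: eq_bigr => i _; rewrite mulrC. Qed.

Lemma dot_lincomb (a : R) x y z : dot (a *: x + y) z = a * dot x z + dot y z.
Proof.
by rewrite /dot mulr_sumr -big_split/=; apply: eq_bigr => i _; rewrite !mxE mulrDl mulrA.
Qed.

Lemma dot_cauchy_schwarz x y : `|dot x y| <= eucl_norm x * eucl_norm y.
Proof.
apply: (@form_cauchy_schwarz _ _ setT (@dot R d)) => //.
- by move=> *; exact: dot_lincomb.
- by move=> *; exact: dotC.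
- by move=> *; exact: dot_ge0.
Qed.

Lemma measurable_dot d' (T : measurableType d') (D : set T) (F G : T -> 'rV[R]_d) :
  (forall i, measurable_fun D (fun z => F z ord0 i)) ->
  (forall i, measurable_fun D (fun z => G z ord0 i)) ->
  measurable_fun D (fun z => dot (F z) (G z)).
Proof.
move=> mF mG.
apply: (@measurable_sum _ _ _ _ _ _ (fun i z => F z ord0 i * G z ord0 i)) => i.
exact: measurable_funM.
Qed.

Lemma measurable_eucl_norm d' (T : measurableType d') (D : set T) (G : T -> 'rV[R]_d) :
  (forall i, measurable_fun D (fun z => G z ord0 i)) ->
  measurable_fun D (fun z => eucl_norm (G z)).
Proof.
move=> mG; apply: (measurableT_comp (f := @Num.sqrt R)).
  by apply: continuous_measurable_fun; exact: sqrt_continuous.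
exact: measurable_dot.
Qed.

End euclidean.

Lemma integrable_dot (R : realType) (d : nat) (U : set 'rV[R]_d)
    (F G : 'rV[R]_d -> 'rV[R]_d) : measurable U ->
  (forall i, Lp U 2 (fun x => F x ord0 i)) -> (forall i, Lp U 2 (fun x => G x ord0 i)) ->
  (lebesgue_rV R d).-integrable U (fun x => (dot (F x) (G x))%:E).
Proof.
move=> mU LF LG.
rewrite (_ : (fun x => _) = (fun x => \sum_(i < d) (F x ord0 i * G x ord0 i)%:E)%E).
  by apply: integrable_sum => // i _; exact: integrable_Lp2M.
by apply/funext => x; rewrite /= /dot sumEFin.
Qed.

Section sobolev_inequality.
Context (R : realType) (n : nat) (U : set 'rV[R]_n.+2).
Hypothesis oU : open U.
Hypothesis bU : bounded_set U.
Local Notation mu := (lebesgue_rV R n.+2).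
Implicit Types (phi : 'rV[R]_n.+2 -> R) (a s : R).

Let mU : measurable U := open_measurable_rV oU.
Let Ufin : (mu U < +oo)%E := bounded_set_measure_lty bU mU.
Let p : R := n.+2%:R / n.+1%:R.
Let p0 : 0 < p. Proof. by rewrite divr_gt0. Qed.

Let grad_norm phi x := eucl_norm (grad phi x).

Let measurable_phi phi : test_fun U phi -> measurable_fun setT phi.
Proof. by move=> tp; exact: (continuous_measurable_rV (test_fun_continuous tp)). Qed.

Let measurable_normr_powR phi a : test_fun U phi ->
  measurable_fun setT (fun x => `|phi x| `^ a).
Proof.
move=> tp; apply: (measurableT_comp (measurable_powR a)).
exact: (measurableT_comp (@normr_measurable R setT) (measurable_phi tp)).
Qed.

Let measurable_grad_norm phi : test_fun U phi -> measurable_fun setT (grad_norm phi).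
Proof.
move=> tp; apply: measurable_eucl_norm => i.
rewrite (_ : (fun x => _) = pderiv i phi); last by apply/funext => x; rewrite mxE.
exact: (continuous_measurable_rV (@test_fun_pderiv_continuous _ _ _ _ i tp)).
Qed.

(** The fundamental theorem for |phi|^a along the line; this is the hypothesis of the Gagliardo
    inequality. *)
Lemma test_fun_line_bound phi a i x : 1 < a -> test_fun U phi ->
  ((`|phi x| `^ a)%:E <= \int[lebesgue_measure]_t
    (a * (`|phi (rV_set i x t)| `^ (a - 1) * eucl_norm (grad phi (rV_set i x t))))%:E)%E.
Proof.
move=> a1 tp; have a0 : 0 <= a by rewrite (le_trans _ (ltW a1)).
have [K [cK KU phi0 _]] := test_fun_support tp.
have [M [_ HM]] := compact_bounded cK.
have cphi := test_fun_continuous tp; have cphi' := @test_fun_pderiv_continuous _ _ _ _ i tp.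
pose q t := phi (rV_set i x t); pose q' t := pderiv i phi (rV_set i x t).
have cq : continuous q by move=> t; apply: continuous_comp; [exact: rV_set_continuous|exact: cphi].
have cq' : continuous q' by move=> t; apply: continuous_comp; [exact: rV_set_continuous|exact: cphi'].
have dq t : is_derive t (1 : R) q (q' t).
  by apply: is_derive_pderiv; exact: test_fun_derivable tp.
have := @ftc_compact_norm R (fun t => `|q t| `^ a) (fun t => signed_power a (q t) * q' t) (M + 1).
have cd : continuous ((signed_power a \o q) * q').
  move=> t; apply: continuousM; last exact: cq'.
  by apply: continuous_comp; [exact: cq|exact: continuous_signed_power].
move=> /(_ _ cd _ (x ord0 i)).
rewrite /q rV_set_id ger0_norm ?powR_ge0// => H.
apply: le_trans (H _ _) _.
- move=> t.
  exact: (@is_derive1_comp R _ q t _ _ (is_derive_normr_powR (q t) a1) (dq t)).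
- move=> t Mt; rewrite phi0 ?normr0 ?powR0 ?gt_eqF ?(lt_trans _ a1)// => Kt.
  have := HM (M + 1/2) _ _ Kt; rewrite ltrDl divr_gt0// => /(_ isT).
  have := rV_coord_le_norm (rV_set i x t) i; rewrite rV_setE => tn tM.
  have := le_trans Mt (le_trans tn tM); lra.
apply: ae_le_integral_lower.
- by move=> t _; rewrite lee_fin.
- by move=> t _; rewrite lee_fin mulr_ge0// mulr_ge0 ?powR_ge0 ?sqrtr_ge0.
apply: aeW => t _; rewrite lee_fin normrM normr_signed_power// -mulrA.
rewrite ler_wpM2l// ler_wpM2l ?powR_ge0// /q'.
by have := coord_le_eucl_norm (grad phi (rV_set i x t)) i; rewrite mxE.
Qed.

Lemma test_fun_gagliardo phi a : 1 < a -> test_fun U phi ->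
  (\int[mu]_x (`|phi x| `^ (a * p))%:E <=
   (a%:E * ((\int[mu]_x (`|phi x| `^ (2 * (a - 1)))%:E) `^ 2^-1 *
            (\int[mu]_x (grad_norm phi x `^ 2)%:E) `^ 2^-1)) `^ p)%E.
Proof.
move=> a1 tp; have a0 : 0 <= a by rewrite (le_trans _ (ltW a1)).
under eq_integral do rewrite powRrM.
have mg : measurable_fun setT (fun x => `|phi x| `^ (a - 1) * grad_norm phi x).
  by apply: measurable_funM; [exact: measurable_normr_powR|exact: measurable_grad_norm].
have := @gagliardo R n (fun x => `|phi x| `^ a)
  (fun x => a * (`|phi x| `^ (a - 1) * grad_norm phi x)).
move/(_ (measurable_normr_powR _ tp)).
move=> /(_ (measurable_funM (measurable_cst _) mg) (fun=> powR_ge0 _ _)) H.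
apply: le_trans (H _ _) _.
- by move=> x; rewrite mulr_ge0// mulr_ge0 ?powR_ge0 ?sqrtr_ge0.
- by move=> i x; exact: test_fun_line_bound.
apply: le_poweR; first exact: ltW.
  by apply: integral_ge0 => x _; rewrite lee_fin mulr_ge0// mulr_ge0 ?powR_ge0 ?sqrtr_ge0.
under eq_integral do rewrite EFinM.
rewrite ge0_integralZl//; last 2 first.
- exact/measurable_EFinP.
- by move=> x _; rewrite lee_fin mulr_ge0 ?powR_ge0 ?sqrtr_ge0.
apply: lee_wpmul2l; first by rewrite lee_fin.
have h2 : 2^-1 + 2^-1 = 1 :> R by lra.
have := @hoelder_ge0 _ _ R mu (fun x => `|phi x| `^ (a - 1)) (grad_norm phi) 2 2
  (measurable_normr_powR _ tp) (measurable_grad_norm tp)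
  (fun=> powR_ge0 _ _) (fun=> sqrtr_ge0 _) (ltr0Sn _ _) (ltr0Sn _ _) h2.
rewrite (_ : (fun x => ((`|phi x| `^ (a - 1)) `^ 2)%:E) =
  (fun x => (`|phi x| `^ (2 * (a - 1)))%:E)) => [H2|]; first exact: H2.
by apply/funext => x; rewrite -powRrM mulrC.
Qed.

(** Hölder against the indicator of [U], which has finite measure. The case b = r is separate
    because the conjugate exponent [Q] is then infinite. *)
Lemma test_fun_Lp_inclusion (r b : R) : 0 < b -> b <= r ->
  exists2 K : R, 0 <= K & forall phi, test_fun U phi ->
  (\int[mu]_x (`|phi x| `^ b)%:E <= K%:E * (\int[mu]_x (`|phi x| `^ r)%:E) `^ (b / r))%E.
Proof.
move=> b0 br; have r0 : 0 < r by rewrite (lt_le_trans b0).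
have i0 phi c : (0 <= \int[mu]_x (`|phi x| `^ c)%:E)%E.
  by apply: integral_ge0 => x _; rewrite lee_fin powR_ge0.
move: br; rewrite le_eqVlt => /predU1P[<-|br].
  by exists 1 => // phi tp; rewrite mul1e divff ?lt0r_neq0// poweRe1.
have rb1 : 1 < r / b by rewrite ltr_pdivlMr// mul1r.
pose Q : R := (1 - b / r)^-1.
have br1 : 0 < 1 - b / r by rewrite subr_gt0 ltr_pdivrMr// mul1r.
have Q0 : 0 < Q by rewrite invr_gt0.
have PQ : (r / b)^-1 + Q^-1 = 1 by rewrite invf_div /Q invrK addrC subrK.
exists (fine ((mu U) `^ Q^-1)) => [|phi tp]; first exact/fine_ge0/poweR_ge0.
rewrite fineK; last by apply: fin_num_poweR; rewrite ge0_fin_numE.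
have [K [cK KU phi0 _]] := test_fun_support tp.
have H := @hoelder_ge0 _ _ R mu (fun x => `|phi x| `^ b) (\1_U) (r / b) Q
  (measurable_normr_powR b tp) (measurable_indic mU) (fun=> powR_ge0 _ _) _
  (lt_trans ltr01 rb1) Q0 PQ.
rewrite muleC.
rewrite (_ : (fun x => (`|phi x| `^ b)%:E) = (fun x => (`|phi x| `^ b * \1_U x)%:E)); last first.
  apply/funext => x; rewrite indicE; case: (boolP (x \in U)) => [_|]; first by rewrite mulr1.
  rewrite notin_setE mulr0 => Ux; rewrite phi0 ?normr0 ?powR0 ?lt0r_neq0// => /KU.
  exact: Ux.
rewrite (_ : (fun x => (`|phi x| `^ r)%:E) = (fun x => ((`|phi x| `^ b) `^ (r / b))%:E)); last first.
  by apply/funext => x; rewrite -powRrM mulrC divfK// lt0r_neq0.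
have -> : mu U = (\int[mu]_x (\1_U x `^ Q)%:E)%E.
  rewrite -[U]setIT -(integral_indic mu measurableT mU).
  apply: eq_integral => x _; rewrite setIT indicE.
  by case: (x \in U); rewrite ?powR1// powR0// lt0r_neq0.
by rewrite -[(b / r)]invf_div; apply: H => x; rewrite indicE.
Qed.

Lemma test_fun_powR_lty phi b : 0 < b -> test_fun U phi ->
  (\int[mu]_x (`|phi x| `^ b)%:E < +oo)%E.
Proof.
move=> b0 tp; have [K [cK KU phi0 _]] := test_fun_support tp.
have [C HC] := test_fun_bounded tp.
have mf := measurable_normr_powR b tp.
rewrite (_ : (fun x => (`|phi x| `^ b)%:E) = (EFin \o (fun x => `|phi x| `^ b)) \_ U); last first.
  apply/funext => x; rewrite patchE; case: ifPn => //.
  rewrite notin_setE => Ux; rewrite phi0 ?normr0 ?powR0 ?lt0r_neq0// => /KU.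
  exact: Ux.
rewrite -integral_mkcond.
apply: (ge0_integrable_lty mu (measurable_funTS mf) (fun x _ => powR_ge0 _ _)).1.
apply: (integrable_bounded (C := C `^ b)) => //; first exact: measurable_funTS.
move=> x _; rewrite ger0_norm ?powR_ge0//.
apply: ge0_ler_powR; rewrite ?nnegrE//; first exact: ltW.
exact: le_trans (normr_ge0 _) (HC x).
Qed.

Lemma test_fun_grad_norm phi : test_fun U phi ->
  (\int[mu]_x (grad_norm phi x `^ 2)%:E =
   (\int[mu]_(x in U) dot (grad phi x) (grad phi x))%:E)%E.
Proof.
move=> tp; have [K [cK KU _ phi0]] := test_fun_support tp.
have E x : grad_norm phi x `^ 2 = dot (grad phi x) (grad phi x).
  by rewrite powR_mulrn ?sqrtr_ge0// eucl_norm_sqr.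
under eq_integral do rewrite E.
rewrite (_ : (fun x => (dot (grad phi x) (grad phi x))%:E) =
    (EFin \o (fun x => dot (grad phi x) (grad phi x))) \_ U); last first.
  apply/funext => x; rewrite patchE; case: ifPn => //.
  rewrite notin_setE => Ux; rewrite /dot big1// => i _.
  by rewrite mxE phi0 ?mul0r// => /KU.
rewrite -integral_mkcond /Rintegral fineK//.
apply: integrable_fin_num => //.
by apply: integrable_dot => // i; have [] := test_fun_weak_grad oU bU tp i.
Qed.

(** Let N be the L^(ap) norm of [phi]. Gagliardo and Cauchy-Schwarz give N^(2a) <= a^2 B |grad
    phi|^2, where B is the integral of |phi|^(2(a-1)), and B <= K N^(2(a-1)) on a bounded set. As N
    is finite, N^(2(a-1)) can be divided out when N is not 0. *)
Lemma sobolev_test_fun a : 1 < a -> 2 * (a - 1) <= a * p ->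
  exists2 C : R, 0 <= C & forall phi, test_fun U phi ->
  ((\int[mu]_x (`|phi x| `^ (a * p))%:E) `^ (2 / (a * p)) <=
   (C * \int[mu]_(x in U) dot (grad phi x) (grad phi x))%:E)%E.
Proof.
move=> a1 ap; have a0 : 0 < a by rewrite (lt_trans _ a1).
have r0 : 0 < a * p by rewrite mulr_gt0.
have b0 : 0 < 2 * (a - 1) by rewrite mulr_gt0// subr_gt0.
have [K K0 HK] := test_fun_Lp_inclusion b0 ap.
exists (a ^+ 2 * K) => [|phi tp]; first by rewrite mulr_ge0// sqr_ge0.
have := test_fun_gagliardo a1 tp; rewrite test_fun_grad_norm//.
have := HK _ tp; have := test_fun_powR_lty r0 tp; have := test_fun_powR_lty b0 tp.
set X := (\int[mu]_x (`|phi x| `^ (a * p))%:E)%E.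
set B := (\int[mu]_x (`|phi x| `^ (2 * (a - 1)))%:E)%E.
have X0 : (0 <= X)%E by apply: integral_ge0 => x _; rewrite lee_fin powR_ge0.
have B0 : (0 <= B)%E by apply: integral_ge0 => x _; rewrite lee_fin powR_ge0.
set y := \int[mu]_(x in U) _.
have y0 : 0 <= y by apply: Rintegral_ge0 => x _; exact: dot_ge0.
case: X X0 => // x x0 ; case: B B0 => // b b0' _ _.
rewrite lee_fin in x0; rewrite lee_fin in b0'.
rewrite ?poweR_EFin -!EFinM ?poweR_EFin !lee_fin => bK xb.
pose N := x `^ (a * p)^-1.
have N0 : 0 <= N := powR_ge0 _ _.
have xN : x = N `^ (a * p) by rewrite -powRrM mulVf ?lt0r_neq0// powRr1.
have -> : x `^ (2 / (a * p)) = N ^+ 2.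
  by rewrite -powR_mulrn// -powRrM mulrC.
have bN : b <= K * N `^ (2 * (a - 1)).
  apply: le_trans bK _; rewrite ler_wpM2l// xN -powRrM.
  by rewrite mulrC divfK// lt0r_neq0.
have Na : N `^ a <= a * (b `^ 2^-1 * y `^ 2^-1).
  have ip0 : 0 <= p^-1 by rewrite invr_ge0 ltW.
  have : x `^ p^-1 <= ((a * (b `^ 2^-1 * y `^ 2^-1)) `^ p) `^ p^-1.
    by apply: ge0_ler_powR; rewrite ?nnegrE ?powR_ge0.
  rewrite -powRrM divff ?lt0r_neq0// powRr1; last first.
    by rewrite mulr_ge0 ?mulr_ge0 ?powR_ge0// ltW.
  by rewrite xN -powRrM mulfK ?lt0r_neq0.
have [->|NN] := eqVneq N 0.
  by rewrite expr0n/= mulr_ge0// mulr_ge0// sqr_ge0.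
have Ngt0 : 0 < N by rewrite lt_neqAle eq_sym NN.
have PN : 0 < N `^ (a - 1) by exact: powR_gt0.
have NaE : N `^ a = N * N `^ (a - 1) by rewrite mulr_powRB1.
have PE : N `^ (2 * (a - 1)) = (N `^ (a - 1)) ^+ 2.
  by rewrite mulrC powRrM powR_mulrn ?powR_ge0.
have : (N `^ a) ^+ 2 <= (a * (b `^ 2^-1 * y `^ 2^-1)) ^+ 2.
  by rewrite lerXn2r ?nnegrE ?powR_ge0// mulr_ge0 ?mulr_ge0 ?powR_ge0// ltW.
rewrite !powR12_sqrt// !exprMn !sqr_sqrtr// NaE exprMn => H.
rewrite -(ler_pM2r (exprn_gt0 2 PN)); apply: le_trans H _.
rewrite (_ : a ^+ 2 * K * y * _ = a ^+ 2 * ((K * N `^ (a - 1) ^+ 2) * y)); last by ring.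
by rewrite ler_wpM2l ?sqr_ge0// ler_wpM2r// -PE.
Qed.

End sobolev_inequality.

(** * The spaces H^{1,2} and H^{1,2}_0 and their bilinear forms *)

Section sobolev_space.
Context (R : realType) (d : nat) (U : set 'rV[R]_d).
Hypothesis oU : open U.
Hypothesis bU : bounded_set U.
Local Notation mu := (lebesgue_rV R d).
Implicit Types (u v w phi psi : 'rV[R]_d -> R) (G : 'rV[R]_d -> 'rV[R]_d).

Let mU : measurable U := open_measurable_rV oU.

Lemma weak_gradP u : H12_mem U u -> is_weak_grad U u (weak_grad U u).
Proof. by move=> [_ uG]; exact: (xgetPex (cst 0) uG). Qed.

Lemma weak_grad_Lp2 u i : H12_mem U u -> Lp U 2 (fun x => weak_grad U u x ord0 i).
Proof. by move=> /weak_gradP/(_ i)[]. Qed.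

Lemma is_weak_grad_lincomb (a : R) u v G G' : Lp U 2 u -> Lp U 2 v ->
  is_weak_grad U u G -> is_weak_grad U v G' ->
  is_weak_grad U (a *: u + v) (fun x => a *: G x + G' x).
Proof.
move=> Lu Lv uG vG i; have [LG EG] := uG i; have [LG' EG'] := vG i.
have E : (fun x => (a *: G x + G' x) ord0 i) =
    a *: (fun x => G x ord0 i) + (fun x => G' x ord0 i).
  by apply/funext => x; rewrite !fctE !mxE.
split; first by rewrite E; exact: Lp2_lincomb.
move=> phi tp; have Lp := test_fun_Lp2 oU bU tp.
have Lp' := @test_fun_pderiv_Lp2 _ _ _ oU bU _ i tp.
have -> : \int[mu]_(x in U) ((a *: G x + G' x) ord0 i * phi x) =
    dotU U (a *: (fun x => G x ord0 i) + (fun x => G' x ord0 i)) phi.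
  by apply: eq_Rintegral => x _; rewrite !fctE !mxE.
rewrite dotU_lincomb// -/(dotU U _ _) dotU_lincomb// /dotU EG// EG'//.
by rewrite mulrN opprD.
Qed.

Lemma H12_lincomb (a : R) u v : H12_mem U u -> H12_mem U v -> H12_mem U (a *: u + v).
Proof.
move=> [Lu [G uG]] [Lv [G' vG]]; split; first exact: Lp2_lincomb.
by exists (fun x => a *: G x + G' x); exact: is_weak_grad_lincomb.
Qed.

Lemma weak_grad_lincomb (a : R) u v : H12_mem U u -> H12_mem U v ->
  \forall x \ae mu, U x ->
    weak_grad U (a *: u + v) x = a *: weak_grad U u x + weak_grad U v x.
Proof.
move=> Hu Hv; apply: (weak_grad_unique oU bU).
  exact/weak_gradP/H12_lincomb.
by apply: is_weak_grad_lincomb; [have [] := Hu|have [] := Hv|exact: weak_gradP|exact: weak_gradP].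
Qed.

Lemma test_fun_H12 phi : test_fun U phi -> H12_mem U phi.
Proof.
move=> tp; split; first exact: test_fun_Lp2.
by exists (grad phi); exact: test_fun_weak_grad.
Qed.

Lemma weak_grad_test_fun phi : test_fun U phi ->
  \forall x \ae mu, U x -> weak_grad U phi x = grad phi x.
Proof.
move=> tp; apply: (weak_grad_unique oU bU); last exact: test_fun_weak_grad.
exact/weak_gradP/test_fun_H12.
Qed.

Definition gradf u v : R :=
  \int[mu]_(x in U) dot (weak_grad U u x) (weak_grad U v x).

Lemma integrable_gradf u v : H12_mem U u -> H12_mem U v ->
  mu.-integrable U (fun x => (dot (weak_grad U u x) (weak_grad U v x))%:E).
Proof.
by move=> Hu Hv; apply: integrable_dot => // i; exact: weak_grad_Lp2.
Qed.

Lemma gradfC u v : gradf u v = gradf v u.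
Proof. by apply: eq_Rintegral => x _; rewrite dotC. Qed.

Lemma gradf_ge0 u : 0 <= gradf u u.
Proof. by apply: Rintegral_ge0 => x _; exact: dot_ge0. Qed.

Lemma gradf_lincomb (a : R) u v w : H12_mem U u -> H12_mem U v -> H12_mem U w ->
  gradf (a *: u + v) w = a * gradf u w + gradf v w.
Proof.
move=> Hu Hv Hw; have iu := integrable_gradf Hu Hw; have iv := integrable_gradf Hv Hw.
rewrite /gradf -RintegralZl// -RintegralD//; last exact: (integrableZl mU a iu).
apply: ae_eq_Rintegral; apply: filterS (weak_grad_lincomb a Hu Hv) => x /[apply] ->.
by rewrite dot_lincomb.
Qed.

Lemma gradf_test_fun phi : test_fun U phi ->
  gradf phi phi = \int[mu]_(x in U) dot (grad phi x) (grad phi x).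
Proof.
move=> tp; apply: ae_eq_Rintegral.
by apply: filterS (weak_grad_test_fun tp) => x /[apply] ->.
Qed.

Lemma grad_normE u : H12_mem U u -> grad_norm U u = (Num.sqrt (gradf u u))%:E.
Proof.
move=> Hu; have iu := integrable_gradf Hu Hu.
rewrite /grad_norm L2_normE//; under eq_integral do rewrite eucl_norm_sqr.
rewrite -[X in (X `^ _)%E]fineK ?integrable_fin_num//.
by rewrite poweR_EFin powR12_sqrt// gradf_ge0.
Qed.

Definition H12f u v : R := dotU U u v + gradf u v.

Lemma H12f_ge0 u : 0 <= H12f u u.
Proof. by rewrite addr_ge0 ?dotU_ge0 ?gradf_ge0. Qed.

Lemma H12f_lincomb (a : R) u v w : H12_mem U u -> H12_mem U v -> H12_mem U w ->
  H12f (a *: u + v) w = a * H12f u w + H12f v w.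
Proof.
move=> Hu Hv Hw; have [Lu _] := Hu; have [Lv _] := Hv; have [Lw _] := Hw.
by rewrite /H12f dotU_lincomb// gradf_lincomb// mulrDr addrACA.
Qed.

Lemma H12f_triangle (a : R) u v : H12_mem U u -> H12_mem U v ->
  Num.sqrt (H12f (a *: u + v) (a *: u + v)) <=
  `|a| * Num.sqrt (H12f u u) + Num.sqrt (H12f v v).
Proof.
apply: (@form_triangle _ _ (H12_mem U) H12f).
- by move=> *; exact: H12_lincomb.
- by move=> *; exact: H12f_lincomb.
- by move=> u0 v0 _ _; rewrite /H12f dotUC gradfC.
- by move=> *; exact: H12f_ge0.
Qed.

Lemma H12_normE u : H12_mem U u -> H12_norm U u = (Num.sqrt (H12f u u))%:E.
Proof.
move=> Hu; have [Lu _] := Hu.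
rewrite /H12_norm grad_normE// L2_norm_dotU// -!EFin_expe -EFinD.
by rewrite !sqr_sqrtr ?dotU_ge0 ?gradf_ge0// poweR_EFin powR12_sqrt// H12f_ge0.
Qed.

Lemma foldr_pderiv_lincomb (a : R) phi psi s : smooth phi -> smooth psi ->
  foldr (@pderiv R d) (a *: phi + psi) s =
  a *: foldr (@pderiv R d) phi s + foldr (@pderiv R d) psi s.
Proof.
move=> sp sq; elim: s => //= i s ->; apply/funext => x.
have [_ dp] := sp s; have [_ dq] := sq s.
by rewrite /pderiv deriveD ?deriveZ//; exact: derivableZ.
Qed.

Lemma test_fun_lincomb (a : R) phi psi : test_fun U phi -> test_fun U psi ->
  test_fun U (a *: phi + psi).
Proof.
move=> [sp cp Up] [sq cq Uq].
have sub : closure [set x | (a *: phi + psi) x != 0] `<=`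
    closure [set x | phi x != 0] `|` closure [set x | psi x != 0].
  rewrite -closureU; apply: closure_subset => x /=; rewrite !fctE => xn.
  apply: contrapT => /not_orP[/negP + /negP]; rewrite !negbK => /eqP p0 /eqP q0.
  by move: xn; rewrite p0 q0 scaler0 addr0 eqxx.
split.
- move=> s; rewrite foldr_pderiv_lincomb//; have [cps dp] := sp s; have [cqs dq] := sq s.
  split=> [x|i x].
    apply: continuousD; last exact: cqs.
    rewrite (_ : a *: _ = cst a * foldr (@pderiv R d) phi s)//.
    by apply: continuousM; [exact: cst_continuous|exact: cps].
  by apply: derivableD => //; exact: derivableZ.
- apply: subclosed_compact sub; first exact: closed_closure.
  exact: compactU.
- by move=> x /sub[/Up|/Uq].
Qed.

Lemma H120_H12 u : H120_mem U u -> H12_mem U u.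
Proof. by case. Qed.

Lemma H120_approx u e : H120_mem U u -> 0 < e -> exists2 phi, test_fun U phi &
  Num.sqrt (H12f (u - phi) (u - phi)) < e.
Proof.
move=> [Hu +] e0 => /(_ e e0)[phi tp H]; exists phi => //.
rewrite -lte_fin -H12_normE//; rewrite -[u - phi]addrC -scaleN1r.
by apply: H12_lincomb => //; exact: test_fun_H12.
Qed.

Lemma H12_sub u v : H12_mem U u -> H12_mem U v -> H12_mem U (u - v).
Proof. by move=> Hu Hv; rewrite addrC -scaleN1r; exact: H12_lincomb. Qed.

Lemma H120_lincomb (a : R) u v : H120_mem U u -> H120_mem U v ->
  H120_mem U (a *: u + v).
Proof.
move=> Hu Hv; have Hu1 := H120_H12 Hu; have Hv1 := H120_H12 Hv.
split; first exact: H12_lincomb.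
move=> e e0; have e2 : 0 < e / 2 / (`|a| + 1) by rewrite !divr_gt0// ltr_wpDl.
have [phi tp Hphi] := H120_approx Hu e2.
have [psi tq Hpsi] := H120_approx Hv (divr_gt0 e0 (ltr0Sn _ 1)).
exists (a *: phi + psi); first exact: test_fun_lincomb.
have -> : (a *: u + v - (a *: phi + psi))%R = a *: (u - phi) + (v - psi).
  by rewrite scalerBr opprD addrACA.
have Hup := H12_sub Hu1 (test_fun_H12 tp); have Hvp := H12_sub Hv1 (test_fun_H12 tq).
rewrite H12_normE; last exact: H12_lincomb.
rewrite lte_fin (le_lt_trans (H12f_triangle _ Hup Hvp))// (splitr e).
rewrite ler_ltD// (@le_trans _ _ (`|a| * (e / 2 / (`|a| + 1))))//.
  by rewrite ler_wpM2l// ltW.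
rewrite mulrA ler_pdivrMr ?ltr_wpDl// mulrC ler_wpM2l ?divr_ge0 ?(ltW e0)//.
by rewrite lerDl.
Qed.

End sobolev_space.

Section form_bound.
Context (R : realType) (n : nat) (U : set 'rV[R]_n.+2).
Hypothesis oU : open U.
Hypothesis bU : bounded_set U.
Local Notation mu := (lebesgue_rV R n.+2).
Implicit Types (W u v phi : 'rV[R]_n.+2 -> R).

Let mU : measurable U := open_measurable_rV oU.

(** Hölder with exponents s and s', then the Sobolev inequality for the L^(2s') norm. The constant
    does not depend on [W], so it can be fixed before [W] is truncated. *)
Lemma form_bound_test_fun (s : R) : 1 < s -> n.+2%:R <= 2 * s ->
  exists2 C : R, 0 <= C & forall W phi, measurable_fun U W ->
    (forall x, 0 <= W x) -> test_fun U phi ->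
  (\int[mu]_(x in U) (W x * phi x ^+ 2)%:E <=
   (\int[mu]_(x in U) (W x `^ s)%:E) `^ s^-1 * (C * gradf U phi phi)%:E)%E.
Proof.
move=> s1 ds; have s0 : 0 < s by rewrite (lt_trans _ s1).
have s10 : 0 < s - 1 by rewrite subr_gt0.
pose s' := s / (s - 1); have s'0 : 0 < s' by rewrite divr_gt0.
have ss' : s^-1 + s'^-1 = 1.
  by rewrite /s' invf_div -[X in X + _]mul1r -mulrDl addrC subrK divff// lt0r_neq0.
pose p : R := n.+2%:R / n.+1%:R; have p0 : 0 < p by rewrite divr_gt0.
(* This power makes the Gagliardo exponent a p equal to 2 s'. The condition 2 (a - 1) <= a p of the
   Sobolev inequality then amounts to d <= 2 s. *)
pose a := 2 * s' / p; have ap : a * p = 2 * s' by rewrite divfK// lt0r_neq0.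
have N0 : 0 <= n%:R :> R by [].
have n1 : n.+1%:R = n%:R + 1 :> R by rewrite -natr1.
have n2 : n.+2%:R = n%:R + 2 :> R by rewrite -addn2 natrD.
have aE : a = 2 * s * (n%:R + 1) / ((s - 1) * (n%:R + 2)).
  rewrite /a /s' /p n1 n2; field.
  by rewrite !gt_eqF//= ?ltr_wpDl.
have den0 : 0 < (s - 1) * (n%:R + 2) by rewrite mulr_gt0// ltr_wpDl.
have a1 : 1 < a by rewrite aE ltr_pdivlMr// mul1r; nra.
have a2 : 2 * (a - 1) <= a * p.
  rewrite ap /s' aE -subr_ge0.
  rewrite (_ : _ - _ = 2 * (2 * s - (n%:R + 2)) / ((s - 1) * (n%:R + 2))).
    by rewrite divr_ge0 ?(ltW den0)// mulr_ge0// subr_ge0 -n2.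
  by field; rewrite !gt_eqF//= ?ltr_wpDl.
have [C C0 HC] := sobolev_test_fun oU bU a1 a2.
exists C => // W phi mW W0 tp.
have mphi := continuous_measurable_rV (test_fun_continuous tp).
have mWU := (measurable_restrictT _ mU).1 mW.
have WU0 x : 0 <= (W \_ U) x by rewrite patchE; case: ifP.
have := @hoelder_ge0 _ _ R mu (W \_ U) (fun x => phi x ^+ 2) s s' mWU
  (measurable_funX 2 mphi) WU0 (fun=> sqr_ge0 _) s0 s'0 ss'.
rewrite (_ : (fun x => ((W \_ U) x * phi x ^+ 2)%:E) =
    (fun x => (W x * phi x ^+ 2)%:E) \_ U); last first.
  by apply/funext => x; rewrite !patchE; case: ifP => // _; rewrite mul0r.
rewrite (_ : (fun x => ((W \_ U) x `^ s)%:E) = (fun x => (W x `^ s)%:E) \_ U); last first.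
  by apply/funext => x; rewrite !patchE; case: ifP => // _; rewrite powR0// lt0r_neq0.
rewrite (_ : (fun x => ((phi x ^+ 2) `^ s')%:E) = (fun x => (`|phi x| `^ (a * p))%:E)); last first.
  by apply/funext => x; rewrite ap powRrM powR_mulrn// real_normK// num_real.
rewrite -(integral_mkcond U (fun x => (W x * phi x ^+ 2)%:E)).
rewrite -(integral_mkcond U (fun x => (W x `^ s)%:E)) => /le_trans; apply; apply: lee_wpmul2l; first exact: poweR_ge0.
have -> : s'^-1 = 2 / (a * p).
  by rewrite ap; move: (s') (lt0r_neq0 s'0) => t t0; field.
by rewrite (gradf_test_fun oU bU tp); exact: HC.
Qed.

Lemma form_bound_test_fun_eps (s : R) W (e : R) : 1 < s -> n.+2%:R <= 2 * s ->
  measurable_fun U W -> (forall x, 0 <= W x) ->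
  (\int[mu]_(x in U) (W x `^ s)%:E < +oo)%E -> 0 < e ->
  exists2 K : R, 0 <= K & forall phi, test_fun U phi ->
  (\int[mu]_(x in U) (W x * phi x ^+ 2)%:E <=
   (e * gradf U phi phi + K * dotU U phi phi)%:E)%E.
Proof.
move=> s1 ds mW W0 Ws e0; have s0 : 0 < s by rewrite (lt_trans _ s1).
have [C C0 HC] := form_bound_test_fun s1 ds.
pose T k x := if k%:R < W x then W x else 0.
have T0 k x : 0 <= T k x by rewrite /T; case: ifP.
have mT (k : nat) : measurable_fun U (T k).
  apply: (measurableT_comp (f := fun y : R => if k%:R < y then y else 0)) mW.
  by apply: measurable_fun_ifT => //; exact: measurable_fun_ltr.
have mTs k : measurable_fun U (fun x => T k x `^ s).
  exact: (measurableT_comp (measurable_powR s)).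
have mWs : measurable_fun U (fun x => W x `^ s).
  exact: (measurableT_comp (measurable_powR s)).
have iWs : mu.-integrable U (EFin \o (fun x => W x `^ s)).
  exact: (ge0_integrable_lty mu mWs (fun x _ => powR_ge0 _ _)).2.
have TW k x : T k x <= W x by rewrite /T; case: ifP.
have [||||_ cvT] := @dominated_convergence_Rintegral _ _ R mu U
  (fun k x => T k x `^ s) (cst 0) (fun x => W x `^ s) mU mTs.
- exact: measurable_cst.
- apply: aeW => x _; apply: cvg_near_cst; near=> k.
  rewrite /T ltNge ifF ?powR0 ?lt0r_neq0//; apply/negbTE; rewrite negbK.
  by near: k; exact: nbhs_infty_ger.
- exact: iWs.
- apply: aeW => x k _; rewrite ger0_norm ?powR_ge0//.
  by apply: ge0_ler_powR; rewrite ?nnegrE// ltW.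
rewrite /= Rintegral_cst// mul0r in cvT.
(* The L^s norm of the part of [W] above the level is to be at most e / (C + 1), so that multiplying
   by C gives at most e; the 1 covers C = 0. *)
have ec0 : 0 < (e / (C + 1)) `^ s by rewrite powR_gt0// divr_gt0// ltr_wpDl.
have [k _ Hk] := (cvgr0_norm_le _ cvT) _ ec0.
have {Hk} := Hk k (leqnn k); rewrite ger0_norm; last first.
  by apply: Rintegral_ge0 => x _; exact: powR_ge0.
move=> Tk.
exists k%:R => // phi tp.
have Lphi := test_fun_Lp2 oU bU tp.
have mphi := Lp2_measurable mU Lphi.
apply: (@le_trans _ _ (\int[mu]_(x in U) ((T k x * phi x ^+ 2)%:E + (k%:R * phi x ^+ 2)%:E))%E).
  apply: ae_le_integral_lower => //.
  - by move=> x _; rewrite lee_fin mulr_ge0// sqr_ge0.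
  - by move=> x _; rewrite -EFinD lee_fin addr_ge0// mulr_ge0// sqr_ge0.
  apply: aeW => x _; rewrite -EFinD lee_fin /T; case: ltP => Wk.
    by rewrite lerDl mulr_ge0// sqr_ge0.
  by rewrite mul0r add0r ler_wpM2r// sqr_ge0.
have mphi2 : measurable_fun U (fun x => phi x ^+ 2) by exact: measurable_funX.
rewrite ge0_integralD//; last 4 first.
- by move=> x _; rewrite lee_fin mulr_ge0// sqr_ge0.
- by apply/measurable_EFinP; exact: measurable_funM.
- by move=> x _; rewrite lee_fin mulr_ge0// sqr_ge0.
- by apply/measurable_EFinP; exact: measurable_funM.
rewrite EFinD; apply: leeD; last first.
  under eq_integral do rewrite EFinM.
  rewrite ge0_integralZl//; last 2 first.
  - exact/measurable_EFinP.
  - by move=> x _; rewrite lee_fin sqr_ge0.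
  by rewrite -dotU_EFin.
apply: le_trans (HC _ _ (mT k) (T0 k) tp) _.
have iTs : mu.-integrable U (EFin \o (fun x => T k x `^ s)).
  apply: (le_integrable mU _ _ iWs); first exact/measurable_EFinP.
  move=> x _ /=; rewrite lee_fin !ger0_norm ?powR_ge0//.
  by apply: ge0_ler_powR; rewrite ?nnegrE// ltW.
rewrite -[X in (X `^ _ * _)%E]fineK; last exact: integrable_fin_num.
rewrite poweR_EFin -EFinM lee_fin mulrA ler_wpM2r ?gradf_ge0//.
have : (fine (\int[mu]_(x in U) (T k x `^ s)%:E)%E) `^ s^-1 <= e / (C + 1).
  have -> : e / (C + 1) = ((e / (C + 1)) `^ s) `^ s^-1.
    by rewrite -powRrM divff ?lt0r_neq0// powRr1// divr_ge0 ?addr_ge0// ltW.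
  apply: ge0_ler_powR; rewrite ?invr_ge0 ?nnegrE ?powR_ge0 ?(ltW s0)//.
  by apply: Rintegral_ge0 => x _; exact: powR_ge0.
move=> H; apply: (@le_trans _ _ (e / (C + 1) * C)); first by rewrite ler_wpM2r.
have C1 : 0 < C + 1 by rewrite ltr_wpDl.
by rewrite mulrAC ler_pdivrMr// ler_wpM2l ?(ltW e0)// lerDl.
Unshelve. all: by end_near. Qed.

End form_bound.

Section ae_integral_bounds.
Context d (T : measurableType d) (R : realType).
Variables (mu : {measure set T -> \bar R}) (D : set T).
Hypothesis mD : measurable D.
Implicit Types (f g : T -> R).

Lemma ae_Rintegral_ge0 f : (\forall x \ae mu, D x -> 0 <= f x) ->
  0 <= \int[mu]_(x in D) f x.
Proof.
move=> f0; rewrite (@ae_eq_Rintegral _ _ _ mu D f (fun x => `|f x|)).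
  exact: Rintegral_ge0.
by apply: filterS f0 => x /[apply] fx; rewrite ger0_norm.
Qed.

Lemma ae_le_Rintegral f g : mu.-integrable D (EFin \o f) ->
  mu.-integrable D (EFin \o g) -> (\forall x \ae mu, D x -> f x <= g x) ->
  \int[mu]_(x in D) f x <= \int[mu]_(x in D) g x.
Proof.
move=> fi gi fg; rewrite -subr_ge0 -RintegralB//; apply: ae_Rintegral_ge0.
by apply: filterS fg => x /[apply]; rewrite subr_ge0.
Qed.

Lemma ae_le_integrable f g : measurable_fun D f -> mu.-integrable D (EFin \o g) ->
  (\forall x \ae mu, D x -> `|f x| <= g x) -> mu.-integrable D (EFin \o f).
Proof.
move=> mf /integrableP[mg gi] fg; apply/integrableP; split; first exact/measurable_EFinP.
apply: le_lt_trans gi; apply: ae_le_integral_lower => //; apply: filterS fg => x /[apply] fgx.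
by rewrite /= lee_fin (le_trans fgx)// ler_norm.
Qed.

End ae_integral_bounds.

Section H120_bounds.
Context (R : realType) (d : nat) (U : set 'rV[R]_d).
Hypothesis oU : open U.
Hypothesis bU : bounded_set U.
Local Notation mu := (lebesgue_rV R d).
Implicit Types (W u v f F G phi : 'rV[R]_d -> R).

Let mU : measurable U := open_measurable_rV oU.

(** The diffusion, drift and [c] terms of the elliptic form are all handled this way, each being
    dominated by a product of two square integrable functions. *)
Lemma ae_le_Lp2M f F G : measurable_fun U f -> Lp U 2 F -> Lp U 2 G ->
  (\forall x \ae mu, U x -> `|f x| <= F x * G x) ->
  mu.-integrable U (EFin \o f) /\
  `|\int[mu]_(x in U) f x| <= Num.sqrt (dotU U F F) * Num.sqrt (dotU U G G).
Proof.
move=> mf LF LG fFG; have iFG := integrable_Lp2M mU LF LG.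
have fi := ae_le_integrable mf iFG fFG.
split => //; apply: le_trans (le_normr_Rintegral mU fi) _.
apply: le_trans (dotU_cauchy_schwarz mU LF LG).
apply: le_trans (ler_norm _); apply: ae_le_Rintegral => //.
exact: integrable_norm.
Qed.

Lemma Lp2_sqrtM W u : measurable_fun U W -> (forall x, 0 <= W x) -> measurable_fun U u ->
  (\int[mu]_(x in U) (W x * u x ^+ 2)%:E < +oo)%E ->
  Lp U 2 (fun x => Num.sqrt (W x) * u x) /\
  ((dotU U (fun x => Num.sqrt (W x) * u x) (fun x => Num.sqrt (W x) * u x))%:E =
    \int[mu]_(x in U) (W x * u x ^+ 2)%:E)%E.
Proof.
move=> mW W0 mu_ fin.
have E x : (Num.sqrt (W x) * u x) ^+ 2 = W x * u x ^+ 2 by rewrite exprMn sqr_sqrtr.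
have msW : measurable_fun U (fun x => Num.sqrt (W x)).
  apply: (measurableT_comp (f := @Num.sqrt R)) => //.
  by apply: continuous_measurable_fun; exact: sqrt_continuous.
have L : Lp U 2 (fun x => Num.sqrt (W x) * u x).
  apply/(Lp2P mU); split; first exact: measurable_funM.
  under eq_fun do rewrite E.
  apply: (ge0_integrable_lty mu _ _).2 => //.
    by apply: measurable_funM => //; exact: measurable_funX.
  by move=> x _; rewrite mulr_ge0// sqr_ge0.
split => //; rewrite (dotU_EFin mU L).
by apply: eq_integral => x _; rewrite E.
Qed.

(** Test functions are dense for the H^{1,2} norm, but the weighted form is not known to be
    continuous. It is for the bounded weights min(W, k), and monotone convergence removes the
    truncation. *)
Lemma H120_form_bound W (c1 c2 : R) u : measurable_fun U W -> (forall x, 0 <= W x) ->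
  0 <= c1 -> 0 <= c2 ->
  (forall phi, test_fun U phi -> (\int[mu]_(x in U) (W x * phi x ^+ 2)%:E <=
     (c1 * gradf U phi phi + c2 * dotU U phi phi)%:E)%E) ->
  H120_mem U u ->
  (\int[mu]_(x in U) (W x * u x ^+ 2)%:E <=
     (c1 * gradf U u u + c2 * dotU U u u)%:E)%E.
Proof.
move=> mW W0 c10 c20 HW Hu; have Hu1 := H120_H12 Hu; have [Lu _] := Hu1.
have mu_ := Lp2_measurable mU Lu.
pose Wk (k : nat) x := Num.min (W x) k%:R.
have Wk0 k x : 0 <= Wk k x by rewrite le_min W0 ler0n.
have mWk k : measurable_fun U (Wk k) by apply: measurable_minr.
pose h v w := c1 * gradf U v w + c2 * dotU U v w.
pose q k v w := dotU U (fun x => Num.sqrt (Wk k x) * v x) (fun x => Num.sqrt (Wk k x) * w x).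
have Lq k v : Lp U 2 v -> Lp U 2 (fun x => Num.sqrt (Wk k x) * v x) /\
    ((q k v v)%:E = \int[mu]_(x in U) (Wk k x * v x ^+ 2)%:E)%E /\
    q k v v <= k%:R * dotU U v v.
  move=> Lv; have mv := Lp2_measurable mU Lv; have [_ iv2] := (Lp2P mU v).1 Lv.
  have mWv : measurable_fun U (fun x => Wk k x * v x ^+ 2).
    by apply: measurable_funM => //; exact: measurable_funX.
  have Wkv : (\int[mu]_(x in U) (Wk k x * v x ^+ 2)%:E <= (k%:R * dotU U v v)%:E)%E.
    rewrite EFinM (dotU_EFin mU Lv) -ge0_integralZl//; last 2 first.
    - exact: measurable_int iv2.
    - by move=> x _; rewrite lee_fin sqr_ge0.
    apply: ge0_le_integral => //.
    - by move=> x _; rewrite lee_fin mulr_ge0// sqr_ge0.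
    - exact/measurable_EFinP.
    - apply: emeasurable_funM => //; exact: measurable_int iv2.
    - by move=> x _; rewrite -EFinM lee_fin ler_wpM2r ?sqr_ge0// ge_min lexx orbT.
  have [L E] := Lp2_sqrtM (mWk k) (Wk0 k) mv (le_lt_trans Wkv (ltry _)).
  by split => //; split => //; rewrite -lee_fin /q E.
(* Square roots of [q k] and [h] are seminorms, both bounded by the H^{1,2} norm; replacing [u] by a
   close test function costs at most [B] times the distance. *)
have key k : q k u u <= h u u.
  rewrite -ler_sqrt; last first.
    by rewrite addr_ge0// mulr_ge0// ?gradf_ge0 ?dotU_ge0.
  apply/ler_addgt0Pr => e e0.
  pose B := Num.sqrt k%:R + Num.sqrt (c1 + c2).
  have B0 : 0 <= B by rewrite addr_ge0 ?sqrtr_ge0.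
  have B1 : 0 < B + 1 by rewrite ltr_wpDl.
  have [phi tp dphi] := H120_approx oU bU Hu (divr_gt0 e0 B1).
  have Hphi := test_fun_H12 oU bU tp; have [Lphi _] := Hphi.
  have Hd := H12_sub oU bU Hu1 Hphi; have [Ld _] := Hd.
  have Hd' := H12_sub oU bU Hphi Hu1.
  have qt : Num.sqrt (q k u u) <= Num.sqrt (q k phi phi) + Num.sqrt (q k (u - phi) (u - phi)).
    have [L1 _] := Lq k _ Lphi; have [L2 _] := Lq k _ Ld.
    have := @form_triangle _ _ (Lp U 2) (@dotU _ _ U) (Lp2_lincomb mU) (dotU_lincomb mU)
      (fun u v _ _ => dotUC U u v) (fun u _ => dotU_ge0 U u) 1 _ _ L1 L2.
    rewrite normr1 mul1r; apply: le_trans; rewrite le_eqVlt; apply/orP; left; apply/eqP.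
    rewrite /q; have E : (fun x => Num.sqrt (Wk k x) * u x) =
      1 *: (fun x => Num.sqrt (Wk k x) * phi x) + (fun x => Num.sqrt (Wk k x) * (u - phi) x).
      by apply/funext => x; rewrite !fctE !scale1r mulrBr addrC subrK.
    by rewrite -E.
  have ht : Num.sqrt (h phi phi) <= Num.sqrt (h u u) + Num.sqrt (h (u - phi) (u - phi)).
    have hS (a : R) v1 v2 v3 : H12_mem U v1 -> H12_mem U v2 -> H12_mem U v3 ->
        h (a *: v1 + v2) v3 = a * h v1 v3 + h v2 v3.
      move=> h1 h2 h3; have [l1 _] := h1; have [l2 _] := h2; have [l3 _] := h3.
      rewrite /h gradf_lincomb// dotU_lincomb//.
      by rewrite !mulrDr [in RHS]addrACA; congr (_ + _ + (_ + _)); rewrite mulrCA.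
    have := @form_triangle _ _ (H12_mem U) h (H12_lincomb oU bU) hS
      (fun u v _ _ => congr2 (fun x y => c1 * x + c2 * y) (gradfC U u v) (dotUC U u v))
      (fun u _ => addr_ge0 (mulr_ge0 c10 (gradf_ge0 U u)) (mulr_ge0 c20 (dotU_ge0 U u)))
      (-1) _ _ Hd Hu1.
    have E : (-1) *: (u - phi) + u = phi by rewrite scaleN1r opprB subrK.
    by rewrite normrN1 mul1r E => H; rewrite addrC.
  have qphi : q k phi phi <= h phi phi.
    have [_ [E _]] := Lq k _ Lphi; rewrite -lee_fin E.
    apply: le_trans (HW _ tp); apply: ae_le_integral_lower => //.
    - by move=> x _; rewrite lee_fin mulr_ge0// sqr_ge0.
    - by move=> x _; rewrite lee_fin mulr_ge0// sqr_ge0.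
    - by apply: aeW => x _; rewrite lee_fin ler_wpM2r ?sqr_ge0// ge_min lexx.
  apply: le_trans qt _.
  pose D := H12f U (u - phi) (u - phi).
  have qd : Num.sqrt (q k (u - phi) (u - phi)) <= Num.sqrt k%:R * Num.sqrt D.
    rewrite -sqrtrM// ler_wsqrtr//; have [_ [_ Hq]] := Lq k _ Ld.
    by apply: le_trans Hq _; rewrite ler_wpM2l// lerDl gradf_ge0.
  have hd : Num.sqrt (h (u - phi) (u - phi)) <= Num.sqrt (c1 + c2) * Num.sqrt D.
    rewrite -sqrtrM ?addr_ge0// ler_wsqrtr// /h /D /H12f.
    have := gradf_ge0 U (u - phi); have := dotU_ge0 U (u - phi).
    set x := dotU _ _ _; set y := gradf _ _ _; move: x y => x y x0 y0; nra.
  have sq : Num.sqrt (q k phi phi) <= Num.sqrt (h phi phi) by apply: ler_wsqrtr.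
  apply: le_trans (lerD (le_trans sq (le_trans ht (lerD (lexx _) hd))) qd) _.
  rewrite -addrA lerD2l -mulrDl addrC -/B.
  apply: le_trans (ler_wpM2l B0 (ltW dphi)) _.
  by rewrite mulrA ler_pdivrMr// mulrC ler_wpM2l ?(ltW e0)// lerDl.
have cv : (\int[mu]_(x in U) (Wk k x * u x ^+ 2)%:E @[k --> \oo] -->
    \int[mu]_(x in U) (W x * u x ^+ 2)%:E)%E.
  rewrite (_ : (\int[mu]_(x in U) (W x * u x ^+ 2)%:E)%E =
    (\int[mu]_(x in U) (limn (fun k => (Wk k x * u x ^+ 2)%:E)))%E); last first.
    apply: eq_integral => x _; apply/esym/cvg_lim => //; apply: cvg_EFin; first exact: nearW.
    apply: cvg_near_cst; near=> k; rewrite /= /Wk min_l//.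
    by near: k; exact: nbhs_infty_ger.
  apply: cvg_monotone_convergence => //.
  - move=> k; apply/measurable_EFinP; apply: measurable_funM => //; exact: measurable_funX.
  - by move=> k x _; rewrite lee_fin mulr_ge0// sqr_ge0.
  - move=> x _ k l kl; rewrite lee_fin ler_wpM2r ?sqr_ge0// /Wk le_min !ge_min lexx/=.
    by rewrite ler_nat kl orbT.
rewrite -(cvg_lim _ cv)//; apply: lime_le; first by apply/cvg_ex; eexists; exact: cv.
apply: nearW => k; have [_ [<- _]] := Lq k _ Lu.
by rewrite lee_fin; exact: key.
Unshelve. all: by end_near. Qed.

End H120_bounds.

(** * The elliptic form *)

Section elliptic_form.
Context (R : realType) (n : nat) (U : set 'rV[R]_n.+2).
Hypothesis oU : open U.
Hypothesis bU : bounded_set U.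
Local Notation mu := (lebesgue_rV R n.+2).
Implicit Types (u v w : 'rV[R]_n.+2 -> R).
Let mU : measurable U := open_measurable_rV oU.
Local Notation wg := (weak_grad U).
Local Notation N u := (Num.sqrt (gradf U u u)).

Lemma H120_form_bound_eps (s : R) (W : 'rV[R]_n.+2 -> R) (e : R) : 1 < s -> n.+2%:R <= 2 * s ->
  measurable_fun U W -> (forall x, 0 <= W x) ->
  (\int[mu]_(x in U) (W x `^ s)%:E < +oo)%E -> 0 < e ->
  exists2 K : R, 0 <= K & forall u, H120_mem U u ->
  (\int[mu]_(x in U) (W x * u x ^+ 2)%:E <=
   (e * gradf U u u + K * dotU U u u)%:E)%E.
Proof.
move=> s1 ds mW W0 Ws e0.
have [K K0 HK] := form_bound_test_fun_eps oU bU s1 ds mW W0 Ws e0.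
exists K => // u Hu; apply: H120_form_bound => //; exact: ltW.
Qed.

(** The form bound for the weight 1, which has a finite L^s norm because [U] is bounded; s = d is an
    admissible exponent. *)
Lemma poincare : exists2 P : R, 0 <= P &
  forall u, H120_mem U u -> dotU U u u <= P * gradf U u u.
Proof.
have s1 : 1 < n.+2%:R :> R by rewrite ltr1n.
have ds : n.+2%:R <= 2 * n.+2%:R :> R by rewrite ler_peMl// ler1n.
have [C C0 HC] := form_bound_test_fun oU bU s1 ds.
pose m := fine (\int[mu]_(x in U) ((1 : R) `^ n.+2%:R)%:E)%E.
have mE : (\int[mu]_(x in U) ((1 : R) `^ n.+2%:R)%:E = m%:E)%E.
  rewrite /m fineK// powR1 integral_cst// mul1e ge0_fin_numE//.
  exact: bounded_set_measure_lty.
exists (m `^ n.+2%:R^-1 * C) => [|u Hu]; first by rewrite mulr_ge0// powR_ge0.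
have [[Lu _] _] := Hu.
rewrite -lee_fin (dotU_EFin mU Lu).
have E : (fun x => (u x ^+ 2)%:E) = (fun x => ((cst 1 : 'rV[R]_n.+2 -> R) x * u x ^+ 2)%:E).
  by apply/funext => x; rewrite mul1r.
rewrite E -[_ * gradf U u u]addr0 -(mul0r (dotU U u u)).
apply: H120_form_bound => //.
- by rewrite mulr_ge0// powR_ge0.
- move=> phi tp; have := HC (cst 1) phi (measurable_cst _) (fun=> ler01) tp.
  by rewrite [X in (_ <= X `^ _ * _)%E -> _]mE poweR_EFin -EFinM mulrA mul0r addr0.
Qed.

Lemma H120_weight_bound (s : R) (W : 'rV[R]_n.+2 -> R) : 1 < s -> n.+2%:R <= 2 * s ->
  measurable_fun U W -> (forall x, 0 <= W x) ->
  (\int[mu]_(x in U) (W x `^ s)%:E < +oo)%E ->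
  exists2 K : R, 0 <= K & forall u, H120_mem U u ->
  Lp U 2 (fun x => Num.sqrt (W x) * u x) /\
  Num.sqrt (dotU U (fun x => Num.sqrt (W x) * u x) (fun x => Num.sqrt (W x) * u x))
    <= K * N u.
Proof.
move=> s1 ds mW W0 Ws; have [P P0 HP] := poincare.
have [K K0 HK] := H120_form_bound_eps s1 ds mW W0 Ws ltr01.
exists (Num.sqrt (1 + K * P)) => [|u Hu]; first exact: sqrtr_ge0.
have [[Lu _] _] := Hu; have mu_ := Lp2_measurable mU Lu.
have Ku := HK u Hu.
have [L E] := Lp2_sqrtM oU mW W0 mu_ (le_lt_trans Ku (ltry _)).
split => //; rewrite -sqrtrM ?addr_ge0 ?mulr_ge0// ler_wsqrtr//.
rewrite -lee_fin E; apply: le_trans Ku _; rewrite lee_fin mulrDl lerD2l// -mulrA.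
by rewrite ler_wpM2l// HP.
Qed.

Lemma eucl_grad_Lp2 u : H12_mem U u ->
  Lp U 2 (fun x => eucl_norm (wg u x)) /\
  dotU U (fun x => eucl_norm (wg u x)) (fun x => eucl_norm (wg u x)) = gradf U u u.
Proof.
move=> Hu; split.
  apply/(Lp2P mU); split.
    by apply: measurable_eucl_norm => i; exact: (Lp2_measurable mU (weak_grad_Lp2 i Hu)).
  by under eq_fun do rewrite eucl_norm_sqr; exact: integrable_gradf.
by apply: eq_Rintegral => x _; rewrite -expr2 eucl_norm_sqr.
Qed.

Variables (A : 'rV[R]_n.+2 -> 'M[R]_n.+2) (M lambda : R).
Hypothesis mA : forall i j, measurable_fun [set: 'rV[R]_n.+2] (fun x => A x i j).
Hypothesis lambda_gt0 : 0 < lambda.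
Hypothesis A_bounded : \forall x \ae mu, forall i j : 'I_n.+2, `|A x i j| <= M.
Hypothesis A_elliptic : \forall x \ae mu, forall xi : 'rV[R]_n.+2,
  lambda * eucl_norm xi ^+ 2 <= dot (xi *m (A x)^T) xi.
Variables (H : 'rV[R]_n.+2 -> 'rV[R]_n.+2) (WH : 'rV[R]_n.+2 -> R) (sH : R).
Hypothesis mH : forall i, measurable_fun U (fun x => H x ord0 i).
Hypothesis mWH : measurable_fun U WH.
Hypothesis WH0 : forall x, 0 <= WH x.
Hypothesis sH1 : 1 < sH.
Hypothesis dsH : n.+2%:R <= 2 * sH.
Hypothesis WHs : (\int[mu]_(x in U) (WH x `^ sH)%:E < +oo)%E.
Hypothesis HWH : \forall x \ae mu, U x -> eucl_norm (H x) <= Num.sqrt (WH x).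
Variables (c : 'rV[R]_n.+2 -> R) (sc theta : R).
Hypothesis mc : measurable_fun U c.
Hypothesis sc1 : 1 < sc.
Hypothesis dsc : n.+2%:R <= 2 * sc.
Hypothesis cs : (\int[mu]_(x in U) (`|c x| `^ sc)%:E < +oo)%E.
Hypothesis c_ge0 : \forall x \ae mu, U x -> 0 <= c x.
Hypothesis theta_ge0 : 0 <= theta.

Definition diff_term u v x := dot (wg u x *m (A x)^T) (wg v x).
Definition drift_term u v x := dot (H x) (wg u x) * v x.
Definition zero_term u v x := (c x + theta) * u x * v x.

Definition aform u v : R :=
  \int[mu]_(x in U) (diff_term u v x + drift_term u v x + zero_term u v x).

Let wgm u i : H120_mem U u -> measurable_fun U (fun x => wg u x ord0 i).
Proof. by move=> Hu; exact: (Lp2_measurable mU (weak_grad_Lp2 i (H120_H12 Hu))). Qed.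

Let mem_m u : H120_mem U u -> measurable_fun U u.
Proof. by move=> [[Lu _] _]; exact: Lp2_measurable. Qed.

Let mulA_coord u x i : (wg u x *m (A x)^T) ord0 i = \sum_j wg u x ord0 j * A x i j.
Proof. by rewrite mxE; apply: eq_bigr => j _; rewrite mxE. Qed.

(** The crude constant counts entries: each of the d coordinates of A grad u is at most d |M| |grad
    u|. *)
Lemma diff_term_integrable u v : H120_mem U u -> H120_mem U v ->
  mu.-integrable U (EFin \o diff_term u v) /\
  `|\int[mu]_(x in U) diff_term u v x| <= n.+2%:R * (n.+2%:R * `|M|) * N u * N v.
Proof.
move=> Hu Hv; have [Lu Eu] := eucl_grad_Lp2 (H120_H12 Hu).
have [Lv Ev] := eucl_grad_Lp2 (H120_H12 Hv).
pose k : R := n.+2%:R * (n.+2%:R * `|M|).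
have k0 : 0 <= k by rewrite !mulr_ge0.
have Lku : Lp U 2 (fun x => k * eucl_norm (wg u x)).
  have := Lp2_lincomb mU k Lu (Lp2_bounded oU bU (f := cst 0) (C := 0) (measurable_cst _) _).
  rewrite (_ : k *: _ + cst 0 = (fun x => k * eucl_norm (wg u x))); first apply.
    by move=> x _; rewrite normr0.
  by apply/funext => x; rewrite !fctE addr0.
have mf : measurable_fun U (diff_term u v).
  apply: measurable_dot => i; last exact: wgm.
  under eq_fun do rewrite mulA_coord.
  apply: (@measurable_sum _ _ _ _ _ _ (fun j x => wg u x ord0 j * A x i j)) => j.
  apply: measurable_funM; first exact: wgm.
  exact: measurable_funTS.
have hb : \forall x \ae mu, U x -> `|diff_term u v x| <= k * eucl_norm (wg u x) * eucl_norm (wg v x).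
  apply: filterS A_bounded => x Ax _.
  rewrite /diff_term /dot (le_trans (ler_norm_sum _ _ _))//.
  have -> : k * eucl_norm (wg u x) * eucl_norm (wg v x) =
      \sum_(i < n.+2) (n.+2%:R * `|M| * (eucl_norm (wg u x) * eucl_norm (wg v x))).
    by rewrite sumr_const card_ord -[RHS]mulr_natl /k !mulrA.
  apply: ler_sum => i _; rewrite normrM mulrA; apply: ler_pM => //; last exact: coord_le_eucl_norm.
  rewrite mulA_coord (le_trans (ler_norm_sum _ _ _))//.
  have -> : n.+2%:R * `|M| * eucl_norm (wg u x) =
      \sum_(j < n.+2) (`|M| * eucl_norm (wg u x)).
    by rewrite sumr_const card_ord -[RHS]mulr_natl mulrA.
  apply: ler_sum => j _; rewrite normrM mulrC; apply: ler_pM => //; last exact: coord_le_eucl_norm.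
  by rewrite (le_trans (Ax i j))// ler_norm.
have [i1 b1] := ae_le_Lp2M oU mf Lku Lv hb; split => //.
apply: le_trans b1 _; rewrite Ev ler_wpM2r ?sqrtr_ge0//.
rewrite (_ : dotU U _ _ = k ^+ 2 * gradf U u u); last first.
  rewrite -Eu /dotU -RintegralZl//.
    by apply: eq_Rintegral => x _; rewrite expr2 mulrACA.
  exact: (integrable_Lp2M mU Lu Lu).
by rewrite sqrtrM ?sqr_ge0// sqrtr_sqr ger0_norm.
Qed.

(** The integrand is at most |grad u| times sqrt(WH) |v|, and the form bound puts the second factor
    in L^2. *)
Lemma drift_term_integrable : exists2 K : R, 0 <= K &
  forall u v, H120_mem U u -> H120_mem U v ->
  mu.-integrable U (EFin \o drift_term u v) /\
  `|\int[mu]_(x in U) drift_term u v x| <= K * N u * N v.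
Proof.
have [K K0 HK] := H120_weight_bound sH1 dsH mWH WH0 WHs.
exists K; first exact: K0.
move=> u v Hu Hv; have [Lu Eu] := eucl_grad_Lp2 (H120_H12 Hu).
have [Lv Ev] := HK v Hv.
have mf : measurable_fun U (drift_term u v).
  apply: measurable_funM; last exact: mem_m.
  by apply: measurable_dot => // i; exact: wgm.
have hb : \forall x \ae mu, U x ->
    `|drift_term u v x| <= eucl_norm (wg u x) * `|Num.sqrt (WH x) * v x|.
  apply: filterS HWH => x /[apply] Hx.
  rewrite /drift_term !normrM [`|Num.sqrt _|]ger0_norm ?sqrtr_ge0// mulrA ler_wpM2r//.
  by rewrite (le_trans (dot_cauchy_schwarz _ _))// mulrC ler_wpM2l// sqrtr_ge0.
have [i1 b1] := ae_le_Lp2M oU mf Lu (Lp2_norm mU Lv) hb; split => //.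
by apply: le_trans b1 _; rewrite Eu dotU_norm [K * _]mulrC -mulrA ler_wpM2l ?sqrtr_ge0.
Qed.

(** The weight |c| is shared out as a square root to each of [u] and [v], whence [K * K]; the
    [theta] part is the Poincaré inequality. *)
Lemma zero_term_integrable : exists2 K : R, 0 <= K &
  forall u v, H120_mem U u -> H120_mem U v ->
  mu.-integrable U (EFin \o zero_term u v) /\
  `|\int[mu]_(x in U) zero_term u v x| <= K * N u * N v.
Proof.
have [K K0 HK] := H120_weight_bound sc1 dsc (measurableT_comp (@normr_measurable R setT) mc)
  (fun=> normr_ge0 _) cs.
have [P P0 HP] := poincare.
exists (K * K + theta * P) => [|u v Hu Hv].
  by rewrite addr_ge0// mulr_ge0.
have [Lu Eu] := HK u Hu; have [Lv Ev] := HK v Hv.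
have [[Lu2 _] _] := Hu; have [[Lv2 _] _] := Hv.
have mcuv : measurable_fun U (fun x => c x * u x * v x).
  by apply: measurable_funM; [apply: measurable_funM => //; exact: mem_m|exact: mem_m].
have iuv := integrable_Lp2M mU Lu2 Lv2.
have itheta : mu.-integrable U (EFin \o (fun x => theta * (u x * v x))).
  exact: (integrableZl mU theta iuv).
have hb : \forall x \ae mu, U x -> `|c x * u x * v x| <=
    `|Num.sqrt `|c x| * u x| * `|Num.sqrt `|c x| * v x|.
  apply: aeW => x _; rewrite !normrM [`|Num.sqrt _|]ger0_norm ?sqrtr_ge0// [leRHS]mulrACA -expr2.
  by rewrite sqr_sqrtr// mulrA.
have [i1 b1] := ae_le_Lp2M oU mcuv (Lp2_norm mU Lu) (Lp2_norm mU Lv) hb.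
have zE : zero_term u v = (fun x => c x * u x * v x + theta * (u x * v x)).
  by apply/funext => x; rewrite /zero_term; ring.
split; first by rewrite zE; exact: (integrableD mU i1 itheta).
rewrite zE (RintegralD mU i1 itheta) (RintegralZl _ mU iuv) -/(dotU U u v).
apply: le_trans (ler_normD _ _) _; rewrite !mulrDl; apply: lerD.
  apply: le_trans b1 _; rewrite !dotU_norm.
  have -> : K * K * N u * N v = (K * N u) * (K * N v) by rewrite -(mulrA (K * K)) mulrACA.
  by apply: ler_pM; [exact: sqrtr_ge0|exact: sqrtr_ge0|exact: Eu|exact: Ev].
rewrite normrM (ger0_norm theta_ge0) -!mulrA; apply: ler_wpM2l; first exact: theta_ge0.
apply: le_trans (dotU_cauchy_schwarz mU Lu2 Lv2) _.
have -> : P * (N u * N v) = (Num.sqrt P * N u) * (Num.sqrt P * N v).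
  by rewrite [RHS]mulrACA -expr2 (sqr_sqrtr P0).
apply: ler_pM; [exact: sqrtr_ge0|exact: sqrtr_ge0| |];
  by rewrite -(sqrtrM _ P0); apply: ler_wsqrtr; exact: HP.
Qed.

Lemma integrable_aform u v : H120_mem U u -> H120_mem U v ->
  mu.-integrable U (EFin \o (fun x => diff_term u v x + drift_term u v x + zero_term u v x)).
Proof.
move=> Hu Hv; have [i1 _] := diff_term_integrable Hu Hv.
have [? _ /(_ u v Hu Hv)[i2 _]] := drift_term_integrable.
have [? _ /(_ u v Hu Hv)[i3 _]] := zero_term_integrable.
exact: (integrableD mU (integrableD mU i1 i2) i3).
Qed.

Lemma aform_bounded : exists2 K : R, 0 <= K &
  forall u v, H120_mem U u -> H120_mem U v -> `|aform u v| <= K * N u * N v.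
Proof.
have [K2 K20 H2] := drift_term_integrable; have [K3 K30 H3] := zero_term_integrable.
exists (n.+2%:R * (n.+2%:R * `|M|) + K2 + K3) => [|u v Hu Hv].
  by rewrite !addr_ge0// !mulr_ge0.
have [i1 b1] := diff_term_integrable Hu Hv.
have [i2 b2] := H2 u v Hu Hv; have [i3 b3] := H3 u v Hu Hv.
have i12 : mu.-integrable U (EFin \o (fun x => diff_term u v x + drift_term u v x)).
  exact: (integrableD mU i1 i2).
rewrite /aform (RintegralD mU i12 i3) (RintegralD mU i1 i2).
move: b1; move: (n.+2%:R * (n.+2%:R * `|M|)) => k b1; rewrite !mulrDl.
apply: le_trans (ler_normD _ _) _; apply: lerD; last exact: b3.
by apply: le_trans (ler_normD _ _) _; apply: lerD; [exact: b1|exact: b2].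
Qed.

Lemma aform_lincomb (a : R) u v w : H120_mem U u -> H120_mem U v -> H120_mem U w ->
  aform (a *: u + v) w = a * aform u w + aform v w.
Proof.
move=> Hu Hv Hw; have iu := integrable_aform Hu Hw; have iv := integrable_aform Hv Hw.
pose F u x := diff_term u w x + drift_term u w x + zero_term u w x.
have iau : mu.-integrable U (EFin \o (fun x => a * F u x)) by exact: (integrableZl mU a iu).
rewrite /aform -(RintegralZl a mU iu) -(RintegralD mU iau iv).
apply: ae_eq_Rintegral.
apply: filterS (weak_grad_lincomb oU bU a (H120_H12 Hu) (H120_H12 Hv)) => x /[apply] E.
rewrite /F /diff_term /drift_term /zero_term E mulmxDl -scalemxAl dot_lincomb.
rewrite !(dotC (H x)) dot_lincomb !fctE /GRing.scale/=.
set p1 := dot _ _; set p2 := dot _ _; set p3 := dot _ _; set p4 := dot _ _.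
by move: p1 p2 p3 p4 => p1 p2 p3 p4; ring.
Qed.

(* Young's inequality absorbs half of the ellipticity into the drift term, whose
   remaining part is form bounded with arbitrarily small relative bound. *)
Lemma aform_garding : exists2 K : R, 0 <= K &
  forall v, H120_mem U v -> - (K * dotU U v v) <= aform v v.
Proof.
(* Young's inequality leaves the factor 1 / (2 lambda) before the weighted form, so the relative
   bound lambda^2 costs exactly the remaining lambda / 2 of the ellipticity. *)
have l20 : 0 < lambda ^+ 2 by rewrite exprn_gt0.
have [K K0 HK] := H120_form_bound_eps sH1 dsH mWH WH0 WHs l20.
exists (K / (2 * lambda)) => [|v Hv]; first by rewrite divr_ge0// mulr_ge0// ltW.
have [[Lv _] _] := Hv; have mv := Lp2_measurable mU Lv.
have [LW EW] := Lp2_sqrtM oU mWH WH0 mv (le_lt_trans (HK v Hv) (ltry _)).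
have := HK v Hv; rewrite -EW lee_fin => {}HK.
set q := dotU U _ _ in HK.
have iv := integrable_aform Hv Hv.
have ig := integrable_gradf oU (H120_H12 Hv) (H120_H12 Hv).
have iq := integrable_Lp2M mU LW LW.
pose f x := lambda / 2 * dot (wg v x) (wg v x)
  + (- (2 * lambda)^-1) * ((Num.sqrt (WH x) * v x) * (Num.sqrt (WH x) * v x)).
have i1 : mu.-integrable U (EFin \o (fun x => lambda / 2 * dot (wg v x) (wg v x))).
  exact: (integrableZl mU (lambda / 2) ig).
have i2 : mu.-integrable U (EFin \o (fun x => (- (2 * lambda)^-1) *
    ((Num.sqrt (WH x) * v x) * (Num.sqrt (WH x) * v x)))).
  exact: (integrableZl mU (- (2 * lambda)^-1) iq).
have fE : \int[mu]_(x in U) f x = lambda / 2 * gradf U v v - (2 * lambda)^-1 * q.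
  by rewrite /f (RintegralD mU i1 i2) (RintegralZl _ mU ig) (RintegralZl _ mU iq) mulNr.
apply: (@le_trans _ _ (\int[mu]_(x in U) f x)).
  rewrite fE.
  have L0 : 0 < 2 * lambda by rewrite mulr_gt0.
  have Li : 0 <= (2 * lambda)^-1 by rewrite invr_ge0 ltW.
  have := ler_wpM2l Li HK.
  rewrite (_ : (2 * lambda)^-1 * (lambda ^+ 2 * gradf U v v + K * dotU U v v) =
    lambda / 2 * gradf U v v + K / (2 * lambda) * dotU U v v).
    set x := gradf _ _ _; set y := dotU _ _ _; set z := _ * q; set t := K / _ * y.
    by set r := lambda / 2 * x; move: z t r => z t r; lra.
  have l0 : lambda != 0 by rewrite gt_eqF.
  set x := gradf _ _ _; set y := dotU _ _ _; move: x y => x y.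
  by field.
apply: ae_le_Rintegral => //; first exact: (integrableD mU i1 i2).
apply: filterS3 A_elliptic HWH c_ge0 => x Ax Hx cx Ux.
have {}Ax := Ax (wg v x); have {}Hx := Hx Ux; have {}cx := cx Ux.
rewrite /f /diff_term /drift_term /zero_term -eucl_norm_sqr.
set g := eucl_norm (wg v x) in Ax *; have g0 : 0 <= g by exact: sqrtr_ge0.
have z0 : 0 <= (c x + theta) * v x * v x by rewrite -mulrA mulr_ge0 ?addr_ge0// -expr2 sqr_ge0.
have d0 : - (Num.sqrt (WH x) * `|v x| * g) <= dot (H x) (wg v x) * v x.
  rewrite lerNl; apply: le_trans (ler_norm _) _; rewrite normrN normrM.
  rewrite mulrAC ler_wpM2r//; apply: le_trans (dot_cauchy_schwarz _ _) _.
  by rewrite ler_wpM2r.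
have Y : Num.sqrt (WH x) * `|v x| * g <= lambda / 2 * g ^+ 2 +
    (2 * lambda)^-1 * (Num.sqrt (WH x) * v x * (Num.sqrt (WH x) * v x)).
  have -> : Num.sqrt (WH x) * v x * (Num.sqrt (WH x) * v x) = (Num.sqrt (WH x) * `|v x|) ^+ 2.
    by rewrite exprMn real_normK ?num_real// expr2 expr2 mulrACA.
  set t := Num.sqrt _ * _.
  rewrite -subr_ge0 (_ : _ - _ = (2 * lambda)^-1 * (lambda * g - t) ^+ 2).
    by rewrite mulr_ge0 ?sqr_ge0// invr_ge0 mulr_ge0// ltW.
  have l0 : lambda != 0 by rewrite gt_eqF.
  by move: t => t; field.
move: Ax d0 Y z0; set p1 := dot _ (wg v x); set p2 := dot _ _ * _; set p3 := _ * v x * v x.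
set p4 := _ * `|v x| * g; set p5 := (2 * lambda)^-1 * _; rewrite mulNr -/p5.
set p6 := g ^+ 2; move: p1 p2 p3 p4 p5 p6 => p1 p2 p3 p4 p5 p6.
rewrite (_ : lambda * p6 = lambda / 2 * p6 + lambda / 2 * p6); last by rewrite -mulrDl -splitr.
by set p7 := lambda / 2 * p6; move: p7 => p7; lra.
Qed.

End elliptic_form.

(** * Abstract evolution inequality *)

(** An a.e. limit need not be measurable for a sigma-algebra that is not complete. Multiplying by
    the indicator of the complement of a measurable null set makes the convergence hold everywhere
    on [D]. *)
Lemma ae_cvg_measurable d (T : measurableType d) (R : realType)
    (mu : {measure set T -> \bar R}) (D : set T) (f_ : nat -> T -> R) (f : T -> R) :
  measurable D -> (forall n, measurable_fun D (f_ n)) ->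
  (\forall t \ae mu, D t -> f_ n t @[n --> \oo] --> f t) ->
  exists2 g : T -> R, measurable_fun D g & \forall t \ae mu, D t -> f t = g t.
Proof.
move=> mD mf [Z [mZ Z0 HZ]].
have cvZ t : D t -> ~ Z t -> f_ n t @[n --> \oo] --> f t.
  by move=> Dt Zt; apply: contrapT => H; apply: Zt; apply: HZ => /= H'; apply: H; exact: H'.
exists (fun t => f t * \1_(~` Z) t); last first.
  exists Z; split => // t /= /not_implyP[Dt]; apply: contra_notP => Zt.
  by rewrite indicE mem_set// mulr1.
apply: (@measurable_fun_cvg _ _ _ _ (fun n t => f_ n t * \1_(~` Z) t)) => [n|t Dt].
  by apply: measurable_funM => //; apply: measurable_indic; exact: measurableC.
rewrite indicE; case: (boolP (t \in ~` Z)) => [/set_mem Zt|_].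
  by apply: cvgM; [exact: cvZ|exact: cvg_cst].
by rewrite mulr0; under eq_fun do rewrite mulr0; exact: cvg_cst.
Qed.

Section simple_integrals.
Context (R : realType) (X : Defs.space R).
Local Notation leb := (@lebesgue_measure R).
Local Notation S := (@sp_mem R X).
Hypothesis S0 : S 0.
Hypothesis S_lincomb : forall (a : R) (u v : X), S u -> S v -> S (a *: u + v).
Implicit Types (s : simple_fun X) (D : set R) (l : X -> R).

Definition linear_on l : Prop := forall (a : R) (u v : X), S u -> S v ->
  l (a *: u + v) = a * l u + l v.

Lemma linear_on0 l : linear_on l -> l 0 = 0.
Proof.
move=> ll; have := ll 1 0 0 S0 S0; rewrite scale1r addr0 mul1r => /eqP.
by rewrite -subr_eq0 opprD addrA subrr sub0r oppr_eq0 => /eqP.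
Qed.

Lemma linear_on_sum l (I : Type) (r : seq I) (k : I -> R) (v : I -> X) :
  linear_on l -> (forall i, S (v i)) ->
  S (\sum_(i <- r) k i *: v i) /\
  l (\sum_(i <- r) k i *: v i) = \sum_(i <- r) k i * l (v i).
Proof.
move=> ll Sv; elim: r => [|i r [IHS IH]].
  by rewrite !big_nil; split; [exact: S0|exact: linear_on0].
by rewrite !big_cons; split; [exact: S_lincomb|rewrite ll// IH].
Qed.

Lemma sf_eval_mem s t : S (sf_eval s t).
Proof.
have l0 : linear_on (fun=> 0) by move=> *; rewrite mulr0 addr0.
by have [] := linear_on_sum (index_enum 'I_(sf_size s)) (fun i => \1_(sf_piece i) t) l0
  (@sf_value_mem _ _ s).
Qed.

Lemma sf_integral_mem s D : S (sf_integral D s).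
Proof.
have l0 : linear_on (fun=> 0) by move=> *; rewrite mulr0 addr0.
by have [] := linear_on_sum (index_enum 'I_(sf_size s))
  (fun i => fine (leb (D `&` sf_piece i))) l0 (@sf_value_mem _ _ s).
Qed.

Lemma linear_sf_eval l s t : linear_on l ->
  l (sf_eval s t) = \sum_i \1_(sf_piece i) t * l (@sf_value _ _ s i).
Proof.
move=> ll.
by have [] := linear_on_sum (index_enum 'I_(sf_size s)) (fun i => \1_(sf_piece i) t) ll
  (@sf_value_mem _ _ s).
Qed.

Lemma measurable_linear_sf l s D : linear_on l ->
  measurable_fun D (fun t : measurableTypeR R => l (sf_eval s t)).
Proof.
move=> ll; under eq_fun do rewrite linear_sf_eval//.
apply: (@measurable_sum _ _ _ _ _ _
  (fun i (t : measurableTypeR R) => \1_(sf_piece i) t * l (@sf_value _ _ s i))) => i.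
apply: measurable_funM => //; apply: measurable_indic.
exact: (@sf_piece_measurable _ _ s i).
Qed.

Lemma integrable_linear_sf l s D : linear_on l -> measurable (D : set (measurableTypeR R)) ->
  (leb D < +oo)%E -> leb.-integrable D (fun t => (l (sf_eval s t))%:E).
Proof.
move=> ll mD Dfin.
apply: (@integrable_bounded _ _ _ leb D (fun t => l (sf_eval s t))
  (\sum_i `|l (@sf_value _ _ s i)|)) => //.
  exact: measurable_linear_sf.
move=> t _; rewrite linear_sf_eval//; apply: le_trans (ler_norm_sum _ _ _) _.
apply: ler_sum => i _; rewrite normrM indicE.
by case: (_ \in _); rewrite ?normr1 ?normr0 ?mul1r ?mul0r.
Qed.

(** The vector integral of a simple function is a finite combination, so linearity suffices and no
    continuity of [l] enters. *)
Lemma linear_sf_integral l s D : linear_on l -> measurable (D : set (measurableTypeR R)) ->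
  (leb D < +oo)%E ->
  l (sf_integral D s) = \int[leb]_(t in D) l (sf_eval s t).
Proof.
move=> ll mD Dfin.
have [_ ->] := linear_on_sum (index_enum 'I_(sf_size s))
  (fun i => fine (leb (D `&` sf_piece i))) ll (@sf_value_mem _ _ s).
have mp (i : 'I_(sf_size s)) : measurable (sf_piece i : set (measurableTypeR R)).
  exact: (@sf_piece_measurable _ _ s i).
have i1 (i : 'I_(sf_size s)) : leb.-integrable D (fun t => (\1_(sf_piece i) t * l (@sf_value _ _ s i))%:E).
  apply: (@integrable_bounded _ _ _ leb D (fun t => \1_(sf_piece i) t * l (@sf_value _ _ s i))
    `|l (@sf_value _ _ s i)|) => //.
    by apply: measurable_funM => //; apply: measurable_indic; exact: mp.
  move=> t _; rewrite normrM indicE.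
  by case: (_ \in _); rewrite ?normr1 ?normr0 ?mul1r ?mul0r.
rewrite /Rintegral; under eq_integral do rewrite linear_sf_eval// -sumEFin.
rewrite integral_sum//.
rewrite (eq_bigr (fun i => (fine (leb (D `&` sf_piece i)) * l (@sf_value _ _ s i))%:E)).
  by rewrite sumEFin.
move=> i _; under eq_integral do rewrite EFinM.
rewrite integralZr//; last first.
  apply: (@integrable_bounded _ _ _ leb D (fun t => \1_(sf_piece i) t) 1) => //.
    by apply: measurable_indic; exact: mp.
  by move=> t _; rewrite indicE; case: (_ \in _); rewrite ?normr1 ?normr0.
rewrite integral_indic//.
rewrite setIC EFinM fineK// ge0_fin_numE// (le_lt_trans _ Dfin)//.
apply: le_measure; rewrite ?inE//; try exact: subIsetl; exact: measurableI.
Qed.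

End simple_integrals.

Lemma le_Rintegral_set d (T : measurableType d) (R : realType)
    (mu : {measure set T -> \bar R}) (D D' : set T) (f : T -> R) :
  measurable D -> measurable D' -> D `<=` D' -> (forall x, 0 <= f x) ->
  mu.-integrable D' (EFin \o f) ->
  \int[mu]_(x in D) f x <= \int[mu]_(x in D') f x.
Proof.
move=> mD mD' DD' f0 fi; have fiD := integrableS mD' mD DD' fi.
rewrite /Rintegral fine_le//; [exact: integrable_fin_num|exact: integrable_fin_num|].
apply: ge0_subset_integral => // [|x _]; last by rewrite lee_fin.
exact: (measurable_int mu).
Qed.

(** The recursion is implicit, as in a backward Euler step; for y <= 1/2 the factor 1 / (1 - y) is
    at most 1 + 2y, and (1 + 2y)^k is at most the exponential. *)
Lemma discrete_gronwall (R : realType) (x : nat -> R) (y delta : R) (k : nat) :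
  0 <= y -> y <= 2^-1 -> 0 <= delta -> x 0 = 0 -> (forall j, 0 <= x j) ->
  (forall j, (j < k)%N -> x j.+1 <= x j + y * x j.+1 + delta) ->
  x k <= k%:R * delta * expR (2 * y * k%:R).
Proof.
move=> y0 y1 delta0 x0 xge0 xS.
have q1 : 1 <= 1 + 2 * y by rewrite lerDl mulr_ge0.
apply: (@le_trans _ _ (k%:R * delta * (1 + 2 * y) ^+ k)); last first.
  rewrite ler_wpM2l ?mulr_ge0// [2 * y * _]mulrC expRM_natl.
  by apply: lerXn2r; rewrite ?nnegrE ?(le_trans ler01 q1)// expR_ge1Dx.
elim: k xS => [_|k IH xS]; first by rewrite x0 !mul0r.
have {}IH := IH (fun j jk => xS j (ltnW jk)).
have := xS k (ltnSn k); have := xge0 k; have := xge0 k.+1.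
have qk : 1 <= (1 + 2 * y) ^+ k by exact: exprn_ege1.
move: IH qk; rewrite exprS -[k.+1%:R]natr1; move: (x k) (x k.+1) (_ ^+ k) (k%:R : R) (ler0n R k).
move=> xk xk1 Q kk kk0 IH Q1 xk10 xk0 H.
have H1 : xk1 <= (1 + 2 * y) * (xk + delta).
  have H2 : xk1 <= (1 + 2 * y) * ((1 - y) * xk1).
    by have : 0 <= y * (1 - 2 * y) * xk1 by [rewrite !mulr_ge0//; lra]; nra.
  by apply: le_trans H2 _; rewrite ler_wpM2l//; lra.
apply: le_trans H1 _; rewrite [leRHS]mulrCA ler_wpM2l ?(le_trans ler01 q1)//.
by have : 0 <= delta * (Q - 1) by [rewrite mulr_ge0// subr_ge0]; nra.
Qed.

(** The primitive of [g] is differentiable a.e. with derivative [g], and it is constant near every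
    point of ]0, T[. *)
Lemma ae_eq0_integral_itv (R : realType) (T : R) (g : measurableTypeR R -> R) :
  let leb := @lebesgue_measure R in
  leb.-integrable `]0, T[ (EFin \o g) ->
  (forall t, 0 < t < T -> \int[leb]_(r in `]0, t]) g r = 0) ->
  \forall t \ae leb, (`]0, T[%classic : set R) t -> g t = 0.
Proof.
move=> leb gi g0; set I := `]0, T[%classic : set R.
have mI : measurable (I : set (measurableTypeR R)) by exact: measurable_itv.
have giT : leb.-integrable setT (EFin \o (g \_ I)).
  by rewrite -restrict_EFin; exact/(integrable_mkcond _ mI).
have giy y : leb.-integrable [set` Interval (BRight 0) (BRight y)] (EFin \o (g \_ I)).
  by apply: integrableS giT => //; exact: measurable_itv.
have := @FTC1 R (g \_ I) (BRight 0) giy (integrable_locally_restrict mI gi).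
apply: filterS; first exact: (ae_filter_ringOfSetsType leb).
move=> x Fx Ix.
have /andP[x0 xT] : 0 < x < T by move: Ix; rewrite /I /= in_itv.
have xb : (BRight 0 < BRight x)%O by rewrite bnd_simp.
have [_] := Fx xb.
rewrite patchE mem_set// => <-; rewrite derive1E.
rewrite [RHS](_ : 0 = 'D_1 (cst (0 : R)) x); last by rewrite derive_cst.
apply: (@near_eq_derive R R R); near=> y.
have /andP[y0 yT] : 0 < y < T.
  by apply/andP; split; near: y; [exact: lt_nbhsr|exact: lt_nbhsl].
rewrite /cst -[RHS](g0 y); last by rewrite y0.
apply: eq_Rintegral => z; rewrite inE/= in_itv/= => /andP[z0 zy].
by rewrite patchE mem_set// /I /= in_itv/= z0 (le_lt_trans zy).
Unshelve. all: by end_near. Qed.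

(** * Evolution with a gradient form [n], an inner product [b] and an elliptic form [a] *)

Section evolution.
Context (R : realType) (X : Defs.space R) (T : R).
Local Notation leb := (@lebesgue_measure R).
Local Notation S := (@sp_mem R X).
Local Notation I := (`]0, T[%classic : set (measurableTypeR R)).
Variables n b a : X -> X -> R.
Local Notation N u := (Num.sqrt (n u u)).
Hypothesis S0 : S 0.
Hypothesis S_lincomb : forall (k : R) (u v : X), S u -> S v -> S (k *: u + v).
Hypothesis n_lincomb : forall (k : R) (u v z : X), S u -> S v -> S z ->
  n (k *: u + v) z = k * n u z + n v z.
Hypothesis nC : forall u v : X, S u -> S v -> n u v = n v u.
Hypothesis n_ge0 : forall u : X, S u -> 0 <= n u u.
Hypothesis b_lincomb : forall (k : R) (u v z : X), S u -> S v -> S z ->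
  b (k *: u + v) z = k * b u z + b v z.
Hypothesis bC : forall u v : X, S u -> S v -> b u v = b v u.
Hypothesis b_ge0 : forall u : X, S u -> 0 <= b u u.
Hypothesis a_lincomb : forall (k : R) (u v z : X), S u -> S v -> S z ->
  a (k *: u + v) z = k * a u z + a v z.
Variables Ca Cb K : R.
Hypotheses (Ca0 : 0 <= Ca) (Cb0 : 0 <= Cb) (K0 : 0 <= K).
Hypothesis a_bounded : forall u v : X, S u -> S v -> `|a u v| <= Ca * N u * N v.
Hypothesis b_bounded : forall u v : X, S u -> S v -> `|b u v| <= Cb * N u * N v.
Hypothesis a_garding : forall v : X, S v -> - (K * b v v) <= a v v.
Variables (w : R -> X) (nu : R -> R).
Hypothesis wS : \forall t \ae leb, I t -> S (w t).
Hypothesis nu0 : forall t, 0 <= nu t.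
Hypothesis nui : leb.-integrable I (EFin \o nu).
Hypothesis nu2i : leb.-integrable I (fun t => (nu t ^+ 2)%:E).
Hypothesis w_nu : \forall t \ae leb, I t -> N (w t) <= nu t.

(** The error is carried by an integrable majorant [e], because the norm of [w t - sf_eval s t] is
    measurable in [t] only up to null sets. *)
Definition simple_approx (s : simple_fun X) (e : R -> R) : Prop :=
  [/\ forall t, 0 <= e t, leb.-integrable I (EFin \o e) &
      \forall t \ae leb, I t -> N (w t - sf_eval s t) <= e t].

Variables (s_ : nat -> simple_fun X) (e_ : nat -> R -> R).
Hypothesis s_approx : forall m, simple_approx (s_ m) (e_ m).
Hypothesis e_cvg : \forall t \ae leb, I t -> e_ m t @[m --> \oo] --> (0 : R).
Hypothesis int_e_cvg : \int[leb]_(t in I) e_ m t @[m --> \oo] --> (0 : R).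

Let mI : measurable I := measurable_itv _.

Let Ifin : (leb I < +oo)%E.
Proof. by rewrite lebesgue_measure_itv/=; case: ifP => // _; rewrite -EFinB ltry. Qed.

Let subI_fin D : measurable D -> D `<=` I -> (leb D < +oo)%E.
Proof. by move=> mD DI; apply: le_lt_trans Ifin; apply: le_measure; rewrite ?inE. Qed.

Let S_B (u v : X) : S u -> S v -> S (u - v).
Proof. by move=> Su Sv; rewrite addrC -scaleN1r; exact: S_lincomb. Qed.

Let linearB (l : X -> R) (u v : X) : linear_on l -> S u -> S v -> l (u - v) = l u - l v.
Proof. by move=> ll Su Sv; rewrite addrC -scaleN1r ll// mulN1r addrC. Qed.

Let n_linear v : S v -> linear_on (n^~ v).
Proof. by move=> Sv k x y Sx Sy; exact: n_lincomb. Qed.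

Let b_linear v : S v -> linear_on (b^~ v).
Proof. by move=> Sv k x y Sx Sy; exact: b_lincomb. Qed.

Let a_linear v : S v -> linear_on (a^~ v).
Proof. by move=> Sv k x y Sx Sy; exact: a_lincomb. Qed.

(** A limit of the measurable functions obtained from the simple approximations, dominated by
    [C * nu]. *)
Lemma bounded_linear_version l C : linear_on l -> 0 <= C ->
  (forall u, S u -> `|l u| <= C * N u) ->
  exists2 g : measurableTypeR R -> R, leb.-integrable I (EFin \o g) &
    \forall t \ae leb, I t -> l (w t) = g t.
Proof.
move=> ll C0 lC.
have cv : \forall t \ae leb, I t -> l (sf_eval (s_ m) t) @[m --> \oo] --> l (w t).
  have : \forall t \ae leb, forall m, I t -> N (w t - sf_eval (s_ m) t) <= e_ m t.
    by apply/ae_foralln => m; have [] := s_approx m.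
  apply: filterS3 wS e_cvg => t Sw et Ne It; apply/cvgrPdist_le => /= eps eps0.
  have C1 : 0 < C + 1 by rewrite ltr_wpDl.
  have /cvgr0_norm_le/(_ (eps / (C + 1))) := et It.
  rewrite divr_gt0// => /(_ isT); apply: filterS => m em.
  have Sm := sf_eval_mem S0 S_lincomb (s_ m) t.
  rewrite -linearB//; [|exact: Sw].
  apply: le_trans (lC _ (S_B (Sw It) Sm)) _.
  rewrite -(@divfK _ (C + 1) _ eps) ?gt_eqF// [leRHS]mulrC.
  apply: ler_pM; [exact: C0|exact: sqrtr_ge0|by rewrite lerDl|].
  exact: le_trans (Ne m It) (le_trans (ler_norm _) em).
have [g mg gE] := ae_cvg_measurable mI
  (fun m => measurable_linear_sf S0 S_lincomb (s_ m) ll) cv.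
exists g => //.
apply: (@ae_le_integrable _ _ _ leb I g (fun t => C * nu t)) => //.
  exact: (integrableZl mI C nui).
apply: filterS3 wS gE w_nu => t Sw gt wn It; rewrite -gt//.
by apply: le_trans (lC _ (Sw It)) _; rewrite ler_wpM2l// wn.
Qed.

Lemma bounded_linear_approx l C s e D : linear_on l -> 0 <= C ->
  (forall u, S u -> `|l u| <= C * N u) -> simple_approx s e ->
  measurable D -> D `<=` I ->
  `|\int[leb]_(t in D) l (w t) - l (sf_integral D s)| <= C * \int[leb]_(t in I) e t.
Proof.
move=> ll C0 lC [e0 ei Ne] mD DI.
have [g gi gE] := bounded_linear_version ll C0 lC.
have giD := integrableS mI mD DI gi; have eiD := integrableS mI mD DI ei.
have Dfin := subI_fin mD DI.
have si := integrable_linear_sf S0 S_lincomb s ll mD Dfin.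
rewrite (@ae_eq_Rintegral _ _ _ leb D (fun t => l (w t)) g); last first.
  by apply: filterS gE => t gt Dt; exact: gt (DI _ Dt).
rewrite linear_sf_integral// -RintegralB//.
have sgi : leb.-integrable D (EFin \o (fun t => g t - l (sf_eval s t))).
  exact: (integrableB mD giD si).
apply: le_trans (le_normr_Rintegral mD sgi) _.
have eiC : leb.-integrable D (EFin \o (fun t => C * e t)).
  exact: (integrableZl mD C eiD).
apply: (@le_trans _ _ (\int[leb]_(t in D) (C * e t))).
  apply: ae_le_Rintegral => //; first exact: integrable_norm.
  apply: filterS3 wS gE Ne => t Sw gt wn Dt; have It := DI _ Dt.
  have Sm := sf_eval_mem S0 S_lincomb s t.
  rewrite -gt// -linearB//; [|exact: Sw].
  by apply: le_trans (lC _ (S_B (Sw It) Sm)) _; rewrite ler_wpM2l// wn.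
by rewrite RintegralZl// ler_wpM2l//; exact: le_Rintegral_set.
Qed.

Let kap := \int[leb]_(t in I) (nu t ^+ 2).

Let kap0 : 0 <= kap.
Proof. by apply: Rintegral_ge0 => t _; exact: sqr_ge0. Qed.

(** Minkowski's inequality by testing with the integral v itself: N(v)^2 is the integral of n(s(t),
    v), which Cauchy-Schwarz bounds by N(v) times the integral of N(s(t)). *)
Lemma norm_sf_integral s e D : simple_approx s e -> measurable D -> D `<=` I ->
  N (sf_integral D s) <= \int[leb]_(t in D) (nu t + e t).
Proof.
move=> [e0 ei Ne] mD DI; set v := sf_integral D s.
have Sv : S v by exact: sf_integral_mem.
have [/eqP->|Nv0] := boolP (N v == 0).
  by apply: Rintegral_ge0 => t _; rewrite addr_ge0.
have Nv : 0 < N v by rewrite lt_def Nv0 sqrtr_ge0.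
have nuei : leb.-integrable D (EFin \o (fun t => nu t + e t)).
  apply: (integrableS mI mD DI).
  exact: (integrableD mI nui ei).
have Dfin := subI_fin mD DI.
have nl := n_linear Sv.
have vv : n v v = \int[leb]_(t in D) n (sf_eval s t) v.
  exact: (linear_sf_integral S0 S_lincomb s nl).
rewrite -(ler_pM2l Nv) -expr2 sqr_sqrtr ?n_ge0// [leLHS]vv -RintegralZl//.
apply: ae_le_Rintegral => //; first exact: (integrable_linear_sf S0 S_lincomb s nl).
  exact: (integrableZl mD (N v) nuei).
apply: filterS3 wS w_nu Ne => t Sw wn wsn Dt; have It := DI _ Dt.
have Sm := sf_eval_mem S0 S_lincomb s t.
apply: le_trans (ler_norm _) _.
apply: le_trans (form_cauchy_schwarz S_lincomb n_lincomb nC n_ge0 Sm Sv) _.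
rewrite mulrC ler_wpM2l ?sqrtr_ge0//.
have -> : sf_eval s t = -1 *: (w t - sf_eval s t) + w t.
  by rewrite scaleN1r opprB subrK.
have := form_triangle S_lincomb n_lincomb nC n_ge0 (-1) (S_B (Sw It) Sm) (Sw It).
move=> /le_trans; apply; rewrite normrN1 mul1r addrC lerD//; [exact: wn|exact: wsn].
Qed.

(** Smallness on short intervals comes from the square integrability of [nu], through nu <= eps nu^2
    + 1/eps; a free [eps] replaces the square root of the length. *)
Lemma norm_sf_integral_itv s e c c' eps : simple_approx s e ->
  0 <= c -> c <= c' -> c' < T -> 0 < eps ->
  N (sf_integral `]c, c'] s) <=
    eps * kap + (c' - c) / eps + \int[leb]_(t in I) e t.
Proof.
move=> se c0 cc' c'T eps0; have [e0 ei Ne] := se.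
set D := `]c, c']%classic.
have mD : measurable (D : set (measurableTypeR R)) by exact: measurable_itv.
have DI : D `<=` I.
  move=> t; rewrite /D /= !in_itv/= => /andP[ct tc'].
  by rewrite (le_lt_trans c0 ct) (le_lt_trans tc' c'T).
apply: le_trans (norm_sf_integral se mD DI) _.
have nuiD := integrableS mI mD DI nui; have eiD := integrableS mI mD DI ei.
rewrite RintegralD//; apply: lerD; last exact: le_Rintegral_set.
have nu2iD : leb.-integrable D (EFin \o (fun t => eps * nu t ^+ 2)).
  apply: (integrableS mI mD DI).
  exact: (integrableZl mI eps nu2i).
have Dfin := subI_fin mD DI.
have ci : leb.-integrable D (EFin \o (fun=> eps^-1)).
  by apply: (@integrable_bounded _ _ _ leb D (fun=> eps^-1) `|eps^-1|).
apply: (@le_trans _ _ (\int[leb]_(t in D) (eps * nu t ^+ 2 + eps^-1))).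
  apply: le_Rintegral => //.
    exact: (integrableD mD nu2iD ci).
  move=> t _; have := sqr_ge0 (eps * nu t - 1); have := nu0 t.
  move: (nu t) => z z0 H; rewrite -(ler_pM2l eps0) mulrDr divff ?gt_eqF//.
  by have : 0 <= eps * z by [rewrite mulr_ge0// ltW]; nra.
rewrite RintegralD// RintegralZl; [|exact: mD|]; last first.
  exact: (integrableS mI mD DI).
apply: lerD.
  rewrite ler_wpM2l ?(ltW eps0)//; apply: le_Rintegral_set => // t.
  exact: sqr_ge0.
rewrite Rintegral_cst// mulrC ler_pM2r ?invr_gt0//.
have lebD : fine (leb D) <= c' - c.
  by rewrite /D lebesgue_measure_itv/=; case: ifP => //= _; rewrite subr_ge0.
exact: lebD.
Qed.

Hypothesis weq : forall v : X, S v -> \forall t \ae leb, I t ->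
  b (w t) v = - \int[leb]_(r in `]0, t]) a (w r) v.

Lemma sf_integral_split s c c' : 0 <= c -> c <= c' ->
  sf_integral `]0, c'] s = sf_integral `]c, c'] s + sf_integral `]0, c] s :> X.
Proof.
move=> c0 cc'; rewrite /sf_integral -big_split/=; apply: eq_bigr => i _.
rewrite -scalerDl; congr (_ *: _).
have mp : measurable (sf_piece i) := @sf_piece_measurable _ _ s i.
have fin (x y : R) : leb (`]x, y]%classic `&` sf_piece i) \is a fin_num.
  rewrite ge0_fin_numE//; apply: (@le_lt_trans _ _ (leb `]x, y]%classic)).
    by apply: le_measure; rewrite ?inE//; exact: measurableI.
  by rewrite lebesgue_measure_itv/=; case: ifP => // _; rewrite -EFinB ltry.
rewrite -fineD//; congr fine; rewrite -measureU//; [|exact: measurableI|exact: measurableI|].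
  rewrite -setIUl; congr (leb (_ `&` _)); rewrite setUC.
  by rewrite -(@itv_bndbnd_setU _ _ _ (BRight c))// bnd_simp.
rewrite setIACA setIid (_ : _ `&` _ = set0)//.
apply/seteqP; split => // t [[]]/=; rewrite !in_itv/= => /andP[ct _] /andP[_ tc].
by have := lt_le_trans ct tc; rewrite ltxx.
Qed.

(* The equation for w, tested with V = S(c'), gives b(w(r), V) = - a(S(r), V), and
   S(r) differs from V by the integral over ]r, c'], whose norm is small. *)
Lemma form_increment s e c c' eps : simple_approx s e ->
  0 <= c -> c <= c' -> c' < T -> 0 < eps ->
  let V := sf_integral `]0, c'] s in
  b (sf_integral `]c, c'] s) V <=
    (c' - c) * (K * b V V + Ca * N V * (eps * kap + (c' - c) / eps
                                        + 2 * \int[leb]_(t in I) e t))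
    + Cb * N V * \int[leb]_(t in I) e t.
Proof.
move=> se c0 cc' c'T eps0 /=; have [e0 ei Ne] := se.
set V := sf_integral `]0, c'] s : X.
set E := \int[leb]_(t in I) e t.
set D := `]c, c']%classic : set (measurableTypeR R).
have SV : S V by exact: sf_integral_mem.
have bl := b_linear SV; have al := a_linear SV.
have mD : measurable D by exact: measurable_itv.
have DI : D `<=` I.
  move=> t; rewrite /D /= !in_itv/= => /andP[ct tc'].
  by rewrite (le_lt_trans c0 ct) (le_lt_trans tc' c'T).
have Dfin := subI_fin mD DI; have eiD := integrableS mI mD DI ei.
set G := K * b V V + Ca * N V * (eps * kap + (c' - c) / eps + 2 * E).
have -> : b (sf_integral D s) V = \int[leb]_(t in D) b (sf_eval s t) V.
  exact: (linear_sf_integral S0 S_lincomb s bl).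
have NV0 : 0 <= N V := sqrtr_ge0 _.
have CN : 0 <= Cb * N V := mulr_ge0 Cb0 NV0.
have E0 : 0 <= E by apply: Rintegral_ge0 => t _; exact: e0.
have Gi : leb.-integrable D (EFin \o (fun=> G)).
  by apply: (@integrable_bounded _ _ _ leb D (fun=> G) `|G|).
have Cei : leb.-integrable D (EFin \o (fun t => Cb * N V * e t)).
  exact: (integrableZl mD (Cb * N V) eiD).
apply: (@le_trans _ _ (\int[leb]_(t in D) (G + Cb * N V * e t))); last first.
  rewrite RintegralD// RintegralZl// Rintegral_cst//.
  have lebD : fine (leb D) = c' - c.
    rewrite /D lebesgue_measure_itv/= lte_fin; case: ltgtP cc' => // [->] _.
    by rewrite subrr.
  by rewrite [fine _]lebD mulrC lerD2l ler_wpM2l//; exact: le_Rintegral_set.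
apply: ae_le_Rintegral => //; first exact: (integrable_linear_sf S0 S_lincomb s bl).
  exact: (integrableD mD Gi Cei).
apply: filterS3 wS Ne (weq SV) => r Sw wsn weqr Dr; have Ir := DI _ Dr.
have {}Sw := Sw Ir; have {}wsn := wsn Ir; have {}weqr := weqr Ir.
have [cr rc'] : c < r /\ r <= c' by move: Dr; rewrite /D /= in_itv/= => /andP.
have r0 := ltW (le_lt_trans c0 cr).
have Sm := sf_eval_mem S0 S_lincomb s r.
have Swm := S_B Sw Sm.
set Vr := sf_integral `]0, r] s; set Dr' := sf_integral `]r, c'] s.
have SDr : S Dr' by exact: sf_integral_mem.
have SVr : S Vr by exact: sf_integral_mem.
have VE : V = 1 *: Dr' + Vr by rewrite scale1r; exact: sf_integral_split.
have H1 : b (sf_eval s r) V <= b (w r) V + Cb * N V * e r.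
  have := linearB bl Sw Sm; have := b_bounded Swm SV.
  have : Cb * N (w r - sf_eval s r) * N V <= Cb * N V * e r.
    by rewrite mulrAC ler_wpM2l.
  move: (b (w r) V) (b (sf_eval s r) V) (b (w r - _) V) => x y z.
  by move=> h1 /ler_normlP[h2 h3] h4; lra.
have lV u : S u -> `|a u V| <= (Ca * N V) * N u.
  by move=> Su; rewrite mulrAC; exact: a_bounded.
have H2 : b (w r) V <= - a Vr V + Ca * N V * E.
  rewrite weqr; set ia := \int[leb]_(_ in _) _.
  have mD' : measurable (`]0, r]%classic : set (measurableTypeR R)) by exact: measurable_itv.
  have D'I : `]0, r]%classic `<=` I.
    move=> t; rewrite /= !in_itv/= => /andP[-> tr]/=.
    exact: le_lt_trans tr (le_lt_trans rc' c'T).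
  have := bounded_linear_approx al (mulr_ge0 Ca0 NV0) lV se mD' D'I.
  by rewrite -/ia -/Vr -/E => /ler_normlP[H _]; lra.
(* Since V = Dr' + Vr, the left side is a(Dr', V) - a(V, V), and Gårding's inequality applies to the
   last term. *)
have H3 : - a Vr V <= a Dr' V + K * b V V.
  have : a V V = a Dr' V + a Vr V by rewrite {1}VE al// mul1r.
  by have := a_garding SV; lra.
have H4 : a Dr' V <= Ca * N V * (eps * kap + (c' - c) / eps + E).
  apply: le_trans (ler_norm _) (le_trans (lV _ SDr) _).
  rewrite ler_wpM2l ?mulr_ge0//.
  apply: le_trans (norm_sf_integral_itv se r0 rc' c'T eps0) _.
  by rewrite lerD2r lerD2l ler_pM2r ?invr_gt0//; rewrite lerB// ltW.
move: H1 H2 H3 H4; rewrite /G; move: (b (sf_eval s r) V) (a Vr V) (a Dr' V) (b (w r) V).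
move: (Ca * N V) (Cb * N V * e r) (b V V) (eps * kap + _) => *; lra.
Qed.

(** Gronwall on the grid j t / k. With D the integral over one step, b(V_{j+1}, V_{j+1}) - b(V_j,
    V_j) = 2 b(D, V_{j+1}) - b(D, D); the last term has a good sign and [form_increment] bounds the
    first. *)
Lemma form_sf_integral_le s e t k eps : simple_approx s e ->
  0 < t -> t < T -> 0 < eps -> (0 < k)%N -> 2 * (t / k%:R) * K <= 2^-1 ->
  let V := sf_integral `]0, t] s in let E := \int[leb]_(r in I) e r in
  b V V <= k%:R * (2 * (t / k%:R * (Ca * (kap + T + E) * (eps * kap + t / k%:R / eps + 2 * E))
                       + Cb * (kap + T + E) * E)) * expR (4 * K * t).
Proof.
move=> se t0 tT eps0 k0 tk /=; have [e0 ei _] := se.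
set V := sf_integral `]0, t] s : X; set E := \int[leb]_(r in I) e r.
have E0 : 0 <= E by apply: Rintegral_ge0 => r _; exact: e0.
have T0 : 0 <= T := ltW (lt_trans t0 tT).
(* [F] bounds the norm of all partial integrals: it is the interval estimate with eps = 1 and length
   at most T. *)
set F := kap + T + E; set h := t / k%:R.
have kR : (0 : R) < k%:R by rewrite ltr0n.
have h0 : 0 <= h by rewrite divr_ge0// ltW.
have F0 : 0 <= F by rewrite !addr_ge0.
pose VV (j : nat) : X := sf_integral `]0, Num.min (j%:R * h) t] s.
have tE : k%:R * h = t by rewrite mulrC divfK// gt_eqF.
have jh j : (j <= k)%N -> Num.min (j%:R * h) t = j%:R * h.
  by move=> jk; apply/min_idPl; rewrite -tE ler_wpM2r// ler_nat.
have -> : V = VV k by rewrite /VV jh// tE.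
have -> : 4 * K * t = 2 * (2 * h * K) * k%:R by rewrite -tE; ring.
have SVV j : S (VV j) by exact: sf_integral_mem.
apply: (@discrete_gronwall _ (fun j => b (VV j) (VV j))) => //.
- exact: (mulr_ge0 (mulr_ge0 (ler0n _ 2) h0) K0).
- have Q0 : 0 <= eps * kap + h / eps + 2 * E.
    by rewrite !addr_ge0//; apply: mulr_ge0 => //; rewrite ?invr_ge0 ltW.
  apply: (mulr_ge0 (ler0n _ 2)); apply: addr_ge0; last exact: mulr_ge0 (mulr_ge0 Cb0 F0) E0.
  exact: mulr_ge0 h0 (mulr_ge0 (mulr_ge0 Ca0 F0) Q0).
- have -> : VV 0 = 0.
    rewrite /VV mul0r (min_idPl (ltW t0)) /sf_integral big1// => i _.
    by rewrite set_itvoc0 set0I measure0 scale0r.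
  exact: (linear_on0 S0 (b_linear S0)).
- by move=> j; exact: b_ge0.
move=> j jk; have jk' := ltnW jk.
set c := j%:R * h; set c' := j.+1%:R * h.
have cc'E : c' - c = h by rewrite /c /c' -mulrBl -natrB// subSnn mul1r.
have c0 : 0 <= c by rewrite mulr_ge0.
have cc' : c <= c' by rewrite -subr_ge0 cc'E.
have c't : c' <= t by rewrite -tE ler_wpM2r// ler_nat.
have c'T := le_lt_trans c't tT.
have VjE : VV j = sf_integral `]0, c] s by rewrite /VV jh.
have Vj1E : VV j.+1 = sf_integral `]0, c'] s by rewrite /VV jh.
set D := sf_integral `]c, c'] s : X.
have SD : S D by exact: sf_integral_mem.
have VjE' : VV j = -1 *: D + VV j.+1.
  by rewrite VjE Vj1E (sf_integral_split s c0 cc') addrA scaleN1r addNr add0r.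
have sq := form_sqr S_lincomb b_lincomb bC (-1) SD (SVV j.+1).
have inc := form_increment se c0 cc' c'T eps0.
have NV : N (VV j.+1) <= F.
  have := norm_sf_integral_itv se (lexx 0) (le_trans c0 cc') c'T ltr01.
  rewrite -Vj1E => /le_trans; apply; rewrite mul1r subr0 divr1 lerD2r lerD2l.
  exact: ltW.
move: inc; rewrite /= -Vj1E -/D -/E cc'E => inc.
rewrite -VjE' sqrrN expr1n mul1r mulN1r in sq.
have bDD := b_ge0 SD.
have Q0 : 0 <= eps * kap + h / eps + 2 * E.
  by rewrite !addr_ge0//; apply: mulr_ge0 => //; rewrite ?invr_ge0 ltW.
have i1 : Ca * N (VV j.+1) * (eps * kap + h / eps + 2 * E) <=
          Ca * F * (eps * kap + h / eps + 2 * E).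
  by rewrite ler_wpM2r// ler_wpM2l.
have i2 : Cb * N (VV j.+1) * E <= Cb * F * E by rewrite ler_wpM2r// ler_wpM2l.
have {i1} := ler_wpM2l h0 i1.
move: inc i2 bDD; rewrite /= sq [- _ *+ 2]mulr2n mulrDr.
move: (b D D) (b D (VV j.+1)) (b (VV j.+1) (VV j.+1)) (Cb * N (VV j.+1) * E).
move: (h * (Ca * N (VV j.+1) * _)) (Cb * F * E) (h * (Ca * F * _)) => *; lra.
Qed.

Lemma form_sf_integral_cvg t : 0 < t -> t < T ->
  let V m := sf_integral `]0, t] (s_ m) in b (V m) (V m) @[m --> \oo] --> (0 : R).
Proof.
move=> t0 tT V.
have SV m : S (V m) by exact: sf_integral_mem.
have T0 : 0 <= T := ltW (lt_trans t0 tT).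
pose E m := \int[leb]_(r in I) e_ m r.
pose B k eps x := k%:R * (2 * (t / k%:R * (Ca * (kap + T + x) * (eps * kap + t / k%:R / eps + 2 * x))
    + Cb * (kap + T + x) * x)) * expR (4 * K * t).
apply/cvgrPdist_le => /= eta eta0.
pose C1 := 2 * t * Ca * (kap + T) * expR (4 * K * t).
have C10 : 0 <= C1 by rewrite !mulr_ge0 ?expR_ge0 ?addr_ge0// ltW.
(* With k = j^2 steps and eps = 1/j, the bound at E = 0 equals C1 (kap + t) / j. The first summand
   makes this smaller than [eta]; the second secures 4 K t <= k, the step size condition of the
   Gronwall inequality. *)
pose j := (Num.truncn (C1 * (kap + t) / eta) + Num.truncn (4 * K * t)).+1.
have jR : (0 : R) < j%:R by rewrite ltr0n.
have j1 : C1 * (kap + t) / eta < j%:R.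
  apply: lt_le_trans (truncnS_gt _) _; rewrite ler_nat ltnS; exact: leq_addr.
have j2 : 4 * K * t <= j%:R ^+ 2.
  apply: (@le_trans _ _ j%:R).
    apply: le_trans (ltW (truncnS_gt _)) _; rewrite ler_nat ltnS; exact: leq_addl.
  by rewrite expr2 -[leLHS]mulr1 ler_wpM2l// ler1n.
pose k := (j ^ 2)%N; pose eps : R := j%:R^-1.
have kE : (k%:R : R) = j%:R ^+ 2 by rewrite /k natrX.
have BE : B k eps (E m) @[m --> \oo] --> B k eps 0.
  have cF : kap + T + E m @[m --> \oo] --> kap + T + 0.
    by apply: cvgD; [exact: cvg_cst|exact: int_e_cvg].
  rewrite /B; apply: cvgM; last exact: cvg_cst.
  apply: cvgM; first exact: cvg_cst.
  apply: cvgM; first exact: cvg_cst.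
  apply: cvgD; apply: cvgM; [exact: cvg_cst| | |exact: int_e_cvg].
    apply: cvgM; first by apply: cvgM; [exact: cvg_cst|exact: cF].
    apply: cvgD; first exact: cvg_cst.
    by apply: cvgM; [exact: cvg_cst|exact: int_e_cvg].
  by apply: cvgM; [exact: cvg_cst|exact: cF].
have Blt : B k eps 0 < eta.
  rewrite /B !addr0 !mulr0 !addr0 kE /eps.
  have -> : j%:R ^+ 2 * (2 * (t / j%:R ^+ 2 * (Ca * (kap + T) *
    (j%:R^-1 * kap + t / j%:R ^+ 2 / j%:R^-1)))) * expR (4 * K * t) = C1 * (kap + t) / j%:R.
    by rewrite /C1; field; rewrite gt_eqF.
  by rewrite ltr_pdivrMr// [ltRHS]mulrC -ltr_pdivrMr.
near=> m; have Bm : B k eps (E m) < eta by near: m; exact: (cvgr_lt _ BE).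
rewrite sub0r normrN ger0_norm ?b_ge0//; apply: le_trans (ltW Bm).
have eps0 : 0 < eps by rewrite invr_gt0.
have k0 : (0 < k)%N by rewrite expn_gt0.
apply: (form_sf_integral_le (s_approx m) t0 tT eps0 k0).
rewrite kE mulrA mulrAC ler_pdivrMr ?exprn_gt0//; move: j2; move: (j%:R ^+ 2) => z; lra.
Unshelve. all: by end_near. Qed.

(** The integral of b(w, v) over ]0, t] is the limit of b(V_m, v), which tends to 0 by
    Cauchy-Schwarz since b(V_m, V_m) does; an integrable function whose primitive vanishes is zero
    a.e. *)
Lemma form_ae_eq0 v : S v -> \forall t \ae leb, I t -> b (w t) v = 0.
Proof.
move=> Sv; have bl := b_linear Sv.
have lC u : S u -> `|b u v| <= (Cb * N v) * N u.
  by move=> Su; rewrite mulrAC; exact: b_bounded.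
have C0 : 0 <= Cb * N v := mulr_ge0 Cb0 (sqrtr_ge0 _).
have [g gi gE] := bounded_linear_version bl C0 lC.
suff : \forall t \ae leb, I t -> g t = 0.
  by apply: filterS2 gE => t gt g0 It; rewrite gt// g0.
apply: ae_eq0_integral_itv => // t /andP[t0 tT].
set D := `]0, t]%classic.
have mD : measurable (D : set (measurableTypeR R)) by exact: measurable_itv.
have DI : D `<=` I.
  move=> r; rewrite /D /= !in_itv/= => /andP[-> rt]; exact: le_lt_trans rt tT.
have -> : \int[leb]_(r in D) g r = \int[leb]_(r in D) b (w r) v.
  by apply: ae_eq_Rintegral; apply: filterS gE => r gr Dr; rewrite gr//; exact: DI.
set x := \int[leb]_(_ in _) _.
pose V m : X := sf_integral D (s_ m).
have SV m : S (V m) by exact: sf_integral_mem.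
pose y m := Cb * N v * (\int[leb]_(r in I) e_ m r) +
            Num.sqrt (b (V m) (V m)) * Num.sqrt (b v v).
have xy m : `|x| <= y m.
  have := bounded_linear_approx bl C0 lC (s_approx m) mD DI.
  have := form_cauchy_schwarz S_lincomb b_lincomb bC b_ge0 (SV m) Sv.
  rewrite -/(V m) -/x /y; move: (Num.sqrt _ * _) (_ * \int[_]_(_ in _) _) (b (V m) v).
  by move=> p q z pz xz; rewrite -(subrK z x) (le_trans (ler_normD _ _))// lerD.
have y0 : y m @[m --> \oo] --> (0 : R).
  have -> : 0 = Cb * N v * 0 + Num.sqrt 0 * Num.sqrt (b v v) :> R.
    by rewrite sqrtr0 mulr0 mul0r addr0.
  apply: cvgD; first by apply: cvgM; [exact: cvg_cst|exact: int_e_cvg].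
  apply: cvgM; last exact: cvg_cst.
  exact: (cvg_comp _ _ (form_sf_integral_cvg t0 tT) (@sqrt_continuous R 0)).
apply/eqP; rewrite -normr_le0 -(cvg_lim (@Rhausdorff R) y0).
by apply: limr_ge; [apply/cvg_ex; exists 0|exact: nearW].
Qed.

(** The null set of [form_ae_eq0] depends on [v]. The simple functions [s_ m] have countably many
    values in all, so one null set serves for them, and they approximate w(t). *)
Lemma evolution_eq0 : \forall t \ae leb, I t -> b (w t) (w t) = 0.
Proof.
have H1 : \forall t \ae leb, forall m, I t -> b (w t) (sf_eval (s_ m) t) = 0.
  apply/ae_foralln => m.
  have : \forall t \ae leb, forall i, I t -> b (w t) (@sf_value _ _ (s_ m) i) = 0.
    by apply: filter_forall => i; apply: form_ae_eq0; exact: sf_value_mem.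
  apply: filterS2 wS => t Sw bw It; have {}Sw := Sw It.
  rewrite bC//; last exact: sf_eval_mem.
  rewrite (linear_sf_eval S0 S_lincomb (s_ m) t (b_linear Sw)).
  rewrite big1// => i _; have Si := @sf_value_mem _ _ (s_ m) i.
  by rewrite bC// bw// mulr0.
have H2 : \forall t \ae leb, forall m, I t -> N (w t - sf_eval (s_ m) t) <= e_ m t.
  by apply/ae_foralln => m; have [] := s_approx m.
have H3 : \forall t \ae leb, I t -> forall m, b (w t) (w t) <= Cb * N (w t) * e_ m t.
  apply: filterS3 wS H1 H2 => t Sw b0 Ne It m.
  have {}Sw := Sw It; have Sm := sf_eval_mem S0 S_lincomb (s_ m) t.
  have Swm := S_B Sw Sm.
  have -> : b (w t) (w t) = b (w t - sf_eval (s_ m) t) (w t).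
    by rewrite (linearB (b_linear Sw) Sw Sm) (bC Sm Sw) b0// subr0.
  apply: le_trans (ler_norm _) (le_trans (b_bounded Swm Sw) _).
  by rewrite mulrAC ler_wpM2l ?Ne// mulr_ge0// sqrtr_ge0.
apply: filterS3 wS e_cvg H3 => t Sw e0 be It; apply/eqP.
rewrite eq_le b_ge0 ?andbT; last exact: Sw.
have y0 : Cb * N (w t) * e_ m t @[m --> \oo] --> (0 : R).
  by rewrite -[X in _ --> X](mulr0 (Cb * N (w t))); apply: cvgM; [exact: cvg_cst|exact: e0].
rewrite -(cvg_lim (@Rhausdorff R) y0).
by apply: limr_ge; [apply/cvg_ex; exists 0|apply: nearW => m; exact: be].
Qed.

End evolution.

(** * Dominated approximation of square integrable functions by simple ones *)

Section simple_approximation.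
Context (R : realType) (X : Defs.space R) (T : R).
Local Notation leb := (@lebesgue_measure R).
Local Notation S := (@sp_mem R X).
Local Notation I := (`]0, T[%classic : set (measurableTypeR R)).
Variable n : X -> X -> R.
Local Notation N u := (Num.sqrt (n u u)).
Hypothesis S0 : S 0.
Hypothesis S_lincomb : forall (k : R) (u v : X), S u -> S v -> S (k *: u + v).
Hypothesis n_lincomb : forall (k : R) (u v z : X), S u -> S v -> S z ->
  n (k *: u + v) z = k * n u z + n v z.
Hypothesis nC : forall u v : X, S u -> S v -> n u v = n v u.
Hypothesis n_ge0 : forall u : X, S u -> 0 <= n u u.
Hypothesis normE : forall u : X, S u -> sp_norm u = (N u)%:E.
Implicit Types (s : simple_fun X) (u v w : R -> X).

Let mI : measurable I := measurable_itv _.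

Let Ifin : (leb I < +oo)%E.
Proof. by rewrite lebesgue_measure_itv/=; case: ifP => // _; rewrite -EFinB ltry. Qed.

Let S_B (x y : X) : S x -> S y -> S (x - y).
Proof. by move=> Sx Sy; rewrite addrC -scaleN1r; exact: S_lincomb. Qed.

Let N_B (x y : X) : S x -> S y -> N (x - y) <= N x + N y.
Proof.
move=> Sx Sy; have := form_triangle S_lincomb n_lincomb nC n_ge0 (-1) Sy Sx.
by rewrite normrN1 mul1r scaleN1r addrC [leRHS]addrC.
Qed.

Let N_BC (x y : X) : S x -> S y -> N (x - y) = N (y - x).
Proof.
move=> Sx Sy; have le a b : S a -> S b -> N (a - b) <= N (b - a).
  move=> Sa Sb.
  have := form_triangle S_lincomb n_lincomb nC n_ge0 (-1) (S_B Sb Sa) S0.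
  rewrite normrN1 mul1r scaleN1r addr0 opprB.
  by rewrite (linear_on0 S0 (fun k x y Sx Sy => n_lincomb k Sx Sy S0)) sqrtr0 addr0.
by apply/eqP; rewrite eq_le !le.
Qed.

Let N_dist (x y : X) : S x -> S y -> `|N x - N y| <= N (x - y).
Proof.
move=> Sx Sy; have H a b : S a -> S b -> N a - N b <= N (a - b).
  move=> Sa Sb; rewrite lerBlDr.
  have := form_triangle S_lincomb n_lincomb nC n_ge0 1 (S_B Sa Sb) Sb.
  by rewrite scale1r subrK normr1 mul1r.
by rewrite ler_norml lerNl opprB H// andbT N_BC// H.
Qed.

Let sub_piece s s' (i : 'I_(sf_size s + sf_size s')) : set (measurableTypeR R) :=
  match fintype.split i with inl j => sf_piece j | inr j => sf_piece j end.

(** The negated values are written [-1 *: _ + 0] to fit the closure property [S_lincomb]. *)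
Let sub_value s s' (i : 'I_(sf_size s + sf_size s')) : X :=
  match fintype.split i with
  | inl j => @sf_value _ _ s j
  | inr j => -1 *: @sf_value _ _ s' j + 0
  end.

Let sub_piece_measurable s s' (i : 'I_(sf_size s + sf_size s')) :
  measurable (sub_piece i).
Proof.
by rewrite /sub_piece; case: fintype.split => j; exact: sf_piece_measurable.
Qed.

Let sub_value_mem s s' (i : 'I_(sf_size s + sf_size s')) : S (sub_value i).
Proof.
rewrite /sub_value; case: fintype.split => j; first exact: sf_value_mem.
by apply: S_lincomb => //; exact: sf_value_mem.
Qed.

Definition sf_sub s s' : simple_fun X :=
  SimpleFun (@sub_piece_measurable s s') (@sub_value_mem s s').

Lemma sf_sub_eval s s' t : sf_eval (sf_sub s s') t = sf_eval s t - sf_eval s' t.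
Proof.
rewrite /sf_eval /sf_sub /= big_split_ord/= /sub_piece /sub_value; congr (_ + _).
  by apply: eq_bigr => i _; rewrite (unsplitK (inl i)).
rewrite -sumrN; apply: eq_bigr => i _.
by rewrite (unsplitK (inr i)) addr0 scaleN1r scalerN.
Qed.

Let restrict_measurable (A : set (measurableTypeR R)) (mA : measurable A) s
  (i : 'I_(sf_size s)) : measurable (A `&` sf_piece i).
Proof. by apply: measurableI => //; exact: sf_piece_measurable. Qed.

Definition sf_restrict (A : set (measurableTypeR R)) (mA : measurable A) s :
    simple_fun X :=
  SimpleFun (@restrict_measurable A mA s) (@sf_value_mem _ _ s).

Lemma sf_restrict_eval A (mA : measurable A) s t :
  sf_eval (sf_restrict mA s) t = \1_A t *: sf_eval s t.
Proof.
rewrite /sf_eval scaler_sumr; apply: eq_bigr => i _ /=.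
by rewrite indicI scalerA.
Qed.

Let simple0 : simple_fun X := sf_restrict measurable0
  (@SimpleFun R X 0 (fun i => set0) (fun i => 0) (fun i => measurable0) (fun i => S0)).

Let simple0_eval t : sf_eval simple0 t = 0.
Proof. by rewrite sf_restrict_eval indic0 scale0r. Qed.

Lemma measurable_norm_sf s D :
  measurable_fun D (fun t : measurableTypeR R => N (sf_eval s t)).
Proof.
have Sm t : S (sf_eval s t) by exact: sf_eval_mem.
apply: (measurableT_comp (f := @Num.sqrt R)).
  by apply: continuous_measurable_fun; exact: sqrt_continuous.
have ln (z : X) : S z -> linear_on (n^~ z) by move=> Sz k x y Sx Sy; exact: n_lincomb.
have nE t : n (sf_eval s t) (sf_eval s t) = \sum_i \1_(sf_piece i) t *
    n (sf_eval s t) (@sf_value _ _ s i).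
  rewrite (linear_sf_eval S0 S_lincomb s t (ln _ (Sm t))); apply: eq_bigr => i _.
  by rewrite nC//; exact: sf_value_mem.
rewrite (_ : (fun t => _) = (fun t => \sum_i \1_(sf_piece i) t *
    n (sf_eval s t) (@sf_value _ _ s i))); last by apply/funext.
apply: (@measurable_sum _ _ _ _ _ _ (fun i (t : measurableTypeR R) =>
  \1_(sf_piece i) t * n (sf_eval s t) (@sf_value _ _ s i))) => i.
apply: measurable_funM; first by apply: measurable_indic; exact: (@sf_piece_measurable _ _ s i).
exact: (measurable_linear_sf S0 S_lincomb s (ln _ (@sf_value_mem _ _ s i))).
Qed.

Let sp_norm_cvg0 (x : X) (s_ : nat -> simple_fun X) t : S x ->
  sp_norm (x - sf_eval (s_ m) t) @[m --> \oo] --> 0%E ->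
  N (x - sf_eval (s_ m) t) @[m --> \oo] --> (0 : R).
Proof.
move=> Sx cx; apply: (@fine_cvg R nat _ _ (fun m => (N (x - sf_eval (s_ m) t))%:E)).
apply: cvg_trans cx; apply: near_eq_cvg; apply: nearW => m.
by rewrite normE//; apply: S_B => //; exact: sf_eval_mem.
Qed.

(** The norm of u - s is the a.e. limit of the norms of the simple functions [sf_sub (s_ m) s],
    hence has a measurable version. *)
Lemma norm_version u s : strongly_measurable `]0, T[%classic u ->
  exists2 f : measurableTypeR R -> R, measurable_fun setT f /\ (forall t, 0 <= f t) &
    \forall t \ae leb, I t -> N (u t - sf_eval s t) = f t.
Proof.
move=> [s_ us].
have cv : \forall t \ae leb, I t ->
    N (sf_eval (sf_sub (s_ m) s) t) @[m --> \oo] --> N (u t - sf_eval s t).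
  apply: (@filterS _ _ (ae_filter_ringOfSetsType leb) _ _ _ us) => t + It => /(_ It)[Su cu].
  have Sm x : S (sf_eval x t) by exact: sf_eval_mem.
  apply/cvgrPdist_le => /= e e0.
  have {}cu := sp_norm_cvg0 Su cu.
  near=> m; rewrite sf_sub_eval.
  apply: le_trans (N_dist (S_B Su (Sm s)) (S_B (Sm (s_ m)) (Sm s))) _.
  rewrite opprB addrA subrK; apply: le_trans (ler_norm _) _; near: m.
  exact: (cvgr0_norm_le _ cu).
have [f mf fE] := ae_cvg_measurable mI (fun m => @measurable_norm_sf (sf_sub (s_ m) s) I) cv.
exists (fun t => `|(f \_ I) t|); first split => //.
  by apply: measurableT_comp => //; exact/(measurable_restrictT _ _).1.
apply: filterS fE => t fE It; rewrite patchE mem_set// -fE// ger0_norm//.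
Unshelve. all: by end_near. Qed.

(** What the evolution argument asks of [w], with integrable majorants in place of norms. It passes
    to the difference of two solutions by adding the majorants. *)
Definition simple_approximable w : Prop := exists (nu : R -> R) (s_ : nat -> simple_fun X) (e_ : nat -> R -> R),
  [/\ forall t, 0 <= nu t, leb.-integrable I (EFin \o nu),
      leb.-integrable I (fun t => (nu t ^+ 2)%:E) &
      \forall t \ae leb, I t -> S (w t) /\ N (w t) <= nu t] /\
  [/\ forall m, simple_approx T n w (s_ m) (e_ m),
      \forall t \ae leb, I t -> e_ m t @[m --> \oo] --> (0 : R) &
      \int[leb]_(t in I) e_ m t @[m --> \oo] --> (0 : R)].

Lemma bochner_L2_simple_approximable u :
  bochner_L2 `]0, T[%classic u -> simple_approximable u.
Proof.
move=> [us u2].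
have [nu [mnu nu0] nuE] := norm_version simple0 us.
have [s_ sE] := us.
have {}nuE : \forall t \ae leb, I t -> S (u t) /\ N (u t) = nu t.
  apply: (@filterS2 _ _ (ae_filter_ringOfSetsType leb) _ _ _ _ sE nuE) => t H1 H2 It; have [Su _] := H1 It; split => //.
  by rewrite -(H2 It) simple0_eval subr0.
have mnuI D : measurable_fun D nu by exact: measurable_funTS.
have nu2i : leb.-integrable I (fun t => (nu t ^+ 2)%:E).
  apply/(@ge0_integrable_lty _ _ R leb I (fun t => nu t ^+ 2)) => [|t _|].
  - exact: measurable_funX.
  - exact: sqr_ge0.
  apply: le_lt_trans u2; apply: ae_le_integral_lower => [t _|t _|].
  - by rewrite lee_fin sqr_ge0.
  - exact: sqre_ge0.
  - by apply: filterS nuE => t + It => /(_ It)[Su <-]; rewrite normE// EFin_expe.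
have nui : leb.-integrable I (EFin \o nu).
  have i1 : leb.-integrable I (EFin \o (fun=> 1)).
    by apply: (@integrable_bounded _ _ _ leb I (fun=> 1) 1) => // t _; rewrite normr1.
  apply: (@ae_le_integrable _ _ _ leb I nu (fun t => 1 + nu t ^+ 2)) => //.
    exact: (integrableD mI i1 nu2i).
  apply: nearW => t _; rewrite ger0_norm//; move: (nu t) => z; nra.
(* Strong measurability gives no domination; the approximations are set to 0
   where they exceed twice the norm of the limit. *)
pose A m := [set t : measurableTypeR R | N (sf_eval (s_ m) t) <= 2 * nu t].
have mA m : measurable (A m).
  rewrite -[A m]setTI; apply: measurable_fun_le => //.
    exact: measurable_norm_sf.
  by apply: measurable_funM.
pose r_ m := sf_restrict (mA m) (s_ m).
have /choice[e_ eE] : forall m, exists e : measurableTypeR R -> R,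
    (measurable_fun setT e /\ (forall t, 0 <= e t)) /\
    \forall t \ae leb, I t -> N (u t - sf_eval (r_ m) t) = e t.
  by move=> m; have [e ? ?] := norm_version (r_ m) us; exists e.
have eE0 m := (eE m).1.
have {}eE : \forall t \ae leb, forall m, I t -> N (u t - sf_eval (r_ m) t) = e_ m t.
  by apply/ae_foralln => m; exact: (eE m).2.
(* On [A m] the error is at most nu + 2 nu, off it the approximation is 0 and the error is nu; so 3
   nu dominates all errors. *)
have H : \forall t \ae leb, I t -> S (u t) /\ forall m, e_ m t <= 3 * nu t /\
    (A m t -> e_ m t = N (u t - sf_eval (s_ m) t)).
  apply: filterS2 nuE eE => t H1 H2 It; have [Su nuN] := H1 It; split => // m.
  have Sm : S (sf_eval (s_ m) t) by exact: sf_eval_mem.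
  rewrite -H2// sf_restrict_eval indicE; have [/set_mem Am|/negP Am] := boolP (t \in A m).
    rewrite scale1r; split => //; apply: le_trans (N_B Su Sm) _.
    by rewrite nuN; have : N (sf_eval (s_ m) t) <= 2 * nu t := Am; lra.
  by rewrite scale0r subr0 nuN; split=> [|/mem_set//]; have := nu0 t; lra.
have e_cvg : \forall t \ae leb, I t -> e_ m t @[m --> \oo] --> (0 : R).
  apply: (@filterS3 _ _ (ae_filter_ringOfSetsType leb) _ _ _ _ _ sE nuE H).
  move=> t H1 H2 H3 It; have [Su cu] := H1 It; have [_ nuN] := H2 It.
  have [_ {}H3] := H3 It; have e0 m : 0 <= e_ m t by exact: (eE0 m).2.
  have {}cu : N (u t - sf_eval (s_ m) t) @[m --> \oo] --> (0 : R).
    exact: (sp_norm_cvg0 Su cu).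
  (* If nu(t) > 0, the approximations are eventually within nu(t) of u(t), hence of norm at most 2
     nu(t), and the cut no longer acts; if nu(t) = 0, the bound 3 nu forces the error to be 0. *)
  apply/cvgrPdist_le => /= eps eps0; have [nut0|nut0] := eqVneq (nu t) 0.
    apply: nearW => m; have [le_e _] := H3 m.
    by rewrite sub0r normrN ger0_norm// (le_trans le_e)// nut0 mulr0 ltW.
  have nut : 0 < nu t by rewrite lt_def nut0 nu0.
  near=> m.
  have cm1 : `|N (u t - sf_eval (s_ m) t)| <= nu t.
    by near: m; exact: (cvgr0_norm_le _ cu).
  have cm2 : `|N (u t - sf_eval (s_ m) t)| <= eps.
    by near: m; exact: (cvgr0_norm_le _ cu).
  have Sm : S (sf_eval (s_ m) t) by exact: sf_eval_mem.
  have [_ ->] := H3 m; first by rewrite sub0r normrN.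
  rewrite /A/=; have := N_B Su (S_B Su Sm); rewrite subKr nuN.
  by move: cm1; rewrite ger0_norm ?sqrtr_ge0//; lra.
have me m : measurable_fun I (e_ m) by apply: measurable_funTS; exact: (eE0 m).1.
have nu3i : leb.-integrable I (EFin \o (fun t => 3 * nu t)) := integrableZl mI 3 nui.
have e_le : \forall t \ae leb, forall m, I t -> `|e_ m t| <= 3 * nu t.
  apply: filterS H => t H m It; have [_ /(_ m)[le_e _]] := H It.
  by rewrite ger0_norm//; exact: (eE0 m).2.
have [_ int_e] := dominated_convergence_Rintegral mI me (measurable_cst _) e_cvg nu3i e_le.
exists nu, r_, e_; split; split => //.
- by apply: filterS nuE => t + It => /(_ It)[Su ->].
- move=> m; split; [exact: (eE0 m).2| |by apply: filterS eE => t /(_ m) + It => ->].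
  apply: (ae_le_integrable (me m) nu3i); apply: filterS e_le => t; exact.
- by move: int_e; rewrite Rintegral_cst// mul0r.
Unshelve. all: by end_near. Qed.

Lemma simple_approximableB u v : simple_approximable u -> simple_approximable v ->
  simple_approximable (fun t => u t - v t).
Proof.
move=> [nu [s_ [e_ [[nu0 nui nu2i uN] [sa ec iec]]]]].
move=> [nu' [s'_ [e'_ [[nu0' nui' nu2i' vN] [sa' ec' iec']]]]].
exists (fun t => nu t + nu' t), (fun m => sf_sub (s_ m) (s'_ m)),
  (fun m t => e_ m t + e'_ m t).
have ei m : leb.-integrable I (EFin \o e_ m) by have [] := sa m.
have ei' m : leb.-integrable I (EFin \o e'_ m) by have [] := sa' m.
split; split.
- by move=> t; exact: addr_ge0.
- exact: (integrableD mI nui nui').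
- have i2 : leb.-integrable I (EFin \o (fun t => 2 * nu t ^+ 2 + 2 * nu' t ^+ 2)).
    exact: (integrableD mI (integrableZl mI 2 nu2i) (integrableZl mI 2 nu2i')).
  have mnu : measurable_fun I nu by apply/measurable_EFinP; exact: (measurable_int leb nui).
  have mnu' : measurable_fun I nu' by apply/measurable_EFinP; exact: (measurable_int leb nui').
  apply: (ae_le_integrable _ i2); first by apply: measurable_funX; exact: measurable_funD.
  apply: nearW => t _; rewrite ger0_norm ?sqr_ge0//.
  have := sqr_ge0 (nu t - nu' t); move: (nu t) (nu' t) => x y; nra.
- apply: filterS2 uN vN => t uN vN It; have [Su Nu] := uN It; have [Sv Nv] := vN It.
  split; first exact: S_B.
  by apply: le_trans (N_B Su Sv) _; exact: lerD.
- move=> m; have [e0 _ Ne] := sa m; have [e0' _ Ne'] := sa' m; split.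
  + by move=> t; exact: addr_ge0.
  + exact: (integrableD mI (ei m) (ei' m)).
  + have H : \forall t \ae leb, I t -> S (u t) /\ S (v t).
      by apply: filterS2 uN vN => t uN vN It; split; [exact: (uN It).1|exact: (vN It).1].
    apply: filterS3 H Ne Ne' => t Suv h h' It; have [Su Sv] := Suv It.
    have Sm : S (sf_eval (s_ m) t) by exact: sf_eval_mem.
    have Sm' : S (sf_eval (s'_ m) t) by exact: sf_eval_mem.
    rewrite sf_sub_eval (_ : _ - _ - _ = (u t - sf_eval (s_ m) t) - (v t - sf_eval (s'_ m) t)).
      by apply: le_trans (N_B (S_B Su Sm) (S_B Sv Sm')) _; apply: lerD; [exact: h|exact: h'].
    by rewrite !opprB addrACA [RHS]addrACA; congr (_ + _); exact: addrC.
- apply: filterS2 ec ec' => t c c' It; rewrite -[X in _ --> X](addr0 0).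
  by apply: cvgD; [exact: c|exact: c'].
- rewrite (_ : (fun m => _) = (fun m => \int[leb]_(t in I) e_ m t + \int[leb]_(t in I) e'_ m t)).
    by rewrite -[X in _ --> X](addr0 0); exact: cvgD.
  by apply/funext => m; rewrite (RintegralD mI (ei m) (ei' m)).
Qed.

End simple_approximation.

(** * Integration of the weak time derivative *)

Section bump_derivative.
Context (R : realType).
Local Notation leb := (@lebesgue_measure R).
Implicit Types (a b c x y : R).

Lemma Rintegral_segment_split (f : R -> R) a c b : a <= c -> c <= b ->
  leb.-integrable `[a, b] (EFin \o f) ->
  \int[leb]_(t in `[a, b]) f t = \int[leb]_(t in `[a, c]) f t + \int[leb]_(t in `[c, b]) f t.
Proof.
move=> ac cb fi; have := @Rintegral_itvB R f (BLeft a) (BRight b) c fi.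
rewrite !bnd_simp => /(_ ac cb) H.
have <- : \int[leb]_(t in `]c, b]) f t = \int[leb]_(t in `[c, b]) f t.
  apply: Rintegral_itv_obnd_cbnd; apply: integrableS fi => // t.
  rewrite /= !in_itv/= => /andP[ct ->]; by rewrite (le_trans ac (ltW ct)).
by rewrite -H addrC subrK.
Qed.

(** Where [p'] keeps one sign, recorded by [sg], the integral of its absolute value is |p(y) -
    p(x)|, so replacing [f] by the constant [L] costs at most [e] times that. *)
Lemma signed_deriv_integral (p p' f : R -> R) x y L e sg :
  (forall t, is_derive t (1 : R) p (p' t)) -> continuous p' -> x <= y ->
  {within `[x, y], continuous f} -> (forall t, x <= t <= y -> `|f t - L| <= e) ->
  `|sg| = 1 -> (forall t, x <= t <= y -> 0 <= sg * p' t) ->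
  `|\int[leb]_(t in `[x, y]) (p' t * f t) - L * (p y - p x)| <= e * `|p y - p x|.
Proof.
move=> dp cp' xy cf fL sg1 sg0.
have [p'i ip'] := ftc_segment dp cp' xy.
have mD : measurable (`[x, y]%classic : set (measurableTypeR R)) by exact: measurable_itv.
have cs (h : R -> R) : {within `[x, y], continuous h} -> leb.-integrable `[x, y] (EFin \o h).
  by move=> ch; apply: continuous_compact_integrable => //; exact: segment_compact.
have cp'w : {within `[x, y], continuous p'} by exact: continuous_subspaceT.
have p'fi : leb.-integrable `[x, y] (EFin \o (fun t => p' t * f t)).
  by apply: cs => t; apply: cvgM; [exact: cp'w|exact: cf].
have ip'R : \int[leb]_(t in `[x, y]) p' t = p y - p x by rewrite /Rintegral ip'.
have p'Li : leb.-integrable `[x, y] (EFin \o (fun t => L * p' t)) := integrableZl mD L p'i.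
rewrite -{1}ip'R -RintegralZl// -RintegralB//.
have di : leb.-integrable `[x, y] (EFin \o (fun t => p' t * f t - L * p' t)).
  exact: (integrableB mD p'fi p'Li).
apply: le_trans (le_normr_Rintegral mD di) _.
have sgi : leb.-integrable `[x, y] (EFin \o (fun t => e * sg * p' t)) := integrableZl mD (e * sg) p'i.
apply: (@le_trans _ _ (\int[leb]_(t in `[x, y]) (e * sg * p' t))).
  apply: le_Rintegral => //; first exact: integrable_norm.
  move=> t; rewrite /= in_itv/= => xty.
  rewrite [L * _]mulrC -mulrBr normrM mulrC -mulrA ler_pM ?fL//.
  by rewrite -[leLHS]mul1r -sg1 -normrM ger0_norm// sg0.
rewrite RintegralZl// ip'R -mulrA ler_wpM2l//.
  by apply: le_trans (fL x _); rewrite ?normr_ge0// lexx.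
by rewrite (le_trans (ler_norm _))// normrM sg1 mul1r.
Qed.

Lemma derive1_bump_ends k a b t : 0 < k -> (t == a) || (t == b) ->
  derive1 (bump k a b) t = 0.
Proof.
move=> k0 tab; rewrite derive1E bumpE.
have [_ ->] := is_derive_bumps a b [:: (1, 1)] t k0.
rewrite /bumps big1// => p _; rewrite /flat !subr_gt0.
by case/orP: tab => /eqP ->; rewrite ltxx ?mul0r ?mulr0.
Qed.

Lemma derive1_bump_left k a b t : 0 < k -> a < b -> a <= t <= (a + b) / 2 ->
  0 <= derive1 (bump k a b) t.
Proof.
move=> k0 ab /andP[]; rewrite le_eqVlt => /predU1P[<-|at_ tm].
  by rewrite derive1_bump_ends// eqxx.
have tb : t < b by lra.
rewrite derive1_bump ?at_// mulr_ge0 ?bump_ge0// mulr_ge0 ?(ltW k0)// subr_ge0.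
rewrite -!exprVn ler_pXn2r ?nnegrE ?invr_ge0 ?subr_ge0 ?(ltW at_) ?(ltW tb)//.
by rewrite lef_pV2 ?posrE ?subr_gt0//; lra.
Qed.

Lemma derive1_bump_right k a b t : 0 < k -> a < b -> (a + b) / 2 <= t <= b ->
  0 <= - 1 * derive1 (bump k a b) t.
Proof.
move=> k0 ab /andP[mt]; rewrite le_eqVlt mulN1r oppr_ge0 => /predU1P[->|tb].
  by rewrite derive1_bump_ends// eqxx orbT.
have at_ : a < t by lra.
rewrite derive1_bump ?at_// mulr_le0_ge0 ?bump_ge0// mulr_ge0_le0 ?(ltW k0)// subr_le0.
rewrite -!exprVn ler_pXn2r ?nnegrE ?invr_ge0 ?subr_ge0 ?(ltW at_) ?(ltW tb)//.
by rewrite lef_pV2 ?posrE ?subr_gt0//; lra.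
Qed.

(* The derivative of the bump is nonnegative left of the midpoint m and nonpositive
   right of it, so its mass concentrates at the end points: it is 1 - o(1) on [a, c]
   for any fixed c in ]a, m], and the mass left on [c, m] is o(1). *)
Lemma bump_derive_cvg (f : R -> R) a b : a < b -> {within `[a, b], continuous f} ->
  \int[leb]_(t in `[a, b]) (derive1 (bump n.+1%:R^-1 a b) t * f t) @[n --> \oo]
    --> f a - f b.
Proof.
move=> ab cf; set m := (a + b) / 2.
have am : a < m by rewrite /m; lra.
have mb : m < b by rewrite /m; lra.
have [M fM] : exists M, forall t, a <= t <= b -> `|f t| <= M.
  have cnf : {within `[a, b], continuous (fun t => `|f t|)}.
    by move=> t; apply: cvg_norm; exact: cf.
  have [c _ fc] := EVT_max (ltW ab) cnf.
  by exists `|f c| => t tab; apply: fc; rewrite in_itv.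
have M0 : 0 <= M by apply: le_trans (fM a _); rewrite ?normr_ge0// lexx ltW.
have /continuous_within_itvP[//|_ fa fb] := cf.
apply/cvgrPdist_le => /= e e0; have e4 : 0 < e / 4 by rewrite divr_gt0.
have [c [ac cm fac]] : exists c, [/\ a < c, c <= m & forall t, a <= t <= c -> `|f t - f a| <= e / 4].
  have /cvgrPdist_le/(_ _ e4) fanear := fa.
  have /= [r r0 Hr] := fanear.
  have r20 : 0 < r / 2 by rewrite divr_gt0.
  exists (Num.min m (a + r / 2)); split; [by rewrite lt_min am/= ltrDl|by rewrite ge_min lexx|].
  move=> t /andP[]; rewrite le_eqVlt => /predU1P[<- _|at_ tc].
    by rewrite subrr normr0 ltW.
  rewrite distrC; apply: Hr => //=; rewrite ltr_norml.
  by move: tc; rewrite le_min => /andP[_]; lra.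
have [d [db md fdb]] : exists d, [/\ d < b, m <= d & forall t, d <= t <= b -> `|f t - f b| <= e / 4].
  have /cvgrPdist_le/(_ _ e4) fbnear := fb.
  have /= [r r0 Hr] := fbnear.
  have r20 : 0 < r / 2 by rewrite divr_gt0.
  exists (Num.max m (b - r / 2)); split.
  - by rewrite gt_max mb/= ltrBlDr ltrDl.
  - by rewrite le_max lexx.
  move=> t /andP[dt]; rewrite le_eqVlt => /predU1P[->|tb].
    by rewrite subrr normr0 ltW.
  rewrite distrC; apply: Hr => //=; rewrite ltr_norml.
  by move: dt; rewrite ge_max => /andP[_]; lra.
(* The error has two parts e/4 near the end points, two parts 2 M e1 from the middle and two parts M
   e1 from the bump not being 1; thus 6 M e1 must be at most e/2. *)
pose e1 := e / (12 * (M + 1)).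
have M1 : 0 < M + 1 by rewrite ltr_wpDl.
have e10 : 0 < e1 by rewrite divr_gt0// mulr_gt0.
have Me1 : 6 * M * e1 <= e / 2.
  rewrite (_ : e / 2 = 6 * (M + 1) * e1); last by rewrite /e1; field; rewrite gt_eqF.
  by rewrite ler_pM2r//; lra.
have near1 x : a < x < b -> \forall n \near \oo, `|1 - bump n.+1%:R^-1 a b x| <= e1.
  move=> axb; have := @bump_cvg R a b x; rewrite indicE mem_set//= => H.
  by move/cvgrPdist_le : H; exact.
have cb : c < b by exact: le_lt_trans cm mb.
have ad : a < d by exact: lt_le_trans am md.
have acb : a < c < b by rewrite ac.
have adb : a < d < b by rewrite ad.
have amb : a < m < b by rewrite am.
near=> n.
have : `|1 - bump n.+1%:R^-1 a b c| <= e1 by near: n; exact: near1.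
have : `|1 - bump n.+1%:R^-1 a b d| <= e1 by near: n; exact: near1.
have : `|1 - bump n.+1%:R^-1 a b m| <= e1 by near: n; exact: near1.
set k : R := n.+1%:R^-1; set p := bump k a b => pm pd pc.
have k0 : 0 < k by rewrite invr_gt0 ltr0n.
have sp : smooth1 p by exact: smooth1_bump.
have dp t : is_derive t (1 : R) p (derive1 p t) := smooth1_is_derive 0 t sp.
have cp' : continuous (derive1 p) := @smooth1_continuous R p 1 sp.
have pa : p a = 0 by rewrite /p bump_out// ltxx.
have pb : p b = 0 by rewrite /p bump_out// ltxx andbF.
have pc1 : p c <= 1 by exact: bump_le1.
have pd1 : p d <= 1 by exact: bump_le1.
have pc0 : 0 <= p c by exact: bump_ge0.
have pd0 : 0 <= p d by exact: bump_ge0.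
have sub x y : a <= x -> y <= b -> {within `[x, y], continuous f}.
  move=> ax yb; apply: continuous_subspaceW cf => t; rewrite /= !in_itv/= => /andP[xt ty].
  by rewrite (le_trans ax xt) (le_trans ty yb).
have f0 x y : a <= x -> y <= b -> forall t, x <= t <= y -> `|f t - 0| <= M.
  move=> ax yb t /andP[xt ty]; rewrite subr0 fM//.
  by rewrite (le_trans ax xt) (le_trans ty yb).
have left_sign x y : a <= x -> y <= m -> forall t, x <= t <= y -> 0 <= 1 * derive1 p t.
  move=> ax ym t /andP[xt ty]; rewrite mul1r; apply: derive1_bump_left => //.
  by rewrite (le_trans ax xt) (le_trans ty ym).
have right_sign x y : m <= x -> y <= b -> forall t, x <= t <= y -> 0 <= - 1 * derive1 p t.
  move=> ax ym t /andP[xt ty]; apply: derive1_bump_right => //.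
  by rewrite (le_trans ax xt) (le_trans ty ym).
have n1 : `|1 : R| = 1 := normr1 R.
have nN1 : `|-1 : R| = 1 := normrN1 R.
have am' := ltW am; have mb' := ltW mb.
have I1 := signed_deriv_integral dp cp' (ltW ac) (sub a c (lexx a) (ltW cb)) fac n1
  (left_sign _ _ (lexx a) cm).
have I2 := signed_deriv_integral dp cp' cm (sub c m (ltW ac) mb') (f0 _ _ (ltW ac) mb') n1
  (left_sign _ _ (ltW ac) (lexx m)).
have I3 := signed_deriv_integral dp cp' md (sub m d am' (ltW db)) (f0 _ _ am' (ltW db)) nN1
  (right_sign _ _ (lexx m) (ltW db)).
have I4 := signed_deriv_integral dp cp' (ltW db) (sub d b (ltW ad) (lexx b)) fdb nN1
  (right_sign _ _ md (lexx b)).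
have gi x y : a <= x -> y <= b -> leb.-integrable `[x, y] (EFin \o (fun t => derive1 p t * f t)).
  move=> ax yb; apply: continuous_compact_integrable; first exact: segment_compact.
  by move=> t; apply: cvgM; [exact: continuous_subspaceT|exact: sub].
rewrite (@Rintegral_segment_split _ a m b)//; last exact: gi.
rewrite (@Rintegral_segment_split _ a c m) ?(ltW ac)//; last exact: gi.
rewrite (@Rintegral_segment_split _ m d b) ?(ltW db)//; last exact: gi.
move: I1 I2 I3 I4; rewrite pa pb subr0 sub0r normrN !mul0r !subr0 (ger0_norm pc0) (ger0_norm pd0).
move: (\int[leb]_(t in `[a, c]) _) (\int[leb]_(t in `[c, m]) _).
move: (\int[leb]_(t in `[m, d]) _) (\int[leb]_(t in `[d, b]) _) => i3 i4 i1 i2 I1 I2 I3 I4.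
have fa1 : `|f a * (1 - p c)| <= M * e1.
  by rewrite normrM ler_pM// fM// lexx ltW.
have fb1 : `|f b * (1 - p d)| <= M * e1.
  by rewrite normrM ler_pM// fM// lexx ltW.
have dist1 x y : `|1 - x| <= e1 -> `|1 - y| <= e1 -> `|x - y| <= 2 * e1.
  by clear; rewrite !ler_norml => /andP[? ?] /andP[? ?]; lra.
have I2' := le_trans I2 (ler_wpM2l M0 (dist1 _ _ pm pc)).
have I3' := le_trans I3 (ler_wpM2l M0 (dist1 _ _ pd pm)).
have I1' : `|i1 - f a * p c| <= e / 4.
  by apply: le_trans I1 _; rewrite ger_pMr.
have I4' : `|i4 + f b * p d| <= e / 4.
  by move: I4; rewrite mulrN opprK => /le_trans; apply; rewrite ger_pMr.
move: fa1 fb1 I1' I2' I3' I4' Me1; rewrite !ler_norml.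
rewrite !(mulrCA M 2 e1) -!(mulrA 6 M e1) !mulrBr !mulr1.
move: (M * e1) (f a * p c) (f b * p d) (f a) (f b) => Me fap fbp fa' fb'; clear.
move=> /andP[? ?] /andP[? ?] /andP[? ?] /andP[? ?] /andP[? ?] /andP[? ?] ?.
by apply/andP; split; lra.
Unshelve. all: by end_near. Qed.

End bump_derivative.

(** * Evaluating Bochner integrals of functionals *)

Section dual_evaluation.
Context (R : realType) (X : Defs.space R).
Local Notation leb := (@lebesgue_measure R).
Local Notation S := (@sp_mem R X).
Variable N : X -> R.
Hypothesis S0 : S 0.
Hypothesis S_lincomb : forall (k : R) (u v : X), S u -> S v -> S (k *: u + v).
Hypothesis N0 : N 0 = 0.
Hypothesis N_ge0 : forall v : X, 0 <= N v.
Hypothesis NZ : forall (k : R) (v : X), S v -> N (k *: v) = `|k| * N v.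
Hypothesis normE : forall v : X, S v -> sp_norm v = (N v)%:E.

Let SZ (k : R) (v : X) : S v -> S (k *: v).
Proof. by move=> Sv; rewrite -[k *: v]addr0; exact: S_lincomb. Qed.

Lemma bounded_functionalP (l : X -> R) : bounded_functional l <->
  linear_on l /\ exists C, forall v : X, S v -> `|l v| <= C * N v.
Proof.
by split=> -[ll [C lC]]; split => //; exists C => v Sv; have := lC v Sv;
  rewrite normE// -EFinM lee_fin.
Qed.

Lemma bounded_functional0 : bounded_functional (0 : X -> R).
Proof.
apply/bounded_functionalP; split=> [k u v _ _|]; first by rewrite mulr0 addr0.
by exists 0 => v _; rewrite normr0 mul0r.
Qed.

Lemma bounded_functional_lincomb k (l l' : X -> R) :
  bounded_functional l -> bounded_functional l' -> bounded_functional (k *: l + l').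
Proof.
move=> /bounded_functionalP[ll [C lC]] /bounded_functionalP[ll' [C' lC']].
apply/bounded_functionalP; split=> [r u v Su Sv|].
  change (k * l (r *: u + v) + l' (r *: u + v) =
    r * (k * l u + l' u) + (k * l v + l' v)).
  by rewrite ll// ll'//; ring.
exists (`|k| * C + C') => v Sv; change (`|k * l v + l' v| <= (`|k| * C + C') * N v).
rewrite (le_trans (ler_normD _ _))// mulrDl lerD ?lC'// normrM -mulrA.
by rewrite ler_wpM2l// lC.
Qed.

Lemma le_dual_norm (l : X -> R) (v : X) : S v -> N v <= 1 -> (`|l v|%:E <= dual_norm l)%E.
Proof.
by move=> Sv Nv; apply: ereal_sup_ubound; exists v => //; split => //; rewrite normE.
Qed.

Let eval_linear (v : X) : linear_on (fun l : dual X => (l : X -> R) v).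
Proof. by []. Qed.

(** Evaluation at [v] commutes with the integral of simple functions, and on the unit ball it is
    bounded by the dual norm; both approximation errors of the Bochner integral therefore pass to
    numbers. *)
Lemma bochner_integral_eval (D : set R) (F : R -> dual X) (J : dual X) (v : X) (phi : R -> R) :
  measurable (D : set (measurableTypeR R)) -> (leb D < +oo)%E ->
  is_bochner_integral D F J -> S v -> leb.-integrable D (EFin \o phi) ->
  (\forall t \ae leb, D t -> (F t : X -> R) v = phi t) ->
  (J : X -> R) v = \int[leb]_(t in D) phi t.
Proof.
move=> mD Dfin [[s0 Fmem] Jmem [s [Fs Js]]] Sv phii Fphi.
have D0 := bounded_functional0; have DS := bounded_functional_lincomb.
(* Rescaling by 1 + N(v) instead of N(v) avoids a division by zero, as N is only a seminorm. *)
wlog Nv1 : v phi Sv phii Fphi / N v <= 1.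
  move=> H; have c0 : 0 < 1 + N v by rewrite ltr_pwDl.
  have c1 : 1 + N v != 0 by rewrite gt_eqF.
  have vE : v = (1 + N v) *: ((1 + N v)^-1 *: v) by rewrite scalerA divff// scale1r.
  have Sv' := SZ (1 + N v)^-1 Sv.
  have lE (l : X -> R) : bounded_functional l -> l v = (1 + N v) * l ((1 + N v)^-1 *: v).
    move=> [ll _]; rewrite {1}vE -[_ *: (_ *: v)]addr0 ll//.
    by rewrite (linear_on0 S0 ll) addr0.
  have phii' : leb.-integrable D (EFin \o (fun t => (1 + N v)^-1 * phi t)).
    exact: (integrableZl mD (1 + N v)^-1 phii).
  rewrite (lE _ Jmem) (H ((1 + N v)^-1 *: v) (fun t => (1 + N v)^-1 * phi t))//.
  - by rewrite RintegralZl// mulrA divff// mul1r.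
  - apply: (@filterS2 _ _ (ae_filter_ringOfSetsType leb) _ _ _ _ Fmem Fphi) => t H1 H2 Dt.
    by rewrite -(H2 Dt) (lE _ (H1 Dt).1) mulrA mulVf// mul1r.
  - by rewrite NZ// ger0_norm ?invr_ge0 ?(ltW c0)// mulrC ler_pdivrMr// mul1r lerDr.
have bd m : (`|(J : X -> R) v - \int[leb]_(t in D) phi t|%:E <=
    sp_norm (J - sf_integral D (s m)) +
    \int[leb]_(t in D) sp_norm (F t - sf_eval (s m) t))%E.
  have evl := eval_linear v.
  have si := @integrable_linear_sf R (dual X) D0 DS _ (s m) D evl mD Dfin.
  have iE := @linear_sf_integral R (dual X) D0 DS _ (s m) D evl mD Dfin.
  have di : leb.-integrable D (EFin \o (fun t => (sf_eval (s m) t : X -> R) v - phi t)).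
    exact: (integrableB mD si phii).
  apply: (@le_trans _ _ (`|(J : X -> R) v - (sf_integral D (s m) : X -> R) v|%:E +
    `|\int[leb]_(t in D) ((sf_eval (s m) t : X -> R) v - phi t)|%:E)%E).
    rewrite -EFinD lee_fin RintegralB//.
    by move: iE => /= ->; rewrite (le_trans _ (ler_normD _ _))// addrA subrK.
  apply: leeD; first exact: (le_dual_norm (J - sf_integral D (s m))).
  rewrite EFin_normr_Rintegral//; apply: le_trans (le_abse_integral leb mD _) _.
    exact: (measurable_int leb di).
  apply: ae_le_integral_lower => //.
    move=> t _; apply: le_trans (le_dual_norm _ S0 _); last by rewrite N0.
    by rewrite lee_fin.
  apply: (@filterS2 _ _ (ae_filter_ringOfSetsType leb) _ _ _ _ Fmem Fphi) => t H1 H2 Dt.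
  rewrite /= -(H2 Dt) distrC.
  exact: (le_dual_norm (F t - sf_eval (s m) t)).
have cv : (sp_norm (J - sf_integral D (s m)) +
    \int[leb]_(t in D) sp_norm (F t - sf_eval (s m) t))%E @[m --> \oo] --> (0 + 0)%E.
  exact: cvgeD.
rewrite adde0 in cv.
have : (`|(J : X -> R) v - \int[leb]_(t in D) phi t|%:E <= 0)%E.
  rewrite -(cvg_lim _ cv)//.
  by apply: lime_ge; [apply/cvg_ex; exists 0%E|exact: nearW].
by rewrite lee_fin normr_le0 subr_eq0 => /eqP.
Qed.

End dual_evaluation.

Section weak_evolution.
Context (R : realType) (X : Defs.space R) (T : R).
Local Notation leb := (@lebesgue_measure R).
Local Notation S := (@sp_mem R X).
Local Notation I := (`]0, T[%classic : set (measurableTypeR R)).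
Variable N : X -> R.
Hypothesis S0 : S 0.
Hypothesis S_lincomb : forall (k : R) (u v : X), S u -> S v -> S (k *: u + v).
Hypothesis N0 : N 0 = 0.
Hypothesis N_ge0 : forall v : X, 0 <= N v.
Hypothesis NZ : forall (k : R) (v : X), S v -> N (k *: v) = `|k| * N v.
Hypothesis normE : forall v : X, S v -> sp_norm v = (N v)%:E.
Variables (bu u' : R -> X -> R).
Hypothesis u'_deriv : forall eta : R -> R, test_fun1 `]0, T[%classic eta ->
  exists2 J : dual X,
    is_bochner_integral `]0, T[%classic (fun t => eta t *: (u' t : dual X)) J &
    is_bochner_integral `]0, T[%classic
      (fun t => derive1 eta t *: (bu t : dual X)) (- J).
Variables (v : X) (f g : R -> R) (L : R).
Hypothesis Sv : S v.
Hypothesis gi : leb.-integrable I (EFin \o g).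
Hypothesis u'_g : \forall t \ae leb, I t -> u' t v = - g t.
Hypothesis bu_f : \forall t \ae leb, I t -> bu t v = f t.
Hypothesis f_continuous : forall t, 0 < t < T -> f s @[s --> t] --> f t.
Hypothesis f_0 : f t @[t --> 0^'+] --> L.

Let mI : measurable I := measurable_itv _.

Let Ifin : (leb I < +oo)%E.
Proof. by rewrite lebesgue_measure_itv/=; case: ifP => // _; rewrite -EFinB ltry. Qed.

Let f_within a b : 0 < a -> b < T -> {within `[a, b], continuous f}.
Proof.
move=> a0 bT; apply: continuous_in_subspaceT => t; rewrite inE/= in_itv/= => /andP[at_ tb].
by apply: f_continuous; rewrite (lt_le_trans a0 at_) (le_lt_trans tb bT).
Qed.

(** The weak derivative provides [J] and [- J] as Bochner integrals; both are evaluated at [v].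
    Outside [a, b] the derivative of the bump vanishes, so [f] is integrated only where it is
    continuous on a compact interval. *)
Lemma weak_evolution_bump k a b : 0 < k -> 0 < a -> a < b -> b < T ->
  \int[leb]_(t in `[a, b]) (derive1 (bump k a b) t * f t) =
  \int[leb]_(t in I) (bump k a b t * g t).
Proof.
move=> k0 a0 ab bT; set p := bump k a b.
have sp : smooth1 p by exact: smooth1_bump.
have cp : continuous p := @smooth1_continuous R p 0 sp.
have cp' : continuous (derive1 p) := @smooth1_continuous R p 1 sp.
have abI : `[a, b]%classic `<=` (`]0, T[%classic : set R).
  move=> t; rewrite /= !in_itv/= => /andP[at_ tb].
  by rewrite (lt_le_trans a0 at_) (le_lt_trans tb bT).
have mp : measurable_fun I p by apply: measurable_funTS; exact: continuous_measurable_fun.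
have mg : measurable_fun I g by apply/measurable_EFinP; exact: (measurable_int leb gi).
have pgi : leb.-integrable I (EFin \o (fun t => - (p t * g t))).
  apply: (@ae_le_integrable _ _ _ leb I _ (fun t => `|g t|)).
  - by apply: measurableT_comp => //; exact: measurable_funM.
  - exact: (integrable_norm gi).
  - by apply: nearW => t _; rewrite normrN normrM ger0_norm ?bump_ge0// ler_piMl// bump_le1.
have p'0 t : ~ (a <= t <= b) -> derive1 p t = 0.
  move=> tab; rewrite derive1E [RHS](_ : 0 = 'D_1 (cst (0 : R)) t); last by rewrite derive_cst.
  apply: (@near_eq_derive R R R); move/negP : tab; rewrite negb_and -!ltNge => /orP[ta|bt].
    near=> s; rewrite /p bump_out//; apply/negP; rewrite negb_and -!leNgt; apply/orP; left.
    by apply: ltW; near: s; exact: lt_nbhsl.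
  near=> s; rewrite /p bump_out//; apply/negP; rewrite negb_and -!leNgt; apply/orP; right.
  by apply: ltW; near: s; exact: lt_nbhsr.
pose h t := derive1 p t * f t.
have hi : leb.-integrable `[a, b] (EFin \o h).
  apply: continuous_compact_integrable; first exact: segment_compact.
  by move=> t; apply: cvgM; [exact: continuous_subspaceT|exact: f_within].
have mab : measurable (`[a, b]%classic : set (measurableTypeR R)) by exact: measurable_itv.
have hE : \int[leb]_(t in `[a, b]) h t = \int[leb]_(t in I) (h \_ `[a, b]) t.
  by rewrite -Rintegral_mkcondr setIidr.
have hIi : leb.-integrable I (EFin \o (h \_ `[a, b])).
  rewrite -restrict_EFin; apply: (integrableS measurableT mI (@subsetT _ _)).
  exact/(integrable_mkcond _ mab).
have [J J1 J2] := u'_deriv (test_fun1_bump k0 abI).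
have E1 : J v = \int[leb]_(t in I) - (p t * g t).
  apply: (bochner_integral_eval S0 S_lincomb N0 N_ge0 NZ normE mI Ifin J1 Sv pgi).
  by apply: filterS u'_g => t H It; rewrite -mulrN -H.
have E2 : - J v = \int[leb]_(t in I) (h \_ `[a, b]) t.
  apply: (bochner_integral_eval S0 S_lincomb N0 N_ge0 NZ normE mI Ifin J2 Sv hIi).
  apply: filterS bu_f => t H It; rewrite patchE /h -H//.
  case: ifPn => // /negP tab.
  transitivity (derive1 p t * bu t v) => //; rewrite p'0 ?mul0r// => tab'.
  by apply: tab; rewrite inE /= in_itv.
rewrite [LHS]hE -E2 E1 -[LHS]mulN1r -RintegralZl//; apply: eq_Rintegral => t _.
by rewrite mulN1r opprK.
Unshelve. all: by end_near. Qed.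

Let int_indic (E : set R) : measurable (E : set (measurableTypeR R)) -> E `<=` I ->
  \int[leb]_(t in I) (\1_E t * g t) = \int[leb]_(t in E) g t.
Proof.
move=> mE EI; rewrite -{2}(setIidr EI) Rintegral_mkcondr; apply: eq_Rintegral => t _.
by rewrite patchE indicE; case: ifPn; rewrite ?mul1r ?mul0r.
Qed.

Let mg : measurable_fun I g.
Proof. by apply/measurable_EFinP; exact: (measurable_int leb gi). Qed.

Let dct (p_ : nat -> R -> R) (E : set R) : measurable (E : set (measurableTypeR R)) ->
  E `<=` I -> (forall m, measurable_fun I (p_ m)) -> (forall m t, 0 <= p_ m t <= 1) ->
  (forall t, I t -> p_ m t @[m --> \oo] --> (\1_E t : R)) ->
  \int[leb]_(t in I) (p_ m t * g t) @[m --> \oo] --> \int[leb]_(t in E) g t.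
Proof.
move=> mE EI mp p01 pE; rewrite -int_indic//.
apply: (@dominated_convergence_Rintegral _ _ R leb I (fun m t => p_ m t * g t) _
  (fun t => `|g t|) mI _ _ _ (integrable_norm gi) _).2.
- by move=> m; exact: measurable_funM.
- by apply: measurable_funM => //; exact: measurable_indic.
- by apply: nearW => t It; apply: cvgM; [exact: pE|exact: cvg_cst].
- apply: nearW => t m _; have /andP[p0 p1] := p01 m t.
  by rewrite normrM ger0_norm// ler_piMl.
Qed.

Lemma weak_evolution_increment a b : 0 < a -> a < b -> b < T ->
  f a - f b = \int[leb]_(t in `]a, b[) g t.
Proof.
move=> a0 ab bT.
have c1 := bump_derive_cvg ab (f_within a0 bT).
have mE : measurable (`]a, b[%classic : set (measurableTypeR R)) by exact: measurable_itv.
have EI : `]a, b[%classic `<=` I.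
  by move=> t; rewrite /= !in_itv/= => /andP[at_ tb]; rewrite (lt_trans a0 at_) (lt_trans tb bT).
have k0 m : 0 < (m.+1%:R^-1 : R) by rewrite invr_gt0 ltr0n.
have c2 : \int[leb]_(t in I) (bump m.+1%:R^-1 a b t * g t) @[m --> \oo] -->
    \int[leb]_(t in `]a, b[) g t.
  apply: dct => // [m|m t|t _].
  - have cb : continuous (bump m.+1%:R^-1 a b).
      exact: (@smooth1_continuous R (bump m.+1%:R^-1 a b) 0 (smooth1_bump (k0 m))).
    by apply: measurable_funTS; exact: continuous_measurable_fun.
  - by rewrite bump_ge0 bump_le1.
  - exact: bump_cvg.
rewrite (_ : (fun m => _) = (fun m => \int[leb]_(t in I) (bump m.+1%:R^-1 a b t * g t))) in c1.
  exact: (cvg_unique (@Rhausdorff R) c1 c2).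
by apply/funext => m; rewrite weak_evolution_bump.
Qed.

Lemma weak_evolution_integral b : 0 < b -> b < T ->
  f b = L - \int[leb]_(t in `]0, b]) g t.
Proof.
move=> b0 bT.
pose a m : R := b / 2 * m.+1%:R^-1.
have b20 : 0 < b / 2 by rewrite divr_gt0.
have a0 m : 0 < a m by rewrite mulr_gt0// invr_gt0 ltr0n.
have ab m : a m < b.
  apply: (@le_lt_trans _ _ (b / 2)); last by lra.
  by rewrite ger_pMr// invf_le1 ?ler1n ?ltr0n.
have acvg : a m @[m --> \oo] --> (0 : R).
  by rewrite -(mulr0 (b / 2)); apply: cvgM; [exact: cvg_cst|exact: cvg_harmonic].
have c1 : f (a m) @[m --> \oo] --> L by apply: (cvg_at_rightP _ _ _).1 f_0 _ _.
have mE : measurable (`]0, b[%classic : set (measurableTypeR R)) by exact: measurable_itv.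
have EI : `]0, b[%classic `<=` I.
  by move=> t; rewrite /= !in_itv/= => /andP[-> tb]; rewrite (lt_trans tb bT).
have mam m : measurable (`]a m, b[%classic : set (measurableTypeR R)) by exact: measurable_itv.
have amI m : `]a m, b[%classic `<=` I.
  by move=> t; rewrite /= !in_itv/= => /andP[at_ tb]; rewrite (lt_trans (a0 m) at_) (lt_trans tb bT).
have c2 : \int[leb]_(t in I) (\1_`]a m, b[ t * g t) @[m --> \oo] -->
    \int[leb]_(t in `]0, b[) g t.
  apply: dct => // [m|m t|t _].
  - exact: measurable_indic.
  - by rewrite indicE; case: (_ \in _); rewrite ?lexx ?ler01.
  - apply: cvg_near_cst; have [tb|tb] := boolP (t \in `]0, b[).
      have /andP[t0 tb'] : 0 < t < b by move: tb; rewrite in_itv.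
      near=> m; rewrite !indicE !mem_set//= in_itv/= tb' andbT.
      by near: m; exact: (cvgr_lt _ acvg).
    apply: nearW => m; rewrite !indicE !memNset// => /= /[!in_itv]/= H; move: tb;
      rewrite in_itv/= => /negP; apply => //.
    by move/andP : H => [am ->]; rewrite (lt_trans (a0 m) am).
have c3 : f (a m) - f b @[m --> \oo] --> L - f b by apply: cvgB => //; exact: cvg_cst.
rewrite (_ : (fun m => _) = (fun m => \int[leb]_(t in I) (\1_`]a m, b[ t * g t))) in c3; last first.
  by apply/funext => m; rewrite weak_evolution_increment// int_indic.
have <- : \int[leb]_(t in `]0, b[) g t = \int[leb]_(t in `]0, b]) g t.
  by apply: Rintegral_itv_bndo_bndc; exact: (integrableS mI mE EI gi).
by rewrite -(cvg_unique (@Rhausdorff R) c3 c2); lra.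
Unshelve. all: by end_near. Qed.

End weak_evolution.

(** * Uniqueness of weak solutions *)

Section H120_solutions.
Context (R : realType) (n : nat) (U : set 'rV[R]_n.+2) (T : R).
Hypothesis oU : open U.
Hypothesis bU : bounded_set U.
Local Notation mu := (lebesgue_rV R n.+2).
Local Notation leb := (@lebesgue_measure R).
Local Notation I := (`]0, T[%classic : set (measurableTypeR R)).
Implicit Types (w : R -> L2 U) (z : 'rV[R]_n.+2 -> R).
Let mU : measurable U := open_measurable_rV oU.
Local Notation N u := (Num.sqrt (gradf U u u)).

Lemma test_fun0 : test_fun U 0.
Proof.
have s0 s : foldr (@pderiv R n.+2) 0 s = 0.
  elim: s => //= i s ->; apply/funext => x.
  by rewrite /pderiv (_ : 0 = cst 0 :> ('rV[R]_n.+2 -> R))// derive_cst.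
have e0 : [set x : 'rV[R]_n.+2 | (0 : 'rV[R]_n.+2 -> R) x != 0] = set0.
  by apply/seteqP; split => x //=; rewrite eqxx.
split; [|by rewrite e0 closure0; exact: compact0|by rewrite e0 closure0].
move=> s; rewrite s0; split => [|i x].
  exact: cst_continuous.
exact: (derivable_cst (0 : R)).
Qed.

Lemma H120_0 : H120_mem U 0.
Proof.
have H0 : H12_mem U 0 by exact: (test_fun_H12 oU bU test_fun0).
split => // e e0; exists 0; first exact: test_fun0.
rewrite subr0 (H12_normE oU)// lte_fin /H12f.
have -> : dotU U (0 : 'rV[R]_n.+2 -> R) 0 = 0.
  by rewrite /dotU; under eq_Rintegral do rewrite mul0r; rewrite Rintegral_cst// mul0r.
have := gradf_lincomb oU bU (-1) H0 H0 H0.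
by rewrite scaler0 addr0 mulN1r addNr => ->; rewrite addr0 sqrtr0.
Qed.

(** An arbitrary filter serves both uses: continuity of the pairing with [z] inside ]0, T[ and its
    limit at 0 from the right. *)
Lemma dotU_cvg (V : Type) (F : set_system V) (FF : Filter F)
    (w : V -> L2 U) (l : L2 U) z : (\forall s \near F, Lp U 2 (w s)) -> Lp U 2 l ->
  Lp U 2 z -> L2_norm U (w s - l) @[s --> F] --> 0%E ->
  dotU U (w s) z @[s --> F] --> dotU U l z.
Proof.
move=> Lw Ll Lz wl.
have LB (x y : 'rV[R]_n.+2 -> R) : Lp U 2 x -> Lp U 2 y -> Lp U 2 (x - y).
  by move=> Lx Ly; rewrite addrC -scaleN1r; exact: Lp2_lincomb.
have {}wl : Num.sqrt (dotU U (w s - l) (w s - l)) @[s --> F] --> (0 : R).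
  apply: (@fine_cvg R V F FF (fun s => (Num.sqrt (dotU U (w s - l) (w s - l)))%:E)).
  apply: cvg_trans wl; apply: near_eq_cvg; apply: filterS Lw => s Ls.
  by rewrite (L2_norm_dotU mU)//; exact: LB.
apply/cvgrPdist_le => /= e e0.
have C0 : 0 < Num.sqrt (dotU U z z) + 1 by rewrite ltr_wpDl ?sqrtr_ge0.
have /cvgr0_norm_le/(_ (e / (Num.sqrt (dotU U z z) + 1))) := wl.
rewrite divr_gt0// => /(_ isT) we; apply: filterS2 Lw we => s Ls we.
rewrite distrC.
have -> : dotU U (w s) z - dotU U l z = dotU U (w s - l) z.
  rewrite -[w s - l]addrC -scaleN1r (dotU_lincomb mU (-1) Ll Ls Lz).
  by rewrite mulN1r addrC.
apply: le_trans (dotU_cauchy_schwarz mU (LB _ _ Ls Ll) Lz) _.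
rewrite -(@divfK _ (Num.sqrt (dotU U z z) + 1) _ e) ?gt_eqF//.
apply: ler_pM; rewrite ?sqrtr_ge0//; last by rewrite lerDl.
exact: le_trans (ler_norm _) we.
Qed.

Let S0 := H120_0.
Let S_lincomb := H120_lincomb oU bU.
Let n_lincomb (k : R) u v z : H120_mem U u -> H120_mem U v -> H120_mem U z ->
  gradf U (k *: u + v) z = k * gradf U u z + gradf U v z.
Proof. by move=> [Hu _] [Hv _] [Hz _]; exact: gradf_lincomb. Qed.
Let nC u v (_ : H120_mem U u) (_ : H120_mem U v) : gradf U u v = gradf U v u := gradfC U u v.
Let n_ge0 u (_ : H120_mem U u) : 0 <= gradf U u u := gradf_ge0 U u.
Let normE u : H120_mem U u -> grad_norm U u = (N u)%:E.
Proof. by move=> [Hu _]; exact: grad_normE. Qed.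

Let g00 : gradf U 0 0 = 0.
Proof.
have := n_lincomb (-1) S0 S0 S0.
by rewrite scaler0 addr0 mulN1r addNr.
Qed.

Let N0 : N (0 : 'rV[R]_n.+2 -> R) = 0.
Proof. by rewrite g00 sqrtr0. Qed.

Let NZ (k : R) u : H120_mem U u -> N (k *: u) = `|k| * N u.
Proof.
move=> Hu; have g0u : gradf U 0 u = 0.
  have := n_lincomb (-1) S0 S0 Hu.
  by rewrite scaler0 addr0 mulN1r addNr.
have -> : gradf U (k *: u) (k *: u) = k ^+ 2 * gradf U u u.
  rewrite -[k *: u]addr0 (form_sqr S_lincomb n_lincomb nC k Hu S0).
  by rewrite g00 (nC Hu S0) g0u mulr0 mul0rn !addr0.
by rewrite sqrtrM ?sqr_ge0// sqrtr_sqr.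
Qed.

Variables (a : ('rV[R]_n.+2 -> R) -> ('rV[R]_n.+2 -> R) -> R) (Ca : R).
Hypothesis Ca0 : 0 <= Ca.
Hypothesis a_bounded : forall u v, H120_mem U u -> H120_mem U v ->
  `|a u v| <= Ca * N u * N v.
Hypothesis a_lincomb : forall (k : R) u v z, H120_mem U u -> H120_mem U v ->
  H120_mem U z -> a (k *: u + v) z = k * a u z + a v z.

Lemma form_version (u : R -> H120 U) z :
  simple_approximable T (@gradf R n.+2 U : H120 U -> H120 U -> R) u -> H120_mem U z ->
  exists2 g : measurableTypeR R -> R, leb.-integrable I (EFin \o g) &
    \forall t \ae leb, I t -> a (u t) z = g t.
Proof.
move=> [nu [s_ [e_ [[nu0 nui nu2i uN] [sa ec iec]]]]] Hz.
have uS : \forall t \ae leb, I t -> H120_mem U (u t).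
  by apply: filterS uN => t + It => /(_ It)[].
have uN' : \forall t \ae leb, I t -> N (u t) <= nu t.
  by apply: filterS uN => t + It => /(_ It)[].
have al : @linear_on R (H120 U) (fun x => a x z).
  exact: (fun k x y Sx Sy => a_lincomb k Sx Sy Hz).
have aC (x : H120 U) : sp_mem x -> `|a x z| <= Ca * N z * N x.
  by move=> Sx; rewrite mulrAC; exact: a_bounded.
have C0 : 0 <= Ca * N z := mulr_ge0 Ca0 (sqrtr_ge0 _).
exact: (@bounded_linear_version R (H120 U) T (@gradf R n.+2 U) S0 S_lincomb u nu uS nui uN'
  s_ e_ sa ec _ _ al C0 aC).
Qed.

(** Through the L^2 embedding, pairing u(t) with [z] is the L^2 product, which the continuous
    version turns into a continuous function of time; the abstract integrated equation then applies
    with initial value (g, z). *)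
Lemma weak_solution_integral (u : R -> H120 U) (u' : R -> Hm12 U) w (g : L2 U) :
  bochner_L2 `]0, T[%classic u -> is_time_derivative T u u' ->
  is_continuous_version T u w -> Lp U 2 g -> sp_norm (w t - g) @[t --> 0^'+] --> 0%E ->
  (forall z, H120_mem U z -> \forall t \ae leb, I t -> (u' t : H120 U -> R) z + a (u t) z = 0) ->
  forall z, H120_mem U z -> \forall t \ae leb, I t ->
    dotU U (u t) z = dotU U g z - \int[leb]_(r in `]0, t]) a (u r) z.
Proof.
move=> u2 uu' [wL wc uw] gL w0 ueq z Hz.
have uapp := @bochner_L2_simple_approximable R (H120 U) T (@gradf R n.+2 U) S0 S_lincomb n_lincomb nC n_ge0 normE _ u2.
have [h hi uh] := form_version uapp Hz.
have Lz : Lp U 2 z by have [[]] := Hz.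
pose f t := dotU U (w t) z.
have cT t : I t -> (`[0, T]%classic : set R) t.
  by rewrite /= !in_itv/= => /andP[/ltW -> /ltW ->].
have bu_f : \forall t \ae leb, I t -> (L2_to_Hm12 (u t) : H120 U -> R) z = f t.
  apply: (@filterS _ _ (ae_filter_ringOfSetsType leb) _ _ _ uw) => t uwt It.
  apply: dotU_ae_eq; [exact: (uwt It)|exact: aeW].
have u'_h : \forall t \ae leb, I t -> (u' t : H120 U -> R) z = - h t.
  apply: filterS2 (ueq z Hz) uh => t + + It => /(_ It)/eqP + /(_ It) ha.
  by rewrite addr_eq0 => /eqP ->; rewrite ha.
have fc t : 0 < t < T -> f s @[s --> t] --> f t.
  move=> t0T; have It : I t by rewrite /= in_itv.
  have ti : (`[0, T]%classic : set R)° t.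
    by rewrite interior_itv_bnd/= in_itv.
  suff : f s @[s --> within (`[0, T]%classic : set R) (nbhs t)] --> f t.
    by rewrite (within_interior ti).
  apply: dotU_cvg => //; [|exact: wL (cT _ It)|exact: wc (cT _ It)].
  by apply: filterS (withinT _ _) => s; exact: wL.
have T0 t : I t -> 0 < T by rewrite /= in_itv/= => /andP[/lt_trans]; exact.
(* For T <= 0 the interval is empty; otherwise there are points of [0, T] to the right of 0. *)
have [T_gt0|T_le0] := ltP 0 T; last first.
  by apply: nearW => t /T0; rewrite ltNge T_le0.
have f0 : f t @[t --> 0^'+] --> dotU U g z.
  apply: dotU_cvg => //.
  near=> t; apply: wL; rewrite /= in_itv/=; apply/andP; split; first by apply: ltW; near: t; exact: nbhs_right_gt.
  by near: t; exact: nbhs_right_le.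
apply: filterS (bu_f) => t ft It.
have /andP[t0 tT] : 0 < t < T by move: It; rewrite /= in_itv.
transitivity (f t); first exact: ft It.
have N_ge0 (x : H120 U) : 0 <= N x := sqrtr_ge0 _.
rewrite (@weak_evolution_integral R (H120 U) T (fun x => N x) S0 S_lincomb N0 N_ge0 NZ normE
  _ _ uu' z f h _ Hz hi u'_h bu_f fc f0 t t0 tT); congr (_ - _).
apply: ae_eq_Rintegral; apply: filterS uh => r uh; rewrite /= in_itv/= => /andP[r0 rt].
by rewrite uh// /= in_itv/= r0 (le_lt_trans rt tT).
Unshelve. all: by end_near. Qed.

Variable Ka : R.
Hypothesis Ka0 : 0 <= Ka.
Hypothesis a_garding : forall u, H120_mem U u -> - (Ka * dotU U u u) <= a u u.

Let b_lincomb (k : R) u v z : H120_mem U u -> H120_mem U v -> H120_mem U z ->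
  dotU U (k *: u + v) z = k * dotU U u z + dotU U v z.
Proof. by move=> [[Lu _] _] [[Lv _] _] [[Lz _] _]; exact: dotU_lincomb. Qed.
Let bC u v (_ : H120_mem U u) (_ : H120_mem U v) : dotU U u v = dotU U v u := dotUC U u v.
Let b_ge0 u (_ : H120_mem U u) : 0 <= dotU U u u := dotU_ge0 U u.

Let b_bounded : exists2 Cb : R, 0 <= Cb & forall u v, H120_mem U u -> H120_mem U v ->
  `|dotU U u v| <= Cb * N u * N v.
Proof.
have [P P0 HP] := poincare oU bU; exists P; first exact: P0.
move=> u v Hu Hv; have [[Lu _] _] := Hu; have [[Lv _] _] := Hv.
apply: le_trans (dotU_cauchy_schwarz mU Lu Lv) _.
have := HP u Hu; have := HP v Hv.
move: (dotU U u u) (dotU U v v) (gradf U u u) (gradf U v v) => bu bv nu nv lev leu.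
have -> : P * Num.sqrt nu * Num.sqrt nv = (Num.sqrt P * Num.sqrt nu) * (Num.sqrt P * Num.sqrt nv).
  by rewrite mulrACA -expr2 sqr_sqrtr// mulrA.
by apply: ler_pM; rewrite ?sqrtr_ge0// -sqrtrM// ler_wsqrtr.
Qed.

Lemma weak_solution_unique (u v : R -> H120 U) (u' v' : R -> Hm12 U) (wu wv : R -> L2 U)
    (g : L2 U) : Lp U 2 g ->
  bochner_L2 `]0, T[%classic u -> is_time_derivative T u u' ->
  is_continuous_version T u wu -> sp_norm (wu t - g) @[t --> 0^'+] --> 0%E ->
  (forall z, H120_mem U z -> \forall t \ae leb, I t -> (u' t : H120 U -> R) z + a (u t) z = 0) ->
  bochner_L2 `]0, T[%classic v -> is_time_derivative T v v' ->
  is_continuous_version T v wv -> sp_norm (wv t - g) @[t --> 0^'+] --> 0%E ->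
  (forall z, H120_mem U z -> \forall t \ae leb, I t -> (v' t : H120 U -> R) z + a (v t) z = 0) ->
  bochner_H120_eq T u v.
Proof.
move=> gL u2 uu' uw u0 ueq v2 vv' vw v0 veq.
have ui := weak_solution_integral u2 uu' uw gL u0 ueq.
have vi := weak_solution_integral v2 vv' vw gL v0 veq.
have uapp := @bochner_L2_simple_approximable R (H120 U) T (@gradf R n.+2 U) S0 S_lincomb
  n_lincomb nC n_ge0 normE _ u2.
have vapp := @bochner_L2_simple_approximable R (H120 U) T (@gradf R n.+2 U) S0 S_lincomb
  n_lincomb nC n_ge0 normE _ v2.
have uS : \forall t \ae leb, I t -> H120_mem U (u t).
  by have [nu [s_ [e_ [[_ _ _ uN] _]]]] := uapp; apply: filterS uN => t + It => /(_ It)[].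
have vS : \forall t \ae leb, I t -> H120_mem U (v t).
  by have [nu [s_ [e_ [[_ _ _ uN] _]]]] := vapp; apply: filterS uN => t + It => /(_ It)[].
have bB x y z : H120_mem U x -> H120_mem U y -> H120_mem U z ->
    dotU U (x - y) z = dotU U x z - dotU U y z.
  move=> Hx Hy Hz; rewrite [x - y]addrC -scaleN1r (b_lincomb (-1) Hy Hx Hz).
  by rewrite mulN1r addrC.
have aB x y z : H120_mem U x -> H120_mem U y -> H120_mem U z ->
    a (x - y) z = a x z - a y z.
  move=> Hx Hy Hz; rewrite [x - y]addrC -scaleN1r (a_lincomb (-1) Hy Hx Hz).
  by rewrite mulN1r addrC.
have weq z : H120_mem U z -> \forall t \ae leb, I t ->
    dotU U (u t - v t) z = - \int[leb]_(r in `]0, t]) a (u r - v r) z.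
  move=> Hz; have [h hi uh] := form_version uapp Hz; have [k ki vk] := form_version vapp Hz.
  have wh : \forall t \ae leb, I t -> a (u t - v t) z = h t - k t.
    apply: filterS2 (filterI uS vS) (filterI uh vk) => t [Hu Hv] [ut vt] It.
    by rewrite -(ut It) -(vt It); exact: aB (Hu It) (Hv It) Hz.
  apply: filterS2 (filterI (uS) (vS)) (filterI (ui z Hz) (vi z Hz)) => t [Hu Hv] [ut vt] It.
  rewrite (bB _ _ _ (Hu It) (Hv It) Hz) (ut It) (vt It).
  have /andP[t0 tT] : 0 < t < T by move: It; rewrite /= in_itv.
  have mD : measurable (`]0, t]%classic : set (measurableTypeR R)) by exact: measurable_itv.
  have DI : `]0, t]%classic `<=` I.
    by move=> r; rewrite /= !in_itv/= => /andP[-> rt]; exact: le_lt_trans rt tT.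
  have mI : measurable I by exact: measurable_itv.
  have sub (f1 f2 : R -> R) : (\forall t \ae leb, I t -> f1 t = f2 t) ->
      \int[leb]_(r in `]0, t]) f1 r = \int[leb]_(r in `]0, t]) f2 r.
    by move=> f12; apply: ae_eq_Rintegral; apply: filterS f12 => r + Dr => /(_ (DI _ Dr)).
  rewrite (sub _ _ uh) (sub _ _ vk) (sub _ _ wh).
  rewrite (RintegralB mD (integrableS mI mD DI hi) (integrableS mI mD DI ki)).
  (* Both integrated equations carry the same initial term (g, z), which cancels. *)
  move: (dotU U g z) (\int[leb]_(r in _) h r) (\int[leb]_(r in _) k r) => *; ring.
have [Cb Cb0 b_bd] := b_bounded.
have [nu [s_ [e_ [[nu0 nui nu2i wN] [sa ec iec]]]]] :=
  @simple_approximableB R (H120 U) T (@gradf R n.+2 U) S0 S_lincomb n_lincomb nC n_ge0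
  u v uapp vapp.
have wS : \forall t \ae leb, I t -> H120_mem U (u t - v t).
  by apply: filterS wN => t + It => /(_ It)[].
have wN' : \forall t \ae leb, I t -> N (u t - v t : 'rV[R]_n.+2 -> R) <= nu t.
  by apply: filterS wN => t + It => /(_ It)[].
have w0 := @evolution_eq0 R (H120 U) T (@gradf R n.+2 U) (@dotU R n.+2 U) a S0 S_lincomb
  n_lincomb nC n_ge0 b_lincomb bC b_ge0 a_lincomb Ca Cb Ka Ca0 Cb0 Ka0 a_bounded b_bd
  a_garding (fun t => u t - v t) nu wS nu0 nui nu2i wN' s_ e_ sa ec iec weq.
apply: (@filterS2 _ _ (ae_filter_ringOfSetsType leb) _ _ _ _ wS w0) => t Hw w0t It.
have [[Lw _] _] := Hw It.
have := dotU_eq0 mU Lw (w0t It).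
apply: filterS => x wx Ux; apply/eqP; rewrite -subr_eq0; apply/eqP; exact: wx Ux.
Qed.

End H120_solutions.

Theorem theorem3p6 (R : realType) (d : nat) (d_ge2 : (2 <= d)%N)
    (U : set 'rV[R]_d) (U_bounded : bounded_set U) (U_open : open U)
    (q : R) (q_d2 : d = 2%N -> 2 < q) (q_d3 : (3 <= d)%N -> q = d%:R)
    (H : 'rV[R]_d -> 'rV[R]_d)
    (H_Lq : forall i : 'I_d, Lp U q (fun x => H x ord0 i))
    (h : 'rV[R]_d -> R) (h_Lq : Lp U q h)
    (H_le_h : \forall x \ae lebesgue_rV R d, U x -> eucl_norm (H x) <= h x)
    (A : 'rV[R]_d -> 'M[R]_d)
    (A_measurable : forall i j : 'I_d, Lebesgue_measurable (fun x => A x i j))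
    (M lambda : R) (M_gt0 : 0 < M) (lambda_gt0 : 0 < lambda)
    (A_bounded : \forall x \ae lebesgue_rV R d,
       forall i j : 'I_d, `|A x i j| <= M)
    (A_elliptic : \forall x \ae lebesgue_rV R d,
       forall xi : 'rV[R]_d,
         lambda * eucl_norm xi ^+ 2 <= dot (xi *m (A x)^T) xi)
    (theta : R) (theta_ge0 : 0 <= theta)
    (s : R) (s_d2 : d = 2%N -> 1 < s) (s_d3 : (3 <= d)%N -> s = d%:R / 2)
    (c : 'rV[R]_d -> R) (c_Ls : Lp U s c)
    (c_ge0 : \forall x \ae lebesgue_rV R d, U x -> 0 <= c x)
    (T : R) (T_gt0 : 0 < T) (g : L2 U) (g_L2 : sp_mem g)
    (u v : R -> H120 U)
    (u_sol : weak_solution T A H c theta g u)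
    (v_sol : weak_solution T A H c theta g v) :
  bochner_H120_eq T u v.
Proof.
destruct d as [|[|n]]; [by []|by []|].
have mU : measurable U := open_measurable_rV U_open.
(* The cases d = 2 and d >= 3 merge: only q > 2 with q >= d, and s > 1 with 2 s >= d, are used from
   here on. *)
have [q2 dq] : 2 < q /\ n.+2%:R <= q.
  case: n {U U_bounded U_open H H_Lq h h_Lq H_le_h A A_measurable A_bounded A_elliptic c
    c_Ls c_ge0 g g_L2 u v u_sol v_sol mU d_ge2 s_d2 s_d3} q_d2 q_d3 => [/(_ erefl) q2 _|n _ /(_ isT) ->].
    by split=> //; exact: ltW.
  by rewrite ltr_nat.
have [s1 ds] : 1 < s /\ n.+2%:R <= 2 * s.
  case: n {U U_bounded U_open H H_Lq h h_Lq H_le_h A A_measurable A_bounded A_elliptic c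
    c_Ls c_ge0 g g_L2 u v u_sol v_sol mU d_ge2 q_d2 q_d3 dq} s_d2 s_d3 => [/(_ erefl) s1 _|n _ /(_ isT) ->].
    by split=> //; rewrite ler_pMr// ltW.
  by rewrite ltr_pdivlMr// mul1r ltr_nat mulrC divfK.
have q0 : 0 < q by exact: lt_trans q2.
have s0 : 0 < s by exact: lt_trans s1.
(* The entries of [A] are replaced by Borel versions; [B] equals [A] a.e., so the bounds persist and
   the elliptic form is unchanged. *)
have /choice[B0 HB0] : forall p : 'I_n.+2 * 'I_n.+2, exists f : 'rV[R]_n.+2 -> R,
    measurable_fun setT f /\ \forall x \ae lebesgue_rV R n.+2, A x p.1 p.2 = f x.
  by move=> p; have [f mf Af] := completed_measurable_fun_ae (A_measurable p.1 p.2); exists f.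
pose B x : 'M[R]_n.+2 := \matrix_(i, j) B0 (i, j) x.
have mB i j : measurable_fun [set: 'rV[R]_n.+2] (fun x => B x i j).
  rewrite (_ : (fun x => _) = B0 (i, j)); first exact: (HB0 (i, j)).1.
  by apply/funext => x; rewrite mxE.
have AB : \forall x \ae lebesgue_rV R n.+2, A x = B x.
  have : \forall x \ae lebesgue_rV R n.+2, forall p, A x p.1 p.2 = B0 p x.
    by apply: filter_forall => p; exact: (HB0 p).2.
  by apply: filterS => x Ax; apply/matrixP => i j; rewrite mxE -(Ax (i, j)).
have B_bounded : \forall x \ae lebesgue_rV R n.+2, forall i j, `|B x i j| <= M.
  by apply: filterS2 AB A_bounded => x <-.
have B_elliptic : \forall x \ae lebesgue_rV R n.+2, forall xi : 'rV[R]_n.+2,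
    lambda * eucl_norm xi ^+ 2 <= dot (xi *m (B x)^T) xi.
  by apply: filterS2 AB A_elliptic => x <-.
have mH i : measurable_fun U (fun x => H x ord0 i) by have [] := (LpP mU _ q0).1 (H_Lq i).
have [mh hq] := (LpP mU _ q0).1 h_Lq.
(* The drift enters through the weight h^2, which is in L^(q/2); its exponent meets the conditions
   q/2 > 1 and d <= 2 (q/2). *)
pose W x := h x ^+ 2.
have mW : measurable_fun U W by exact: measurable_funX.
have W0 x : 0 <= W x := sqr_ge0 _.
have q1 : 1 < q / 2 by rewrite ltr_pdivlMr// mul1r.
have dq2 : n.+2%:R <= 2 * (q / 2) by rewrite mulrC divfK.
have Wq : (\int[lebesgue_rV R n.+2]_(x in U) (W x `^ (q / 2))%:E < +oo)%E.
  rewrite (_ : (fun x => _) = (fun x => (`|h x| `^ q)%:E))//; apply/funext => x.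
  by rewrite /W -real_normK ?num_real// -powR_mulrn// -powRrM mulrC divfK.
have HW : \forall x \ae lebesgue_rV R n.+2, U x -> eucl_norm (H x) <= Num.sqrt (W x).
  by apply: filterS H_le_h => x + Ux => /(_ Ux)/le_trans; apply; rewrite sqrtr_sqr ler_norm.
have [mc cs] := (LpP mU _ s0).1 c_Ls.
have a_lin := aform_lincomb U_open U_bounded mB B_bounded mH mW W0 q1 dq2 Wq HW mc s1 ds cs theta_ge0.
have [Ca Ca0 a_bd] := aform_bounded U_open U_bounded mB B_bounded mH mW W0 q1 dq2 Wq HW mc s1 ds cs
  theta_ge0.
have [K K0 a_gar] := aform_garding U_open U_bounded mB lambda_gt0 B_bounded B_elliptic mH mW W0 q1 dq2
  Wq HW mc s1 ds cs c_ge0 theta_ge0.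
have aE x y : aform U A H c theta x y = aform U B H c theta x y.
  apply: ae_eq_Rintegral; apply: filterS AB => z Az _.
  by rewrite /diff_term Az.
have [u2 [u' [_ uu' ueq]] [wu [uw u0]]] := u_sol.
have [v2 [v' [_ vv' veq]] [wv [vw v0]]] := v_sol.
apply: (weak_solution_unique U_open U_bounded Ca0 a_bd a_lin K0 a_gar g_L2 u2 uu' uw u0 _ v2 vv' vw v0).
  by move=> z Hz; apply: (@filterS _ _ (ae_filter_ringOfSetsType (@lebesgue_measure R)) _ _ _ (ueq z Hz)) => t + It => /(_ It) <-; rewrite -aE.
by move=> z Hz; apply: (@filterS _ _ (ae_filter_ringOfSetsType (@lebesgue_measure R)) _ _ _ (veq z Hz)) => t + It => /(_ It) <-; rewrite -aE.
Qed.
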